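(* Let $\pi : (M, g_0) \rightarrow (N, g_N)$ be a Riemannian submersion with minimal fibers. If there exists a non-trivial variation $\{ g_t, t \in (-\epsilon, \epsilon) \} \subset \mathrm{Riem}(M, \mathcal{V}, g_0)$ such that $\pi : (M, g_t) \rightarrow (N, g_N)$ is a Riemannian submersion with minimal fibers for all $t \in (-\epsilon, \epsilon)$, then there exists a non-trivial vertical vector field $\xi$ on $M$ whose restriction to $(\mathcal{F}_{x} , g_0 \vert_{\mathcal{F}_{x}})$ is divergence-free for all $x \in N$. On the other hand, if on $(M, g_0)$ there exists a non-trivial bounded vertical vector field $\xi$ whose restriction to every fiber of $\pi$ (with the metric induced by $g_0$) is divergence-free, then there exists a non-trivial variation $\{ g_t, t \in (-\epsilon, \epsilon) \} \subset \mathrm{Riem}(M, \mathcal{V}, g_0)$ such that $\pi : (M, g_t) \rightarrow (N, g_N)$ is a Riemannian submersion with minimal fibers for all $t \in (-\epsilon, \epsilon)$.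
   Context: Manifolds are smooth, connected and oriented; all functions and tensor fields are smooth. A Riemannian submersion $\pi:(M,g)\to(N,g_N)$ is a smooth map with $\operatorname{rank}\pi_*=\dim N$ and $g(X,Y)=g_N(\pi_*X,\pi_*Y)$ for all $X,Y$ that are $g$-orthogonal to $\ker\pi_*$. $\mathcal{V}=\ker\pi_*$ is the vertical distribution, $n=\dim\mathcal{V}$; vertical vector fields are those with values in $\mathcal{V}$; $\mathcal{F}_x=\pi^{-1}(\{x\})$ is the fiber over $x\in N$. $\mathrm{Riem}(M,\mathcal{V},g_0)$ is the set of Riemannian metrics $g$ on $M$ with $g(X,Y)=g_0(X,Y)$ for all vertical $X,Y$. A variation of $g_0$ is a one-parameter family $\{g_t, t\in(-\epsilon,\epsilon)\}\subset \mathrm{Riem}(M,\mathcal{V},g_0)$ depending smoothly on $t$, whose member at $t=0$ is $g_0$; it is non-trivial if $g_t\neq g_0$ for some $t$. A vector field is non-trivial if it is not everywhere zero, and bounded on $(M,g)$ if $g(X,X)$ is a bounded function. The second fundamental form of the fibers is $h_t(X,Y)=P_{\mathcal{H}}^t\nabla^t_XY$ for vertical $X,Y$, where $\nabla^t$ is the Levi-Civita connection of $g_t$ and $P_{\mathcal{H}}^t$ is the $g_t$-orthogonal projection onto the $g_t$-orthogonal complement $\mathcal{H}(t)$ of $\mathcal{V}$; the mean curvature of the fibers is $H_t=\sum_{a=1}^n h_t(E_a,E_a)$ for a local $g_t$-orthonormal frame $\{E_1,\ldots,E_n\}$ of $\mathcal{V}$. The fibers of $\pi:(M,g_t)\to(N,g_N)$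 are minimal if $H_t=0$.
   Formalization: N is assumed to have dimension at least 1; for dim N = 0 (e.g. M = S³ over a point) every vector field is vertical and Riem(M, V, g_0) = {g_0}, so a bounded divergence-free field exists but no non-trivial variation does, and the second claim fails. *)

(* Defs.v *)
From HB Require Import structures.
From mathcomp Require Import all_boot all_order all_algebra.
From mathcomp Require Import all_classical all_reals all_analysis.
Set Implicit Arguments.
Unset Strict Implicit.
Unset Printing Implicit Defensive.
Import Order.TTheory GRing.Theory Num.Theory.
Import numFieldNormedType.Exports.
Local Open Scope classical_set_scope.
Local Open Scope ring_scope.

(* Smoothness on an open set A of a normed space (finite-dimensional in all
   uses below): the iterated directional derivatives of all orders exist and
   are Frechet differentiable at every point of A.  Only the germs of f at the
   points of A matter. *)
Fixpoint diff_order {R : realType} {V W : normedModType R} (k : nat)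
    (A : set V) (f : V -> W) : Prop :=
  if k is k'.+1 then
    (forall x, A x -> differentiable f x) /\
    (forall v, diff_order k' A ('D_v f))
  else True.

Definition smooth_on {R : realType} {V W : normedModType R}
    (A : set V) (f : V -> W) : Prop :=
  forall k, diff_order k A f.

(* The values of chart_map off chart_dom, and of chart_inv off
   chart_map @` chart_dom, are irrelevant. *)
Record chart (R : realType) (T : topologicalType) (m : nat) := Chart {
  chart_dom : set T;
  chart_map :> T -> 'rV[R]_m;
  chart_inv : 'rV[R]_m -> T;
  chart_dom_open : open chart_dom;
  chart_cod_open : open (chart_map @` chart_dom);
  chart_mapK : forall p, chart_dom p -> chart_inv (chart_map p) = p;
  chart_map_continuous :
    forall p, chart_dom p -> {for p, continuous chart_map};
  chart_inv_continuous :
    forall x, (chart_map @` chart_dom) x -> {for x, continuous chart_inv} }.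

(* Smooth connected oriented m-manifold.  The atlas is the family of the
   chart_at p; it is smooth and its transition maps have positive Jacobian
   determinant.  The preferred chart chart_at p also serves to identify the
   tangent space T_pM with 'rV[R]_m. *)
Record manifold (R : realType) (m : nat) := Manifold {
  points :> topologicalType;
  chart_at : points -> chart R points m;
  chart_atP : forall p, chart_dom (chart_at p) p;
  transition_smooth : forall p q,
    smooth_on (chart_at p @` (chart_dom (chart_at p) `&` chart_dom (chart_at q)))
      (chart_at q \o chart_inv (chart_at p));
  transition_oriented : forall p q r,
    chart_dom (chart_at p) r -> chart_dom (chart_at q) r ->
    0 < \det ('J (chart_at q \o chart_inv (chart_at p)) (chart_at p r));
  manifold_hausdorff : hausdorff_space points;
  manifold_second_countable : @second_countable points;
  manifold_connected : connected [set: points] }.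

Section LocalGeometry.
Variables (R : realType) (m : nat).

Definition inner (G : 'M[R]_m) (u v : 'rV[R]_m) : R := (u *m G *m v^T) 0 0.

Definition basis_vec (i : 'I_m) : 'rV[R]_m := delta_mx 0 i.

(* Gamma(u, v)^k = u^i v^j Gamma^k_ij at x, with
   Gamma^k_ij = 1/2 G^kl (d_i G_jl + d_j G_il - d_l G_ij). *)
Definition christoffel (G : 'rV[R]_m -> 'M[R]_m) (x u v : 'rV[R]_m) : 'rV[R]_m :=
  (\row_l (2^-1 * (inner ('D_u G x) v (basis_vec l)
                   + inner ('D_v G x) u (basis_vec l)
                   - inner ('D_(basis_vec l) G x) u v))) *m invmx (G x).

(* Levi-Civita covariant derivative of the metric G on an open set of R^m. *)
Definition cov_deriv (G : 'rV[R]_m -> 'M[R]_m) (X Y : 'rV[R]_m -> 'rV[R]_m)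
    (x : 'rV[R]_m) : 'rV[R]_m :=
  'D_(X x) Y x + christoffel G x (X x) (Y x).

(* trace of v |-> nabla_v X *)
Definition divergence (G : 'rV[R]_m -> 'M[R]_m) (X : 'rV[R]_m -> 'rV[R]_m)
    (x : 'rV[R]_m) : R :=
  \sum_i (cov_deriv G (cst (basis_vec i)) X x) 0 i.

(* The connection above is the Levi-Civita one: symmetric Christoffel symbols
   (no torsion), and D_w G (u, v) = G(Gamma(w,u), v) + G(u, Gamma(w,v))
   (compatibility with the metric). *)
Lemma christoffelC (G : 'rV[R]_m -> 'M[R]_m) (x u v : 'rV[R]_m) :
  (forall w, ('D_w G x)^T = 'D_w G x) ->
  christoffel G x u v = christoffel G x v u.
Proof.
move=> DGs; rewrite /christoffel; congr (_ *m _); apply/rowP => l.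
rewrite !mxE; congr (_ * _).
rewrite [in RHS]addrC [in RHS](addrC (inner _ _ _) (inner _ _ _)).
rewrite [in RHS]addrC; congr (_ - _).
by rewrite /inner -[in LHS]DGs -{1}[u]trmxK -!trmx_mul mulmxA mxE.
Qed.

Lemma christoffel_metric (G : 'rV[R]_m -> 'M[R]_m) (x u v w : 'rV[R]_m) :
  differentiable G x -> G x \in unitmx -> (G x)^T = G x ->
  (forall z, ('D_z G x)^T = 'D_z G x) ->
  inner ('D_w G x) u v
  = inner (G x) (christoffel G x w u) v + inner (G x) u (christoffel G x w v).
Proof.
move=> dG Gu Gs DGs.
have innerC (A : 'M[R]_m) a b : A^T = A -> inner A a b = inner A b a.
  by move=> As; rewrite /inner -[in LHS]As -{1}[a]trmxK -!trmx_mul mulmxA mxE.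
have lower a b : inner (G x) (christoffel G x w a) b =
    2^-1 * (inner ('D_w G x) a b + inner ('D_a G x) w b - inner ('D_b G x) w a).
  have innerE A c : inner A c b = \sum_l b 0 l * inner A c (basis_vec l).
    rewrite /inner mxE; apply: eq_bigr => l _.
    by rewrite /basis_vec trmx_delta -colE !mxE mulrC.
  have DbE : inner ('D_b G x) w a = \sum_l b 0 l * inner ('D_(basis_vec l) G x) w a.
    rewrite deriveE // [in LHS](row_sum_delta b) linear_sum /inner.
    rewrite mulmx_sumr mulmx_suml summxE; apply: eq_bigr => l _.
    by rewrite linearZ /= -scalemxAr -scalemxAl mxE deriveE.
  rewrite innerE [X in _ = _ * (X + _ - _)]innerE [X in _ = _ * (_ + X - _)]innerE DbE.
  rewrite -big_split -sumrB mulr_sumr; apply: eq_bigr => l _ /=.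
  rewrite {1}/inner /christoffel mulmxKV // /basis_vec trmx_delta -colE.
  by rewrite !mxE -mulrDr -mulrBr mulrCA.
rewrite (innerC (G x) u) // !lower (innerC _ v u) //.
rewrite -mulrDr; set a := inner _ u v; set b := inner _ w v; set c := inner _ w u.
have -> : a + b - c + (a + c - b) = 2 * a.
  by rewrite -[a + b - c]addrA -[a + c - b]addrA -[c - b]opprB addrACA subrr addr0 mulr_natl mulr2n.
by rewrite mulKf // pnatr_eq0.
Qed.

End LocalGeometry.

Section Manifolds.
Variables (R : realType) (m : nat) (M : manifold R m).

(* Rows are the coordinates, in the tangent spaces of M, of the partial
   derivatives of the map s from an open set of R^k to M. *)
Definition param_diff (k : nat) (s : 'rV[R]_k -> M) (u : 'rV[R]_k) : 'M[R]_(k, m) :=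
  'J (chart_at (s u) \o s) u.

(* A section g : M -> 'M[R]_m is a field of bilinear forms: g p is the Gram
   matrix in the preferred coordinates of T_pM.  This is its pull-back by s. *)
Definition pullback (k : nat) (g : M -> 'M[R]_m) (s : 'rV[R]_k -> M)
    (u : 'rV[R]_k) : 'M[R]_k :=
  param_diff s u *m g (s u) *m (param_diff s u)^T.

Definition metric_in_chart (g : M -> 'M[R]_m) (c : chart R M m) :
    'rV[R]_m -> 'M[R]_m :=
  pullback g (chart_inv c).

Definition field_in_chart (X : M -> 'rV[R]_m) (c : chart R M m)
    (x : 'rV[R]_m) : 'rV[R]_m :=
  let q := chart_inv c x in
  X q *m 'J (c \o chart_inv (chart_at q)) (chart_at q q).

Definition smooth_field_on (U : set M) (X : M -> 'rV[R]_m) : Prop :=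
  forall p, smooth_on (chart_at p @` (U `&` chart_dom (chart_at p)))
                      (field_in_chart X (chart_at p)).

Definition riemannian (g : M -> 'M[R]_m) : Prop :=
  [/\ forall p, (g p)^T = g p,
      forall p v, v != 0 -> 0 < inner (g p) v v
    & forall p, smooth_on (chart_at p @` chart_dom (chart_at p))
                          (metric_in_chart g (chart_at p))].

(* Levi-Civita connection at p, computed in the preferred chart at p, whose
   coordinates are those of T_pM. *)
Definition levi_civita (g : M -> 'M[R]_m) (X Y : M -> 'rV[R]_m) (p : M) : 'rV[R]_m :=
  cov_deriv (metric_in_chart g (chart_at p)) (field_in_chart X (chart_at p))
    (field_in_chart Y (chart_at p)) (chart_at p p).

(* Smooth dependence on (t, p) of a family g t, for t in ]-eps, eps[. *)
Definition smooth_family (eps : R) (g : R -> M -> 'M[R]_m) : Prop :=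
  forall p, smooth_on
    (`]- eps, eps[%classic `*` (chart_at p @` chart_dom (chart_at p)))
    (fun tx : R^o * 'rV[R]_m => metric_in_chart (g tx.1) (chart_at p) tx.2).

Definition bounded_field (g : M -> 'M[R]_m) (X : M -> 'rV[R]_m) : Prop :=
  exists C : R, forall p, `|inner (g p) (X p) (X p)| <= C.

End Manifolds.

Section Submersions.
Variables (R : realType) (m d : nat) (M : manifold R m) (N : manifold R d).
Variable pi : M -> N.

Definition smooth_map : Prop :=
  continuous pi /\
  forall p q, smooth_on
    (chart_at p @` (chart_dom (chart_at p) `&` pi @^-1` chart_dom (chart_at q)))
    (chart_at q \o pi \o chart_inv (chart_at p)).

(* matrix of pi_* : T_pM -> T_(pi p)N, acting on row vectors on the right *)
Definition map_diff (p : M) : 'M[R]_(m, d) :=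
  'J (chart_at (pi p) \o pi \o chart_inv (chart_at p)) (chart_at p p).

(* Subspaces of T_pM are row spaces of matrices. *)
Definition vertical (p : M) : 'M[R]_m := kermx (map_diff p).

Definition horizontal (g : M -> 'M[R]_m) (p : M) : 'M[R]_m :=
  kermx (g p *m (vertical p)^T).

Definition horizontal_proj (g : M -> 'M[R]_m) (p : M) (v : 'rV[R]_m) : 'rV[R]_m :=
  v *m proj_mx (horizontal g p) (vertical p).

Definition riemannian_submersion (g : M -> 'M[R]_m) (gN : N -> 'M[R]_d) : Prop :=
  [/\ smooth_map,
      forall p, \rank (map_diff p) = d
    & forall p (X Y : 'rV[R]_m),
        (X <= horizontal g p)%MS -> (Y <= horizontal g p)%MS ->
        inner (g p) X Y
        = inner (gN (pi p)) (X *m map_diff p) (Y *m map_diff p)].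

(* Riem(M, V, g0) *)
Definition Riem (g0 g : M -> 'M[R]_m) : Prop :=
  riemannian g /\
  forall p (X Y : 'rV[R]_m),
    (X <= vertical p)%MS -> (Y <= vertical p)%MS ->
    inner (g p) X Y = inner (g0 p) X Y.

Definition nontrivial_variation (g0 : M -> 'M[R]_m) (eps : R)
    (g : R -> M -> 'M[R]_m) : Prop :=
  [/\ 0 < eps,
      forall t, t \in `]- eps, eps[ -> Riem g0 (g t),
      smooth_family eps g,
      g 0 = g0
    & exists2 t, t \in `]- eps, eps[ & g t <> g0].

Definition vertical_frame (n : nat) (g : M -> 'M[R]_m) (U : set M)
    (E : 'I_n -> M -> 'rV[R]_m) : Prop :=
  [/\ forall a, smooth_field_on U (E a),
      forall a p, U p -> (E a p <= vertical p)%MS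
    & forall a b p, U p -> inner (g p) (E a p) (E b p) = (a == b)%:R].

Definition second_fundamental_form (g : M -> 'M[R]_m) (X Y : M -> 'rV[R]_m)
    (p : M) : 'rV[R]_m :=
  horizontal_proj g p (levi_civita g X Y p).

Definition mean_curvature (n : nat) (g : M -> 'M[R]_m)
    (E : 'I_n -> M -> 'rV[R]_m) (p : M) : 'rV[R]_m :=
  \sum_(a < n) second_fundamental_form g (E a) (E a) p.

(* n is the dimension of the fibers *)
Definition minimal_fibers (n : nat) (g : M -> 'M[R]_m) : Prop :=
  forall (U : set M) (E : 'I_n -> M -> 'rV[R]_m),
    open U -> vertical_frame g U E ->
    forall p, U p -> mean_curvature g E p = 0.

(* s is the inverse of a chart of the n-dimensional embedded submanifold
   pi^-1(x): an immersion which is a homeomorphism of the open set A of R^n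
   onto an open subset of the fiber. *)
Definition fiber_param (n : nat) (x : N) (A : set 'rV[R]_n)
    (s : 'rV[R]_n -> M) : Prop :=
  [/\ open A,
      forall u, A u -> {for u, continuous s} /\ pi (s u) = x,
      forall p, smooth_on (A `&` s @^-1` chart_dom (chart_at p)) (chart_at p \o s),
      forall u, A u -> \rank (param_diff s u) = n
    & {in A &, injective s} /\
      forall B : set 'rV[R]_n, open B -> B `<=` A ->
        exists2 O : set M, open O & s @` B = O `&` pi @^-1` [set x]].

(* The restriction of the vertical field xi to the fiber pi^-1(x) has zero
   divergence for the metric induced by g: in every parametrization s, where
   xi has components X. *)
Definition div_free_on_fiber (n : nat) (g : M -> 'M[R]_m) (xi : M -> 'rV[R]_m)
    (x : N) : Prop :=
  forall (A : set 'rV[R]_n) (s : 'rV[R]_n -> M)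
    (X : 'rV[R]_n -> 'rV[R]_n),
    fiber_param x A s ->
    (forall u, A u -> X u *m param_diff s u = xi (s u)) ->
    forall u, A u -> divergence (pullback g s) X u = 0.

Definition vertical_field (xi : M -> 'rV[R]_m) : Prop :=
  smooth_field_on setT xi /\ forall p, (xi p <= vertical p)%MS.

Definition nontrivial_field (xi : M -> 'rV[R]_m) : Prop :=
  exists p, xi p != 0.

End Submersions.

Arguments minimal_fibers {R m d M N} pi n g.
Arguments div_free_on_fiber {R m d M N} pi n g xi x.

(* Main.v *)
(* Let f be a function on N and X_t the g_t-gradient of f o pi.  For a vertical
   field E, g_t(nabla^t_E E, X_t) = - g_t(nabla^t_E X_t, E), and
   g_t(nabla^t_E X_t, E) is half the Lie derivative of g_t along X_t on (E, E),
   which depends only on g_t along the fibers because [X_t, E] is vertical: X_t is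
   projectable, with projection the g_N-gradient of f.  As all the g_t agree on
   vertical vectors, the mean curvatures of g_t and g_0 paired with d(f o pi) differ
   by the trace on the fiber of half the Lie derivative of g_0 along the vertical
   field X_t - X_0, i.e. by the fiberwise divergence of X_t - X_0.

   If both mean curvatures vanish, X_t - X_0 is divergence-free, and it is nonzero
   for some f since g_t is determined by g_0 on the fibers and by these gradients.
   Conversely, given xi, choose F on N with d(F o pi) <> 0 at a point where xi <> 0
   and set g_t = A_t g_0 A_t^T with A_t = 1 - t d(F o pi) (x) xi.  This shear fixes
   vertical vectors and commutes with pi_*, and X_t - X_0 is the product of xi with
   t g_N(grad f, grad F) o pi, a function constant on the fibers, hence
   divergence-free. *)

Require Import Defs.
From HB Require Import structures.
From mathcomp Require Import all_boot all_order all_algebra.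
From mathcomp Require Import all_classical all_reals all_analysis.
From mathcomp Require Import ring lra.
Set Implicit Arguments.
Unset Strict Implicit.
Unset Printing Implicit Defensive.
Import Order.TTheory GRing.Theory Num.Theory.
Import numFieldNormedType.Exports.
Local Open Scope classical_set_scope.
Local Open Scope ring_scope.

(** * Calculus of smooth maps *)

(** The submersion condition is used in dual form: with [P] the matrix of [pi_*], [P^T g^-1 P] is
    the inverse of [gN]. Horizontal spaces, which move with the metric, drop out: the gradient of
    [phi o pi] is [dphi^T P^T g^-1], its projectability is a single use of the chain rule, and a
    metric can be recovered from its values on [ker P] together with [P^T g^-1]. Minimality is
    quantified over local vertical frames and fiberwise divergence over parametrizations of the
    fibers, so both kinds of objects have to be produced around every point. This is what calls for
    a smooth orthonormalization and for the inverse function theorem. Symmetry of second derivatives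
    enters twice: in the verticality of the bracket of a gradient with a vertical field, and in the
    comparison of the intrinsic divergence on a fiber with a trace computed in the ambient chart. *)

Section DiffOrder.
Variable R : realType.
Implicit Types V W : normedModType R.

Lemma diff_orderW V W k (A : set V) (f : V -> W) :
  diff_order k.+1 A f -> diff_order k A f.
Proof.
elim: k f => [//|k IH] f [df Df]; split=> // v; exact: IH (Df v).
Qed.

Lemma diff_order_subset V W k (A B : set V) (f : V -> W) : B `<=` A ->
  diff_order k A f -> diff_order k B f.
Proof.
move=> sBA; elim: k f => [//|k IH] f [df Df]; split=> [x Bx|v].
  exact: df (sBA _ Bx).
exact: IH (Df v).
Qed.

(** Only germs at the points of [A] matter, so a different local formula, for instance in another
    chart, may be used around each point. *)
Lemma diff_order_pointwise V W k (A : set V) (f : V -> W) :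
  (forall x, A x -> diff_order k [set x] f) -> diff_order k A f.
Proof.
elim: k f => [//|k IH] f h; split=> [x Ax|v].
  by case: (h x Ax) => df _; apply: df.
by apply: IH => x Ax; case: (h x Ax) => _ /(_ v).
Qed.

Lemma near_eq_differentiable V W (f g : V -> W) x :
  (\forall y \near x, f y = g y) -> differentiable f x -> differentiable g x.
Proof.
move=> fg /diff_locallyP[df fe].
have fgx : f x = g x by exact: nbhs_singleton fg.
suff h : g \o shift x = cst (g x) + 'd f x +o_ 0 id.
  have := @diff_unique R V W g ('d f x) x df h => dgf.
  by apply/diff_locallyP; rewrite dgf.
apply/eqaddoP => _/posnumP[e].
move/eqaddoP : fe => /(_ e%:num) /(_ [gt0 of e%:num]) fe.
near=> y.
have -> : (g \o shift x - (cst (g x) + 'd f x)) y = (f \o shift x - (cst (f x) + 'd f x)) y.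
  rewrite /= fgx; congr (_ - _).
  rewrite !fctE /=; symmetry; near: y.
  by have := fg; rewrite (near_shift 0) subr0; exact.
near: y; exact: fe.
Unshelve. all: by end_near. Qed.

Lemma diff_order_near V W k (A : set V) (f g : V -> W) :
  (forall x, A x -> \forall y \near x, f y = g y) ->
  diff_order k A f -> diff_order k A g.
Proof.
elim: k f g => [//|k IH] f g fg [df Df]; split=> [x Ax|v].
  exact: near_eq_differentiable (fg _ Ax) (df _ Ax).
(* [near_join] gives equality near every [y] close to [x], so the directional derivatives also have
   equal germs. *)
apply: IH (Df v) => x /fg /near_join; apply: filterS => y fgy.
exact: near_eq_derive.
Qed.

Lemma diff_order_eq V W k (A : set V) (f g : V -> W) : open A ->
  {in A, f =1 g} -> diff_order k A f -> diff_order k A g.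
Proof.
move=> oA fg; apply: diff_order_near => x Ax.
apply: filterS (open_nbhs_nbhs (conj oA Ax)) => y Ay; apply: fg; exact/mem_set.
Qed.

Lemma smooth_onP V W (A : set V) (f : V -> W) :
  smooth_on A f <-> (forall x, A x -> differentiable f x) /\
    (forall v, smooth_on A ('D_v f)).
Proof.
split=> [h|[h1 h2] [//|k]]; last by split=> // v; exact: h2.
by split=> [|v k]; [case: (h 1%N)|case: (h k.+1) => _ /(_ v)].
Qed.

End DiffOrder.

(** * Closure of differentiability of finite order under algebra and composition *)

Section DiffOrderAlgebra.
Variable R : realType.
Implicit Types V W : normedModType R.

Lemma diff_order_cst V W k (A : set V) (c : W) : diff_order k A (fun=> c).
Proof.
elim: k c => [//|k IH] c; split=> [x _|v]; first exact: differentiable_cst.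
by rewrite (_ : 'D_v (fun=> c) = fun=> 0)//; apply/funext => x; exact: derive_cst.
Qed.

Lemma diff_order_id V k (A : set V) : diff_order k A (fun x : V => x).
Proof.
case: k => [//|k]; split=> [x _|v]; first exact: ex_diff.
rewrite (_ : 'D_v (fun x : V => x) = fun=> v); first exact: diff_order_cst.
by apply/funext => x; exact: derive_id.
Qed.

Lemma diff_orderD V W k (A : set V) (f g : V -> W) : open A ->
  diff_order k A f -> diff_order k A g -> diff_order k A (fun x => f x + g x).
Proof.
move=> oA; elim: k f g => [//|k IH] f g [df Df] [dg Dg]; split=> [x Ax|v].
  by apply: differentiableD; [exact: df|exact: dg].
apply: diff_order_eq (IH _ _ (Df v) (Dg v)) => // x /set_mem Ax.
by symmetry; apply: deriveD; apply: diff_derivable; [exact: df|exact: dg].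
Qed.

Lemma diff_order_sum V W k (A : set V) (I : Type) (r : seq I) (P : pred I)
  (F : I -> V -> W) : open A -> (forall i, diff_order k A (F i)) ->
  diff_order k A (fun x => \sum_(i <- r | P i) F i x).
Proof.
move=> oA hF; elim: r => [|i r IH].
  by under eq_fun do rewrite big_nil; exact: diff_order_cst.
under eq_fun do rewrite big_cons.
by case: (P i) => //; exact: diff_orderD.
Qed.

Lemma derive_comp V W (Z : normedModType R) (f : V -> W) (g : W -> Z) x v :
  differentiable f x -> differentiable g (f x) ->
  'D_v (g \o f) x = 'D_('D_v f x) g (f x).
Proof.
move=> df dg; rewrite deriveE; last exact: differentiable_comp.
by rewrite diff_comp//= [RHS]deriveE// [in RHS]deriveE.
Qed.

Lemma diff_order_linear V W (Z : normedModType R) k (A : set V) (f : V -> W)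
    (L : {linear W -> Z}) : open A -> continuous L ->
  diff_order k A f -> diff_order k A (L \o f).
Proof.
move=> oA cL; elim: k f => [//|k IH] f [df Df]; split=> [x Ax|v].
  by apply: differentiable_comp; [exact: df|exact: linear_differentiable].
apply: diff_order_eq (IH _ (Df v)) => // x /set_mem Ax /=.
have dL := @linear_differentiable _ _ _ L (f x) cL.
by rewrite derive_comp//; [rewrite [RHS]deriveE// diff_lin|exact: df].
Qed.

Lemma diff_orderM V k (A : set V) (f g : V -> R) : open A ->
  diff_order k A f -> diff_order k A g -> diff_order k A (fun x => f x * g x).
Proof.
move=> oA; elim: k f g => [//|k IH] f g hf hg; have [df Df] := hf.
have [dg Dg] := hg; split=> [x Ax|v].
  by apply: differentiableM; [exact: df|exact: dg].
have h : diff_order k A (fun x => f x * 'D_v g x + g x * 'D_v f x).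
  apply: diff_orderD => //; apply: IH => //; by [exact: diff_orderW|exact: Df|exact: Dg].
apply: diff_order_eq h => // x /set_mem Ax; symmetry.
by rewrite [LHS]deriveM//; apply: diff_derivable; [exact: df|exact: dg].
Qed.

Lemma diff_orderN V k (A : set V) (f : V -> R) : open A ->
  diff_order k A f -> diff_order k A (fun x => - f x).
Proof.
move=> oA hf; under eq_fun do rewrite -mulN1r.
by apply: diff_orderM => //; exact: diff_order_cst.
Qed.

Lemma diff_order_prod V k (A : set V) (I : Type) (r : seq I) (P : pred I)
  (F : I -> V -> R) : open A -> (forall i, diff_order k A (F i)) ->
  diff_order k A (fun x => \prod_(i <- r | P i) F i x).
Proof.
move=> oA hF; elim: r => [|i r IH].
  by under eq_fun do rewrite big_nil; exact: diff_order_cst.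
under eq_fun do rewrite big_cons.
by case: (P i) => //; exact: diff_orderM.
Qed.

Lemma diff_order_comp1 V k (A : set V) (B : set R) (f : V -> R) (h : R -> R) :
  open A -> (forall x, A x -> B (f x)) ->
  diff_order k A f -> diff_order k B h -> diff_order k A (h \o f).
Proof.
move=> oA fAB; elim: k f h fAB => [//|k IH] f h fAB hf [dh Dh].
have [df Df] := hf; split=> [x Ax|v].
  by apply: differentiable_comp; [exact: df|apply: dh; exact: fAB].
have H : diff_order k A (fun x => ('D_1 h \o f) x * 'D_v f x).
  apply: diff_orderM => //; last exact: Df.
  by apply: (IH _ _ fAB); [exact: diff_orderW|exact: Dh].
apply: diff_order_eq H => // x /set_mem Ax /=.
have dfx := df x Ax; have dhx := dh _ (fAB _ Ax).
rewrite [RHS](derive_comp _ dfx dhx) [RHS]deriveE//.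
by rewrite -[X in _ = 'd h _ X]mulr1 [RHS]linearZ_LR /= -deriveE// mulrC.
Qed.

(** The derivative [- f^-2 Df] involves [1/f] at one order less, so induction on [k] closes. *)
Lemma diff_orderV V k (A : set V) (f : V -> R) : open A ->
  (forall x, A x -> f x != 0) ->
  diff_order k A f -> diff_order k A (fun x => (f x)^-1).
Proof.
move=> oA f0; elim: k => [//|k IH] hf; have [df Df] := hf; split=> [x Ax|v].
  by apply: differentiableV; [exact: df|exact: f0].
have h : diff_order k A (fun x => - ((f x)^-1 * (f x)^-1) * 'D_v f x).
  apply: diff_orderM => //; last exact: Df.
  apply: diff_orderN => //.
  by apply: diff_orderM => //; apply: IH; exact: diff_orderW.
apply: diff_order_eq h => // x /set_mem Ax; symmetry.
rewrite [LHS]deriveV; [|exact: f0|by apply: diff_derivable; exact: df].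
by rewrite -exprVn expr2.
Qed.

Lemma differentiable_mxP V m n (f : V -> 'M[R]_(m, n)) x :
  differentiable f x <-> forall i j, differentiable (fun y => f y i j) x.
Proof.
split=> [df i j|df].
  apply: (@differentiable_comp _ _ _ _ f (fun N : 'M[R]_(m, n) => N i j)) => //.
  exact: differentiable_coord.
rewrite (_ : f = \sum_(i < m) \sum_(j < n) (fun y => f y i j *: delta_mx i j)).
  apply: differentiable_sum => i; apply: differentiable_sum => j.
  exact: differentiableZl.
apply/funext => y; rewrite fct_sumE [LHS]matrix_sum_delta; apply: eq_bigr => i _.
by rewrite fct_sumE.
Qed.

Lemma derive_entry V m n (f : V -> 'M[R]_(m, n)) x v i j :
  differentiable f x -> 'D_v f x i j = 'D_v (fun y => f y i j) x.
Proof. by move=> /diff_derivable - /(_ v) h; rewrite derive_mx// mxE. Qed.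

Lemma diff_order_mxP V m n k (A : set V) (f : V -> 'M[R]_(m, n)) : open A ->
  diff_order k A f <-> forall i j, diff_order k A (fun x => f x i j).
Proof.
move=> oA; elim: k f => [//|k IH] f; split.
  move=> [df Df] i j; split=> [x /df/differentiable_mxP//|v].
  have [h _] := IH ('D_v f); have {}h := h (Df v) i j.
  by apply: diff_order_eq h => // x /set_mem /df; exact: derive_entry.
move=> h; have df : forall x, A x -> differentiable f x.
  by move=> x Ax; apply/differentiable_mxP => i j; have [+ _] := h i j; exact.
split=> // v; apply/IH => i j; have [_ /(_ v) h'] := h i j.
apply: diff_order_eq h' => // x /set_mem /df; symmetry; exact: derive_entry.
Qed.

Lemma diff_order_mulmx V m n p k (A : set V) (f : V -> 'M[R]_(m, n))
    (g : V -> 'M[R]_(n, p)) : open A ->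
  diff_order k A f -> diff_order k A g -> diff_order k A (fun x => f x *m g x).
Proof.
move=> oA /(diff_order_mxP _ _ oA) hf /(diff_order_mxP _ _ oA) hg.
apply/diff_order_mxP => // i j; under eq_fun do rewrite mxE.
by apply: diff_order_sum => // l; exact: diff_orderM.
Qed.

Lemma diff_order_trmx V m n k (A : set V) (f : V -> 'M[R]_(m, n)) : open A ->
  diff_order k A f -> diff_order k A (fun x => (f x)^T).
Proof.
move=> oA /(diff_order_mxP _ _ oA) hf; apply/diff_order_mxP => // i j.
by under eq_fun do rewrite mxE.
Qed.

Lemma diff_order_scale V m n k (A : set V) (a : V -> R) (f : V -> 'M[R]_(m, n)) :
  open A -> diff_order k A a -> diff_order k A f ->
  diff_order k A (fun x => a x *: f x).
Proof.
move=> oA ha /(diff_order_mxP _ _ oA) hf; apply/diff_order_mxP => // i j.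
by under eq_fun do rewrite mxE; exact: diff_orderM.
Qed.

Lemma diff_order_opp V m n k (A : set V) (f : V -> 'M[R]_(m, n)) :
  open A -> diff_order k A f -> diff_order k A (fun x => - f x).
Proof.
move=> oA hf; under eq_fun do rewrite -scaleN1r.
by apply: diff_order_scale => //; exact: diff_order_cst.
Qed.

Lemma diff_order_det V n k (A : set V) (f : V -> 'M[R]_n) : open A ->
  diff_order k A f -> diff_order k A (fun x => \det (f x)).
Proof.
move=> oA /(diff_order_mxP _ _ oA) hf; rewrite /determinant.
apply: diff_order_sum => // s; apply: diff_orderM => //.
  exact: diff_order_cst.
exact: diff_order_prod.
Qed.

(** Cramer's rule: the inverse is the adjugate, polynomial in the entries, divided by the
    determinant. *)
Lemma diff_order_invmx V n k (A : set V) (f : V -> 'M[R]_n) : open A ->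
  (forall x, A x -> f x \in unitmx) ->
  diff_order k A f -> diff_order k A (fun x => invmx (f x)).
Proof.
move=> oA fu hf.
have h : diff_order k A (fun x => (\det (f x))^-1 *: \adj (f x)).
  apply: diff_order_scale => //.
    apply: diff_orderV => //; last exact: diff_order_det.
    by move=> x /fu; rewrite unitmxE unitfE.
  apply/diff_order_mxP => // i j; rewrite /adjugate.
  under eq_fun do rewrite mxE /cofactor.
  apply: diff_orderM => //; first exact: diff_order_cst.
  apply: diff_order_det => //; apply/diff_order_mxP => // i' j'.
  under eq_fun do rewrite !mxE.
  by move/(diff_order_mxP _ _ oA) : hf.
by apply: diff_order_eq h => // x /set_mem /fu fx; rewrite /invmx fx.
Qed.

Lemma row_sum_basis p (v : 'rV[R]_p) : v = \sum_i v 0 i *: basis_vec R i.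
Proof. exact: row_sum_delta. Qed.

Lemma derive_sum_basis p W (g : 'rV[R]_p -> W) x v : differentiable g x ->
  'D_v g x = \sum_i v 0 i *: 'D_(basis_vec R i) g x.
Proof.
move=> dg; rewrite deriveE// [in LHS](row_sum_basis v) linear_sum.
by apply: eq_bigr => i _; rewrite linearZ deriveE.
Qed.

(** The chain rule is expanded over the basis of the intermediate space: each summand is a product
    of scalar functions, one of them again a composition with [f], of order one less. *)
Lemma diff_order_comp_scalar V p k (A : set V) (B : set 'rV[R]_p)
    (f : V -> 'rV[R]_p) (g : 'rV[R]_p -> R) :
  open A -> (forall x, A x -> B (f x)) ->
  diff_order k A f -> diff_order k B g -> diff_order k A (g \o f).
Proof.
move=> oA fAB; elim: k f g fAB => [//|k IH] f g fAB hf [dg Dg].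
have [df Df] := hf; split=> [x Ax|v].
  by apply: differentiable_comp; [exact: df|apply: dg; exact: fAB].
have h : diff_order k A
    (fun x => \sum_i 'D_v f x 0 i * ('D_(basis_vec R i) g \o f) x).
  apply: diff_order_sum => // i; apply: diff_orderM => //.
    by have /(diff_order_mxP _ _ oA) := Df v; apply.
  by apply: (IH _ _ fAB); [exact: diff_orderW|exact: Dg].
apply: diff_order_eq h => // x /set_mem Ax /=; symmetry.
rewrite derive_comp; [|exact: df|by apply: dg; exact: fAB].
by rewrite derive_sum_basis; last by apply: dg; exact: fAB.
Qed.

Lemma diff_order_comp V p m n k (A : set V) (B : set 'rV[R]_p)
    (f : V -> 'rV[R]_p) (g : 'rV[R]_p -> 'M[R]_(m, n)) :
  open A -> open B -> (forall x, A x -> B (f x)) ->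
  diff_order k A f -> diff_order k B g -> diff_order k A (g \o f).
Proof.
move=> oA oB fAB hf /(diff_order_mxP _ _ oB) hg; apply/diff_order_mxP => // i j.
exact: (@diff_order_comp_scalar _ _ _ _ B f (fun y => g y i j)).
Qed.

Lemma diff_order_jacobian p m k (A : set 'rV[R]_p) (f : 'rV[R]_p -> 'rV[R]_m) :
  open A -> diff_order k.+1 A f -> diff_order k A (jacobian f).
Proof.
move=> oA [df Df]; apply/diff_order_mxP => // i j.
have /(diff_order_mxP _ _ oA) /(_ 0 j) := Df (basis_vec R i).
apply: diff_order_eq => // x /set_mem /df dfx.
by rewrite deriveEjacobian// /basis_vec -rowE mxE.
Qed.

Lemma smooth_on_continuous V W (A : set V) (f : V -> W) x :
  smooth_on A f -> A x -> {for x, continuous f}.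
Proof.
by move=> /(_ 1%N)[df _] Ax; apply: differentiable_continuous; exact: df.
Qed.

End DiffOrderAlgebra.

(** * Product and chain rules for matrix-valued maps and Jacobians *)

Section MatrixDerivative.
Variable R : realType.
Implicit Types V : normedModType R.

Lemma differentiable_mulmx V m n p (f : V -> 'M[R]_(m, n)) (g : V -> 'M[R]_(n, p)) x :
  differentiable f x -> differentiable g x ->
  differentiable (fun y => f y *m g y) x.
Proof.
move=> /differentiable_mxP df /differentiable_mxP dg.
apply/differentiable_mxP => i j.
rewrite (_ : (fun y => _) = \sum_l ((fun y => f y i l) * (fun y => g y l j))).
  by apply: differentiable_sum => l; exact: differentiableM.
by apply/funext => y; rewrite mxE fct_sumE.
Qed.

Lemma derive_mulmx V m n p (f : V -> 'M[R]_(m, n)) (g : V -> 'M[R]_(n, p)) x v :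
  differentiable f x -> differentiable g x ->
  'D_v (fun y => f y *m g y) x = 'D_v f x *m g x + f x *m 'D_v g x.
Proof.
move=> df dg; have [/(_ df) dfe _] := differentiable_mxP f x.
have [/(_ dg) dge _] := differentiable_mxP g x.
apply/matrixP => i j; rewrite derive_entry; last exact: differentiable_mulmx.
rewrite (_ : (fun y => _) = \sum_l ((fun y => f y i l) * (fun y => g y l j))); last first.
  by apply/funext => y; rewrite mxE fct_sumE.
rewrite derive_sum; last by move=> l; exact/diff_derivable/differentiableM.
rewrite !mxE -big_split /=; apply: eq_bigr => l _.
rewrite deriveM; [|exact: diff_derivable|exact: diff_derivable].
rewrite -(derive_entry _ _ _ df) -(derive_entry _ _ _ dg) addrC.
by congr (_ + _); exact: mulrC.
Qed.

Lemma differentiable_trmx V m n (f : V -> 'M[R]_(m, n)) x :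
  differentiable f x -> differentiable (fun y => (f y)^T) x.
Proof.
move=> /differentiable_mxP df; apply/differentiable_mxP => i j.
by under eq_fun do rewrite mxE.
Qed.

Lemma derive_trmx V m n (f : V -> 'M[R]_(m, n)) x v : differentiable f x ->
  'D_v (fun y => (f y)^T) x = ('D_v f x)^T.
Proof.
move=> df; apply/matrixP => i j; rewrite derive_entry; last exact: differentiable_trmx.
by under eq_fun do rewrite mxE; rewrite mxE derive_entry.
Qed.

Lemma derive_mulmxr V m n p (f : V -> 'M[R]_(m, n)) (M : 'M[R]_(n, p)) x v :
  differentiable f x -> 'D_v (fun y => f y *m M) x = 'D_v f x *m M.
Proof.
move=> df; have dM : differentiable (fun=> M : 'M[R]_(n, p)) x.
  exact: differentiable_cst.
have D0 : 'D_v (fun=> M) x = 0 by exact: derive_cst.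
by rewrite (derive_mulmx v df dM) D0 mulmx0 addr0.
Qed.

Lemma differentiable_mulmxr V m n p (f : V -> 'M[R]_(m, n)) (M : 'M[R]_(n, p)) x :
  differentiable f x -> differentiable (fun y => f y *m M) x.
Proof. by move=> df; apply: differentiable_mulmx => //; exact: differentiable_cst. Qed.

Lemma jacobian_eq m n (f : 'rV[R]_m -> 'rV[R]_n) x (M : 'M[R]_(m, n)) :
  differentiable f x -> (forall v, 'D_v f x = v *m M) -> 'J f x = M.
Proof.
move=> df h; apply/row_matrixP => i; rewrite !rowE.
exact: etrans (esym (deriveEjacobian _ df)) (h _).
Qed.

Lemma jacobian_comp m n p (f : 'rV[R]_m -> 'rV[R]_n) (g : 'rV[R]_n -> 'rV[R]_p) x :
  differentiable f x -> differentiable g (f x) ->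
  'J (g \o f) x = 'J f x *m 'J g (f x).
Proof.
move=> df dg; apply: jacobian_eq; first exact: differentiable_comp.
move=> v; rewrite derive_comp// (deriveEjacobian _ dg) (deriveEjacobian _ df).
exact: esym (mulmxA _ _ _).
Qed.

Lemma near_eq_jacobian m n (f g : 'rV[R]_m -> 'rV[R]_n) x :
  (\forall y \near x, f y = g y) -> differentiable f x -> 'J f x = 'J g x.
Proof.
move=> fg df; apply: jacobian_eq => // v.
by rewrite (near_eq_derive _ fg) deriveEjacobian//; exact: near_eq_differentiable fg df.
Qed.

Lemma jacobian_id m (x : 'rV[R]_m) : 'J (fun y => y) x = 1%:M.
Proof.
apply: jacobian_eq => [|v]; first exact: ex_diff.
by rewrite mulmx1; exact: derive_id.
Qed.

Lemma jacobian_mulmxr m n p (f : 'rV[R]_m -> 'rV[R]_n) (M : 'M[R]_(n, p)) x :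
  differentiable f x -> 'J (fun y => f y *m M) x = 'J f x *m M.
Proof.
move=> df; apply: jacobian_eq; first exact: differentiable_mulmxr.
by move=> v; rewrite derive_mulmxr// deriveEjacobian// mulmxA.
Qed.

End MatrixDerivative.

(** * Symmetry of second derivatives *)

(* Otherwise conversion between distinct derivatives unfolds them and diverges. *)
#[local] Opaque derive jacobian.

Section MeanValue.
Variable R : realType.
Implicit Types V W : normedModType R.

Lemma deriveZv V W (f : V -> W) (x v : V) (a : R) : differentiable f x ->
  'D_(a *: v) f x = a *: 'D_v f x.
Proof. by move=> df; rewrite !deriveE// linearZ. Qed.

Lemma mean_value_dir V (f : V -> R) (x v : V) :
  (forall t, 0 <= t <= 1 -> differentiable f (x + t *: v)) ->
  exists2 t, 0 <= t <= 1 & f (x + v) - f x = 'D_v f (x + t *: v).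
Proof.
move=> df; pose l (t : R) := x + t *: v.
have dl t : is_diff t l ( *:%R^~ v).
  apply: is_diff_eq; apply/funext => s; rewrite !fctE /=.
  by rewrite add0r.
have D (t : R) : t \in `]0, 1[%R -> is_derive t 1 (f \o l) ('D_v f (x + t *: v)).
  move=> /itvP t01; have dft : differentiable f (l t) by apply: df; rewrite !t01.
  apply: DeriveDef.
    by apply: diff_derivable; exact: differentiable_comp.
  rewrite derive_comp//; congr ('D_ _ f _).
  by rewrite deriveE// diff_val scale1r.
have C : {within `[0 : R, 1], continuous (f \o l)}.
  apply: continuous_in_subspaceT => t /set_mem /= /itvP t01.
  apply: differentiable_continuous; apply: differentiable_comp => //.
  by apply: df; rewrite !t01.
have [t /itvP t01] := MVT ltr01 D C.
rewrite /= /l scale1r scale0r addr0 subr0 mulr1 => ->.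
by exists t => //; rewrite !t01.
Qed.

(** Two uses of the mean value theorem: in direction [v] for the increment [f (y + u) - f y], then
    in direction [u] for ['D_v f]. *)
Lemma second_difference V (A : set V) (f : V -> R) (x u v : V) :
  open A -> smooth_on A f ->
  (forall a b, 0 <= a <= 1 -> 0 <= b <= 1 -> A (x + a *: u + b *: v)) ->
  exists a b, [/\ 0 <= a <= 1, 0 <= b <= 1 &
    f (x + u + v) - f (x + u) - (f (x + v) - f x) =
      'D_u ('D_v f) (x + a *: u + b *: v)].
Proof.
move=> oA sf hA; pose phi y := f (y + u) - f y.
have I0 : (0 : R) <= 0 <= (1 : R) by rewrite lexx ler01.
have I1 : (0 : R) <= 1 <= (1 : R) by rewrite lexx ler01.
have [df Df] := (smooth_onP _ _).1 sf.
have du y : is_diff y (fun z => z + u) id.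
  by apply: is_diff_eq; apply/funext => s; rewrite !fctE /= addr0.
have dphi t : 0 <= t <= 1 -> is_derive (x + t *: v) v phi
    ('D_v f (x + t *: v + u) - 'D_v f (x + t *: v)).
  move=> t01; have dfu : differentiable f (x + t *: v + u).
    by apply: df; rewrite addrAC -[X in _ + X + _]scale1r; exact: hA.
  have dfx : differentiable f (x + t *: v).
    by apply: df; rewrite -[X in X + _]addr0 -(scale0r u); exact: hA.
  apply: is_deriveB; last exact/derivableP/diff_derivable.
  apply: DeriveDef.
    by apply: diff_derivable; exact: (@differentiable_comp _ _ _ _ (fun z => z + u) f).
  rewrite (@derive_comp _ _ _ _ (fun z => z + u) f)//; congr ('D_ _ f _).
  by rewrite deriveE// diff_val.
have [t t01] : exists2 t, 0 <= t <= 1 & phi (x + v) - phi x = 'D_v phi (x + t *: v).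
  apply: mean_value_dir => t t01; apply: differentiableB.
    apply: (@differentiable_comp _ _ _ _ (fun z => z + u) f) => //; apply: df.
    by rewrite addrAC -[X in _ + X + _]scale1r; exact: hA.
  by apply: df; rewrite -[X in X + _]addr0 -(scale0r u); exact: hA.
have -> := @derive_val _ _ _ _ _ _ _ (dphi t t01).
have [s s01] : exists2 s, 0 <= s <= 1 &
    'D_v f (x + t *: v + u) - 'D_v f (x + t *: v) =
    'D_u ('D_v f) (x + t *: v + s *: u).
  have [dDf _] := (smooth_onP _ _).1 (Df v).
  apply: (mean_value_dir (f := 'D_v f)) => s s01.
  by apply: dDf; rewrite addrAC; exact: hA.
move=> -> e; exists s, t; split; [by []|by []|].
by rewrite (addrAC x (s *: u)) -e /phi addrAC [x + v + u]addrAC; ring.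
Qed.

(** The second difference over a small parallelogram is symmetric in its two sides, and
    [second_difference] writes it as a mixed derivative at a nearby point in either order;
    continuity of both mixed derivatives finishes. *)
Lemma deriveC_scalar V (A : set V) (f : V -> R) (x u v : V) : open A ->
  smooth_on A f -> A x -> 'D_u ('D_v f) x = 'D_v ('D_u f) x.
Proof.
move=> oA sf Ax; apply/eqP; rewrite -subr_eq0 -normr_le0; apply/ler_addgt0Pl.
move=> e e0; rewrite addr0.
have e20 : 0 < e / 2 by rewrite divr_gt0.
have aux (p q w q' : R) : `|p - q| <= e / 2 -> `|w - q'| <= e / 2 -> q = q' ->
    `|p - w| <= e.
  move=> pq wq' qq'; rewrite -(subrKA q) [X in _ + (X - _)]qq'.
  by rewrite (le_trans (ler_normD _ _))// [e in leRHS]splitr lerD// distrC.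
have [df Df] := (smooth_onP _ _).1 sf.
have Cd w w' : {for x, continuous ('D_w ('D_w' f))}.
  have [_ DDf] := (smooth_onP _ _).1 (Df w').
  exact: smooth_on_continuous (DDf w) Ax.
have /cvgrPdist_le /(_ _ e20) Cuv := Cd u v.
have /cvgrPdist_le /(_ _ e20) Cvu := Cd v u.
have [r /= r0 rP] : exists2 r : R, 0 < r & forall y, `|x - y| < r ->
   [/\ A y, `|'D_u ('D_v f) x - 'D_u ('D_v f) y| <= e / 2 &
    `|'D_v ('D_u f) x - 'D_v ('D_u f) y| <= e / 2].
  have H : \forall y \near x, [/\ A y, `|'D_u ('D_v f) x - 'D_u ('D_v f) y| <= e / 2 &
    `|'D_v ('D_u f) x - 'D_v ('D_u f) y| <= e / 2].
    by apply: filterS3 (open_nbhs_nbhs (conj oA Ax)) Cuv Cvu => y h1 h2 h3; split; [exact: h1|exact: h2|exact: h3].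
  have /nbhs_ballP[r /= r0 rH] := H.
  by exists r => // y xy; apply: rH; rewrite -ball_normE.
(* Sides [s *: u] and [s *: v] keep the parallelogram in the ball of radius [r]; the summand 1 keeps
   the denominator positive and the inequality strict. *)
pose s := r / (`|u| + `|v| + 1).
have uv0 : 0 < `|u| + `|v| + 1.
  by rewrite ltr_wpDl// addr_ge0.
have s0 : 0 < s by rewrite divr_gt0.
have rE : r = s * (`|u| + `|v| + 1) by rewrite /s divfK// gt_eqF.
clearbody s.
have near_x a b : 0 <= a <= 1 -> 0 <= b <= 1 ->
    `|x - (x + a *: (s *: u) + b *: (s *: v))| < r.
  move=> /andP[a0 a1] /andP[b0 b1].
  rewrite -addrA opprD addNKr normrN (le_lt_trans (ler_normD _ _))//.
  rewrite !normrZ (ger0_norm a0) (ger0_norm b0) (gtr0_norm s0).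
  have su : 0 <= s * `|u| by rewrite mulr_ge0// ltW.
  have sv : 0 <= s * `|v| by rewrite mulr_ge0// ltW.
  rewrite rE !mulrDr mulr1.
  have := ler_pM a0 su a1 (lexx _); have := ler_pM b0 sv b1 (lexx _).
  by rewrite !mul1r => h1 h2; lra.
have near_x' a b : 0 <= a <= 1 -> 0 <= b <= 1 ->
    `|x - (x + a *: (s *: v) + b *: (s *: u))| < r.
  by move=> a01 b01; rewrite addrAC; exact: near_x.
have [a [b [a01 b01]]] := second_difference oA sf
  (fun a b ha hb => let: And3 h _ _ := rP _ (near_x a b ha hb) in h).
have [a' [b' [a'01 b'01]]] := second_difference oA sf
  (fun a b ha hb => let: And3 h _ _ := rP _ (near_x' a b ha hb) in h).
set z := x + a *: _ + _; set z' := x + a' *: _ + _ => e2 e1.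
have [Az zu _] := rP _ (near_x _ _ a01 b01).
have [Az' _ zv] := rP _ (near_x' _ _ a'01 b'01).
(* The factor [s] comes out of both directions, so the same [s * s] cancels on the two sides. *)
have D2 w w' y : A y -> 'D_(s *: w) ('D_(s *: w') f) y = s * (s * 'D_w ('D_w' f) y).
  move=> Ay; have [dDf _] := (smooth_onP _ _).1 (Df w').
  rewrite deriveZv; last by have [+ _] := (smooth_onP _ _).1 (Df (s *: w')); apply.
  congr (s * _).
  rewrite (@near_eq_derive _ _ _ _ (s *: 'D_w' f)).
    by rewrite deriveZ//; apply: diff_derivable; exact: dDf.
  apply: filterS (open_nbhs_nbhs (conj oA Ay)) => y' Ay'.
  by rewrite deriveZv//; exact: df.
have E : 'D_u ('D_v f) z = 'D_v ('D_u f) z'.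
  have {}e1 := etrans e1 (D2 u v z Az).
  have {}e2 := etrans e2 (D2 v u z' Az').
  have sn : s != 0 by rewrite gt_eqF.
  apply: (mulfI sn); apply: (mulfI sn); apply: etrans (etrans (esym e1) _) e2.
  by rewrite (addrAC x); ring.
exact: aux zu zv E.
Qed.

Lemma deriveC V m n (A : set V) (f : V -> 'M[R]_(m, n)) (x u v : V) : open A ->
  smooth_on A f -> A x -> 'D_u ('D_v f) x = 'D_v ('D_u f) x.
Proof.
move=> oA sf Ax; have [df Df] := (smooth_onP _ _).1 sf.
have sfij i j : smooth_on A (fun y => f y i j).
  by move=> k; have /(diff_order_mxP _ _ oA) := sf k; apply.
have H w w' i j : 'D_w ('D_w' f) x i j = 'D_w ('D_w' (fun y => f y i j)) x.
  rewrite derive_entry; last by have [+ _] := (smooth_onP _ _).1 (Df w'); apply.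
  apply: near_eq_derive; apply: filterS (open_nbhs_nbhs (conj oA Ax)) => y Ay.
  by rewrite derive_entry//; exact: df.
by apply/matrixP => i j; rewrite [LHS]H [RHS]H; exact: deriveC_scalar oA (sfij i j) Ax.
Qed.

End MeanValue.

(** * Inverse function theorem *)

(** Row vectors have to form a complete normed module for the contraction principle used in
    [inverse_function_id]. *)
HB.instance Definition _ (R : realType) (m n : nat) :=
  Complete.copy 'M[R]_(m, n) 'M[R]_(m, n).

Section InverseFunction.
Variable R : realType.

Lemma norm_entry_le m n (M : 'M[R]_(m, n)) i j : `|M i j| <= `|M|.
Proof.
rewrite [leRHS]/Num.Def.normr /= mx_normrE.
exact: (le_bigmax _ (fun ij : 'I_m * 'I_n => `|M ij.1 ij.2|) (i, j)).
Qed.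

Lemma norm_mx_le m n (M : 'M[R]_(m, n)) (C : R) : 0 <= C ->
  (forall i j, `|M i j| <= C) -> `|M| <= C.
Proof.
move=> C0 h; rewrite [leLHS]/Num.Def.normr /= mx_normrE.
by apply: bigmax_le => // ij _; exact: h.
Qed.

Lemma norm_mulmx_le m n (v : 'rV[R]_m) (M : 'M[R]_(m, n)) :
  `|v *m M| <= m%:R * `|M| * `|v|.
Proof.
apply: norm_mx_le => [|i j]; first by rewrite !mulr_ge0.
rewrite mxE (le_trans (ler_norm_sum _ _ _))//.
apply: (@le_trans _ _ (\sum_(l < m) `|M| * `|v|)).
  apply: ler_sum => l _; rewrite normrM mulrC ler_pM//; exact: norm_entry_le.
by rewrite sumr_const card_ord -[leLHS]mulr_natl mulrA.
Qed.

Lemma continuous_mulmxr m n (M : 'M[R]_(m, n)) :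
  continuous (fun v : 'rV[R]_m => v *m M).
Proof.
move=> v; apply: (@smooth_on_continuous _ _ _ setT) => // k.
apply: diff_order_mulmx; first exact: openT.
  exact: diff_order_id.
exact: diff_order_cst.
Qed.

Lemma differentiable_approx (V W : normedModType R) (f : V -> W)
    (L : {linear V -> W}) x : continuous L ->
  (forall e : R, 0 < e -> \forall h \near (0 : V), `|f (h + x) - f x - L h| <= e * `|h|) ->
  differentiable f x /\ 'd f x = L :> (V -> W).
Proof.
move=> cL h.
have E : f \o shift x = cst (f x) + L +o_ 0 id.
  apply/eqaddoP => _/posnumP[e]; have := h e%:num [gt0 of e%:num].
  apply: filterS => y; apply: le_trans.
  by rewrite !fctE /= /cst opprD addrA.
have D := @diff_unique R V W f L x cL E.
by split=> //; apply/diff_locallyP; rewrite D.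
Qed.

(** On a small ball, which is convex, ['J f] stays close to its value at [x0]; the mean value
    theorem is applied to each coordinate of [f] minus its linear part. *)
Lemma lipschitz_approx m p (A : set 'rV[R]_m) (f : 'rV[R]_m -> 'rV[R]_p) x0
    (e : R) : open A -> smooth_on A f -> A x0 -> 0 < e ->
  exists2 r : R, 0 < r & ball x0 r `<=` A /\
    forall x y, ball x0 r x -> ball x0 r y ->
      `|f y - f x - (y - x) *m 'J f x0| <= e * `|y - x|.
Proof.
move=> oA sf Ax0 e0.
have [df Df] := (smooth_onP _ _).1 sf.
(* For the maximum norm a product with a matrix costs a factor [m] ([norm_mulmx_le]); [m.+1] avoids
   dividing by zero when [m = 0]. *)
pose e' := e / m.+1%:R; have e'0 : 0 < e' by rewrite divr_gt0.
have cJ : {for x0, continuous (jacobian f)}.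
  by apply: (@smooth_on_continuous _ _ _ A) => // k; apply: diff_order_jacobian.
have /cvgrPdist_le /(_ _ e'0) HJ := cJ.
have Hn : nbhs x0 (A `&` [set z | `|'J f x0 - 'J f z| <= e']).
  exact: filterI (open_nbhs_nbhs (conj oA Ax0)) HJ.
move/nbhs_ballP : Hn => [r /= r0 rP].
exists r => //; split=> [x /rP[]//|x y xr yr].
have inr t : 0 <= t <= 1 -> ball x0 r (x + t *: (y - x)).
  move=> /andP[t0 t1]; move: xr yr; rewrite -ball_normE /= => xr yr.
  have -> : x0 - (x + t *: (y - x)) = (1 - t) *: (x0 - x) + t *: (x0 - y).
    rewrite !scalerBr !scalerBl !scale1r; set a := t *: x0; set b := t *: x.
    set c := t *: y; apply/rowP => i; rewrite !mxE; ring.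
  rewrite (le_lt_trans (ler_normD _ _))// !normrZ (ger0_norm t0) ger0_norm ?subr_ge0//.
  have [->|tn0] := eqVneq t 0; first by rewrite subr0 mul1r mul0r addr0.
  have -> : r = (1 - t) * r + t * r by ring.
  rewrite ler_ltD//; first by apply: ler_wpM2l; [rewrite subr_ge0|exact: ltW].
  by rewrite ltr_pM2l// lt0r tn0.
apply: norm_mx_le => [|i j]; first by rewrite mulr_ge0// ltW.
rewrite (ord1 i) {i}.
pose g z := (f z - z *m 'J f x0) 0 j.
have dg z : ball x0 r z -> is_derive z (y - x) g (((y - x) *m ('J f z - 'J f x0)) 0 j).
  move=> /rP[Az _]; have dfz := df z Az.
  have dl : is_derive z (y - x) (fun z => z *m 'J f x0) ((y - x) *m 'J f x0).
    apply: DeriveDef; last by rewrite derive_mulmxr ?derive_id.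
    exact/diff_derivable/differentiable_mulmxr.
  have df' : is_derive z (y - x) f ((y - x) *m 'J f z).
    by apply: DeriveDef; [exact: diff_derivable|exact: deriveEjacobian].
  have dh := is_deriveB df' dl.
  have := @derive_mx _ _ _ _ (fun z => f z - z *m 'J f x0) z (y - x) (@ex_derive _ _ _ _ _ _ _ dh).
  have -> := @derive_val _ _ _ _ _ _ _ dh.
  rewrite -mulmxBr => /rowP /(_ j); rewrite [RHS]mxE => ->.
  apply: DeriveDef => //.
  by have /derivable_mxP := @ex_derive _ _ _ _ _ _ _ dh; apply.
have [t t01] : exists2 t, 0 <= t <= 1 &
    g (x + (y - x)) - g x = 'D_(y - x) g (x + t *: (y - x)).
  apply: mean_value_dir => t t01.
  have /rP[Az _] := inr t t01.
  suff : differentiable (fun z => f z - z *m 'J f x0) (x + t *: (y - x)).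
    by move/differentiable_mxP; apply.
  apply: differentiableB; first exact: df.
  exact: differentiable_mulmxr.
have -> := @derive_val _ _ _ _ _ _ _ (dg _ (inr t t01)).
rewrite subrKC => E.
have -> : (f y - f x - (y - x) *m 'J f x0) 0 j = g y - g x.
  by rewrite /g mulmxBl !mxE; ring.
rewrite E (le_trans (norm_entry_le _ _ _))// (le_trans (norm_mulmx_le _ _))//.
rewrite ler_wpM2r//.
have /rP[_ h] := inr t t01.
rewrite distrC (le_trans (ler_wpM2l _ h))//.
rewrite /e' mulrCA -[leRHS]mulr1 ler_wpM2l ?ltW//.
by rewrite ltr_pdivrMr// mul1r ltr_nat.
Qed.

Lemma open_preimage_on (S T : topologicalType) (A : set S) (B : set T) (f : S -> T) :
  open A -> (forall x, A x -> {for x, continuous f}) -> open B ->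
  open (A `&` f @^-1` B).
Proof.
move=> oA cf oB; have := continuous_inP f oA => -[+ _]; apply=> //.
by move=> x /set_mem; exact: cf.
Qed.

(** With identity Jacobian, solving [f x = y] amounts to finding a fixed point of [x - f x + y], a
    contraction near [x0]. *)
Lemma inverse_function_id m (A : set 'rV[R]_m) (f : 'rV[R]_m -> 'rV[R]_m) x0 :
  open A -> smooth_on A f -> A x0 -> 'J f x0 = 1%:M ->
  exists (O B : set 'rV[R]_m) (g : 'rV[R]_m -> 'rV[R]_m),
    [/\ open O, O x0, O `<=` A & open B] /\
    [/\ forall x, O x -> B (f x) /\ g (f x) = x,
        forall y, B y -> O (g y) /\ f (g y) = y,
        forall x, O x -> 'J f x \in unitmx &
        forall x y, O x -> O y -> `|x - y| <= 2 * `|f x - f y|].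
Proof.
move=> oA sf Ax0 J1.
pose A' := A `&` [set x | 'J f x \in unitmx].
have oA' : open A'.
  have -> : A' = A `&` (fun x => \det ('J f x)) @^-1` [set~ 0].
    apply/seteqP; split=> x [Ax] /= h; split=> //; move: h => /=.
      by rewrite unitmxE unitfE => /eqP.
    by rewrite unitmxE unitfE => /eqP.
  apply: open_preimage_on => //; last first.
    exact/closed_openC/accessible_closed_set1/hausdorff_accessible/Rhausdorff.
  move=> x Ax; apply: (@smooth_on_continuous _ _ _ A) => // k.
  by apply: diff_order_det => //; exact: diff_order_jacobian.
have A'x0 : A' x0 by split=> //=; rewrite J1 unitmx1.
have sf' : smooth_on A' f by move=> k; apply: diff_order_subset (sf k) => x [].
(* The constant 1/2 serves twice: it is the contraction ratio, and it gives the expansion bound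
   [|x - y| <= 2 |f x - f y|]. *)
have h2 : 0 < 2^-1 :> R by [].
have [r r0 [rA rf]] := lipschitz_approx oA' sf' A'x0 h2.
rewrite J1 in rf.
have {}rf x y : ball x0 r x -> ball x0 r y ->
    `|f y - f x - (y - x)| <= 2^-1 * `|y - x|.
  by move=> xr yr; have := rf x y xr yr; rewrite mulmx1.
have expand x y : ball x0 r x -> ball x0 r y -> `|x - y| <= 2 * `|f x - f y|.
  move=> xr yr; have := rf y x yr xr.
  have := ler_distD (f x - f y) (x - y) 0; rewrite !subr0 [`|x - y - _|]distrC.
  by move=> h1 h; lra.
(* The contraction preserves the closed ball of radius [r / 2]: it moves [x0] by less than [r / 4]
   and shrinks distances to [x0], at most [r / 2], to at most [r / 4]. *)
pose B := ball (f x0) (r / 4).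
have oB : open B by apply: ball_open; rewrite divr_gt0.
have surj y : B y -> exists2 x, ball x0 r x & f x = y.
  move=> yB'; have yB : `|f x0 - y| < r / 4 by move: yB'; rewrite /B -ball_normE.
  pose U := closed_ball x0 (r / 2).
  have r20 : 0 < r / 2 by rewrite divr_gt0.
  have UE x : U x <-> `|x0 - x| <= r / 2 by rewrite /U closed_ballE.
  have Ur x : U x -> ball x0 r x.
    by move=> /UE h; rewrite -ball_normE /=; apply: le_lt_trans h _; lra.
  pose F x := x - f x + y.
  have Flip x x' : U x -> U x' -> `|F x - F x'| <= 2^-1 * `|x - x'|.
    move=> /Ur Ux /Ur Ux'; have := rf x' x Ux' Ux; apply: le_trans.
    rewrite -normrN le_eqVlt; apply/orP; left; apply/eqP; congr `|_|.
    by apply/rowP => i; rewrite /F !mxE; ring.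
  have FU : {homo F : x / U x >-> U x}.
    move=> x Ux; apply/UE.
    have Ux0 : U x0 by apply/UE; rewrite subrr normr0 ltW.
    have := Flip x0 x Ux0 Ux; have := (UE x).1 Ux => h1 h3.
    have := ler_distD (F x0) x0 (F x).
    have -> : `|x0 - F x0| = `|f x0 - y|.
      by congr `|_|; apply/rowP => i; rewrite /F !mxE; ring.
    by move=> h; lra.
  have cF : is_contraction (mkfun FU).
    exists (NngNum (ltW h2)); split => /=; first by lra.
    by move=> [x x'] [Ux Ux'] /=; exact: Flip.
  have [x Ux xF] : exists2 x, U x & x = F x.
    apply: (@banach_fixed_point R 'rV[R]_m U (mkfun FU) cF).
      exact: closed_ball_closed.
    by exists x0; apply/UE; rewrite subrr normr0 ltW.
  exists x; first exact: Ur.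
  move: xF; rewrite /F => /rowP xF; apply/rowP => i.
  by have := xF i; rewrite !mxE => h; lra.
pose O := ball x0 r `&` f @^-1` B.
have brA x : ball x0 r x -> A x by move=> /rA[].
(* The default 0 is taken only where [y] has no preimage in the ball, hence never on [B]. *)
pose g y := xget 0 [set x | ball x0 r x /\ f x = y].
have gP y : B y -> ball x0 r (g y) /\ f (g y) = y.
  move=> /surj[x xr fx].
  exact: (@xgetPex _ (0 : 'rV[R]_m) [set x | ball x0 r x /\ f x = y]
    (ex_intro _ x (conj xr fx))).
have inj x y : ball x0 r x -> ball x0 r y -> f x = f y -> x = y.
  move=> xr yr e; have := expand x y xr yr.
  by rewrite e subrr normr0 mulr0 normr_le0 subr_eq0 => /eqP.
exists O, B, g; split; split=> //.
- apply: open_preimage_on => //; first exact: ball_open.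
  by move=> x /brA; exact: smooth_on_continuous.
- by split; [exact: ballxx|apply: ballxx; rewrite divr_gt0].
- by move=> x [/brA].
- move=> x [xr Bfx]; split=> //; have [gr fg] := gP _ Bfx.
  exact: inj.
- by move=> y By; have [gr fg] := gP _ By; split=> //; split=> //=; rewrite fg.
- by move=> x [/rA[]].
- by move=> x y [xr _] [yr _]; exact: expand.
Qed.

Section SmoothInverse.
Variables (m : nat) (O B : set 'rV[R]_m) (f g : 'rV[R]_m -> 'rV[R]_m).
Hypotheses (oO : open O) (oB : open B) (sf : smooth_on O f).
Hypothesis gB : forall y, B y -> O (g y) /\ f (g y) = y.
Hypothesis fU : forall x, O x -> 'J f x \in unitmx.
Hypothesis fL : forall x y, O x -> O y -> `|x - y| <= 2 * `|f x - f y|.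

(** The expansion bound [fL] converts the error of the linear approximation of [f], small compared
    with the increment of [g], into an error small compared with [h]. *)
Lemma inverse_differentiable y : B y ->
  differentiable g y /\ forall v, 'D_v g y = v *m invmx ('J f (g y)).
Proof.
move=> By; have [Ox fgy] := gB By; set x := g y in Ox fgy *.
set M := invmx _.
have D := @differentiable_approx 'rV[R]_m 'rV[R]_m g (mulmxr M) y
  (@continuous_mulmxr _ _ M).
suff : differentiable g y /\ 'd g y = mulmxr M :> (_ -> _).
  by move=> [dg dgE]; split=> // v; rewrite deriveE// dgE.
apply: D => e e0.
(* [C] bounds multiplication by [M], and the 1 makes it positive; in [e'] below, the factor 2 comes
   from [fL]. *)
pose C := m%:R * `|M| + 1.
have C0 : 0 < C by rewrite ltr_wpDl// mulr_ge0.
pose e' := e / (2 * C); have e'0 : 0 < e' by rewrite divr_gt0// mulr_gt0.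
have [r r0 [_ rf]] := lipschitz_approx oO sf Ox e'0.
have nB : \forall h \near (0 : 'rV[R]_m), B (h + y).
  have /= := near_shift 0 y B; rewrite subr0 => <-.
  exact: (open_nbhs_nbhs (conj oB By)).
have nr : \forall h \near (0 : 'rV[R]_m), `|h| < r / 2.
  have : 0 < r / 2 by rewrite divr_gt0.
  by move=> /(nbhs0_lt) ; apply.
apply: filterS2 nB nr => h Bh hr /=.
have [Ox' fx'] := gB Bh; set x' := g (h + y) in Ox' fx' *.
have xx' : `|x' - x| <= 2 * `|h|.
  by rewrite (le_trans (fL Ox' Ox))// fx' fgy addrK.
have xr' : ball x r x'.
  by rewrite -ball_normE /= distrC (le_lt_trans xx')//; lra.
have := rf x x' (ballxx _ r0) xr'; rewrite fx' fgy addrK => E.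
have -> : x' - x - h *m M = - ((h - (x' - x) *m 'J f x) *m M).
  by rewrite mulmxBl mulmxK ?fU// opprB.
rewrite normrN (le_trans (norm_mulmx_le _ _))//.
apply: (@le_trans _ _ (C * (e' * (2 * `|h|)))).
  apply: ler_pM => //; first by rewrite /C lerDl.
  by rewrite (le_trans E)// ler_wpM2l// ltW.
rewrite le_eqVlt; apply/orP; left; apply/eqP; rewrite /e'.
by field; rewrite gt_eqF.
Qed.

(** The derivative of [g] is the inverse of ['J f] composed with [g], so order [k] for [g] yields
    order [k + 1]. *)
Lemma inverse_smooth : smooth_on B g.
Proof.
elim=> [//|k IH]; split=> [y By|v]; first by have [] := inverse_differentiable By.
apply: (@diff_order_eq _ _ _ k B (fun y => v *m invmx ('J f (g y)))) => //.
  by move=> y /set_mem /inverse_differentiable[_ ->].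
apply: diff_order_mulmx => //; first exact: diff_order_cst.
apply: diff_order_invmx => //; first by move=> y /gB[Oy _]; exact: fU.
apply: (@diff_order_comp _ _ _ _ _ _ B O g (jacobian f)) => //.
  by move=> y /gB[].
exact: diff_order_jacobian.
Qed.

End SmoothInverse.

(** Multiplying [f] by the inverse of its Jacobian at [x0] reduces to the case of identity
    Jacobian. *)
Theorem inverse_function m (A : set 'rV[R]_m) (f : 'rV[R]_m -> 'rV[R]_m) x0 :
  open A -> smooth_on A f -> A x0 -> 'J f x0 \in unitmx ->
  exists (O B : set 'rV[R]_m) (g : 'rV[R]_m -> 'rV[R]_m),
    [/\ open O, O x0, O `<=` A & open B] /\
    [/\ forall x, O x -> B (f x) /\ g (f x) = x,
        forall y, B y -> O (g y) /\ f (g y) = y,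
        forall x, O x -> 'J f x \in unitmx &
        smooth_on B g].
Proof.
move=> oA sf Ax0 uT; set T := 'J f x0 in uT.
pose f1 x := f x *m invmx T.
have sf1 : smooth_on A f1.
  by move=> k; apply: diff_order_mulmx => //; exact: diff_order_cst.
have [df _] := (smooth_onP _ _).1 sf.
have J1 x : A x -> 'J f1 x = 'J f x *m invmx T.
  by move=> /df; exact: jacobian_mulmxr.
have [|O [B [g [[oO Ox0 OA oB] [h1 h2 h3 h4]]]]] := inverse_function_id oA sf1 Ax0.
  by rewrite J1// mulmxV.
have sg := inverse_smooth oO oB (fun k => diff_order_subset OA (sf1 k)) h2 h3 h4.
pose B' := [set y | B (y *m invmx T)].
have oB' : open B'.
  by apply: open_comp => // y _; exact: continuous_mulmxr.
exists O, B', (fun y => g (y *m invmx T)); split.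
  by split; [exact: oO|exact: Ox0|exact: OA|exact: oB'].
split.
- by move=> x /h1[].
- move=> y /h2[Og fg]; split=> //.
  exact: (can_inj (mulmxKV uT)) fg.
- move=> x Ox; have := h3 x Ox; rewrite J1; last exact: OA.
  by rewrite unitmx_mul => /andP[].
- move=> k; apply: (@diff_order_comp _ _ _ _ _ _ B' B (fun y => y *m invmx T) g) => //.
  apply: diff_order_mulmx => //; first exact: diff_order_id.
  exact: diff_order_cst.
Qed.

End InverseFunction.

(** * Bump functions and orthonormalization *)

Section Bump.
Variable R : realType.

(** [flat 0] is the classical flat function [exp(-1/x)]; the powers of [1/x] make the family stable
    under differentiation up to linear combinations. *)
Definition flat (j : nat) (x : R) : R :=
  if 0 < x then x^-1 ^+ j * expR (- x^-1) else 0.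

(** With [y = 1/x], raise [z <= exp z] at [z = y / (j + 2)] to the power [j + 2]. Two powers of [x]
    are left over, which forces a zero derivative at the origin. *)
Lemma flat_le (j : nat) (x : R) : 0 < x -> flat j x <= j.+2%:R ^+ j.+2 * x ^+ 2.
Proof.
move=> x0; rewrite /flat x0 expRN ler_pdivrMr ?expR_gt0//.
pose y := x^-1; have y0 : 0 < y by rewrite invr_gt0.
have -> : x = y^-1 by rewrite invrK.
have n0 : 0 < j.+2%:R :> R by [].
have e : (y / j.+2%:R) ^+ j.+2 <= expR y.
  have -> : expR y = expR (y / j.+2%:R) ^+ j.+2.
    by rewrite -expRM_natl mulrC divfK// gt_eqF.
  apply: lerXn2r; [by rewrite nnegrE divr_ge0// ltW|by rewrite nnegrE expR_ge0|].
  by apply: le_trans (expR_ge1Dx _); rewrite lerDr.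
rewrite invrK; apply: le_trans (ler_wpM2l _ e); last first.
  by rewrite mulr_ge0 ?exprn_ge0// invr_ge0 ltW.
rewrite expr_div_n mulrACA -mulrA.
have -> : y ^+ j.+2 = y ^+ j * y ^+ 2 by rewrite -exprD addn2.
clearbody y; rewrite exprVn.
have h1 : y ^+ 2 != 0 by rewrite expf_neq0// gt_eqF.
have h2 : j.+2%:R ^+ j.+2 != 0 :> R by rewrite expf_neq0// gt_eqF.
rewrite le_eqVlt; apply/orP; left; apply/eqP.
move: (y ^+ j) (y ^+ 2) h1 (_ ^+ j.+2) h2 => u b b0 c c0'.
by field; rewrite b0 c0'.
Qed.

Lemma flat_ge0 j x : 0 <= flat j x.
Proof.
rewrite /flat; case: ifPn => // x0.
by rewrite mulr_ge0 ?exprn_ge0 ?expR_ge0// invr_ge0 ltW.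
Qed.

Lemma flat_is_derive j (x : R) : is_derive x 1 (flat j) (- (j%:R * flat j.+1 x) + flat j.+2 x).
Proof.
have [x0|x0|->] := ltgtP x 0.
- have -> : - (j%:R * flat j.+1 x) + flat j.+2 x = 0.
    by rewrite /flat !ltNge (ltW x0) /= mulr0 oppr0 addr0.
  have h0 : is_derive x 1 (fun _ : R => 0 : R) (0 : R) := is_derive_cst _ _ _.
  apply: near_eq_is_derive h0.
  near=> y; rewrite /flat ltNge; have -> // : y <= 0.
  by apply: ltW; near: y; exact: lt_nbhsl.
- have xn0 : x != 0 by rewrite gt_eqF.
  have dV : is_derive x 1 (fun y : R => y^-1) (- x ^- 2).
    have := @is_derive_id _ _ x (1 : R) => di.
    apply: DeriveDef; first exact: derivableV.
    by rewrite (@deriveV _ _ id)// derive_id -[LHS]/(_ * _) mulr1.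
  have dX : is_derive x 1 (fun y : R => (y^-1) ^+ j) (- (j%:R * x^-1 ^+ j.+1)).
    have := is_deriveX j dV; case: j => [|j] /= h.
      rewrite mul0r oppr0; rewrite (_ : (fun _ => _) = cst 1); first exact: is_derive_cst.
      by apply/funext => y; rewrite expr0.
    rewrite (_ : (fun _ => _) = (fun y : R => y^-1) ^+ j.+1); last first.
      by apply/funext => y; rewrite exprfctE.
    apply: is_derive_eq h _.
    by rewrite -[LHS]/(_ * _) mulrN -mulrA -exprVn -exprD addn2.
  have dE : is_derive x 1 (fun y : R => expR (- y^-1)) (x^-1 ^+ 2 * expR (- x^-1)).
    have dN : is_derive x 1 (fun y : R => - y^-1) (x^-1 ^+ 2).
      by have := is_deriveN dV; rewrite opprK exprVn.
    have := @is_derive1_comp _ expR (fun y : R => - y^-1) x _ _ (is_derive_expR _) dN.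
    by rewrite [_ * x^-1 ^+ 2]mulrC.
  have h := is_deriveM dX dE.
  apply: (near_eq_is_derive _ (is_derive_eq h _)).
    near=> y; rewrite /flat; have -> // : 0 < y.
    by near: y; exact: lt_nbhsr.
  rewrite /flat x0 -![_ *: _]/(_ * _) !exprS.
  ring.
- rewrite /flat ltxx mulr0 oppr0 addr0 -/(flat j).
  have [df d0] : differentiable (flat j) (0 : R) /\ 'd (flat j) (0 : R) = \0 :> (R -> R).
    apply: differentiable_approx => [|e e0].
      exact: cst_continuous.
    pose C : R := j.+2%:R ^+ j.+2; have C0 : 0 < C by rewrite exprn_gt0.
    near=> h; rewrite addr0 /= {2}/flat ltxx !subr0.
    rewrite ger0_norm ?flat_ge0//.
    have [h0|h0] := ltP 0 h; last by rewrite /flat ltNge h0 /= mulr_ge0// ltW.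
    rewrite (le_trans (flat_le _ h0))// -/C gtr0_norm// expr2 mulrA ler_wpM2r ?ltW//.
    rewrite -ltr_pdivlMl// mulrC.
    apply: le_lt_trans (ler_norm _) _; near: h.
    have eC : 0 < e / C by rewrite divr_gt0.
    exact: (@nbhs0_lt _ R^o _ eC).
  by apply: DeriveDef; [exact: diff_derivable|rewrite deriveE// d0].
Unshelve. all: by end_near. Qed.

Lemma flat_smooth j : smooth_on setT (flat j).
Proof.
move=> k; elim: k j => [//|k IH] j.
have df x : differentiable (flat j) x.
  by have [dfx _] := flat_is_derive j x; exact/derivable1_diffP.
split=> // v.
apply: (@diff_order_eq _ _ _ _ _ (fun x => v * (- (j%:R * flat j.+1 x) + flat j.+2 x))).
- exact: openT.
- move=> x _; have [_ <-] := flat_is_derive j x.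
  by have := deriveZv (1 : R) v (df x); rewrite -[v *: 1]/(v * 1) mulr1 => ->.
- have oT := @openT R; apply: diff_orderM => //; first exact: diff_order_cst.
  apply: diff_orderD => //; apply: diff_orderN => //.
  by apply: diff_orderM => //; exact: diff_order_cst.
Qed.

(** The linear map [(y - a) *m alpha] is multiplied by a cutoff equal to 1 at [a]. As [y - a]
    vanishes at [a], the derivative of the cutoff does not contribute to the Jacobian there. *)
Lemma bump_function d (a : 'rV[R]_d) (r : R) (alpha : 'cV[R]_d) : 0 < r ->
  exists Phi : 'rV[R]_d -> 'rV[R]_1,
    [/\ smooth_on setT Phi, 'J Phi a = alpha &
        forall y, Phi y != 0 -> `|a - y| <= r].
Proof.
move=> r0; pose q (y : 'rV[R]_d) := r ^+ 2 - \sum_i (y 0 i - a 0 i) ^+ 2.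
(* Normalizes the cutoff to 1 at [a], where [q] equals [r ^+ 2]. *)
pose c0 := (flat 0 (r ^+ 2))^-1.
have c00 : flat 0 (r ^+ 2) != 0.
  by rewrite /flat exprn_gt0// expr0 mul1r gt_eqF// expR_gt0.
pose w y := (flat 0 (q y) * c0) *: alpha.
pose Phi y := (y - a) *m w y.
have oT := @openT 'rV[R]_d.
have sq k : diff_order k setT q.
  apply: diff_orderD => //; first exact: diff_order_cst.
  apply: diff_orderN => //; apply: diff_order_sum => // i.
  have hi : diff_order k setT (fun y : 'rV[R]_d => y 0 i - a 0 i).
    apply: diff_orderD => //; last exact: diff_order_cst.
    have /(diff_order_mxP _ _ oT) := @diff_order_id R 'rV[R]_d k setT; apply.
  by under eq_fun do rewrite expr2; exact: diff_orderM.
have sw k : diff_order k setT w.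
  apply: diff_order_scale => //; last exact: diff_order_cst.
  apply: diff_orderM => //; last exact: diff_order_cst.
  by apply: (@diff_order_comp1 _ _ _ _ setT) => //; exact: flat_smooth.
have sl k : diff_order k setT (fun y : 'rV[R]_d => y - a).
  by apply: diff_orderD => //; [exact: diff_order_id|exact: diff_order_cst].
exists Phi; split.
- by move=> k; exact: diff_order_mulmx.
- have dw : differentiable w a by have [+ _] := sw 1%N; apply.
  have dl : differentiable (fun y : 'rV[R]_d => y - a) a by have [+ _] := sl 1%N; apply.
  apply: jacobian_eq; first exact: differentiable_mulmx.
  move=> v; rewrite derive_mulmx// subrr mul0mx addr0.
  have -> : w a = alpha.
    rewrite /w /q big1 ?subr0; first by rewrite divff// scale1r.
    by move=> i _; rewrite subrr expr0n.
  have [_ ->] // : is_derive a v (fun y : 'rV[R]_d => y - a) v.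
  by apply: is_derive_eq; rewrite subr0.
- move=> y Py; have qy : 0 < q y.
    apply: contra_neqT Py => qy.
    by rewrite /Phi /w /flat (negbTE qy) mul0r scale0r mulmx0.
  (* The cutoff lives on a Euclidean ball while the norm is the maximum norm, so the bound is
     obtained coordinate by coordinate. *)
  have : forall i, `|(a - y) 0 i| <= r.
    move=> i; rewrite -ler_sqr ?nnegrE//; last exact: ltW.
    rewrite real_normK ?num_real//.
    move: qy; rewrite /q subr_gt0 => /ltW; apply: le_trans.
    rewrite (bigD1 i)//= !mxE -sqrrN opprB lerDl sumr_ge0// => l _.
    exact: sqr_ge0.
  move=> h; rewrite [leLHS]/Num.Def.normr /= mx_normrE.
  by apply: bigmax_le => [|[i' i] _]; [exact: ltW|rewrite (ord1 i')].
Qed.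

Lemma sqrt_smooth : smooth_on [set x : R | 0 < x] Num.sqrt.
Proof.
have oP : open [set x : R | 0 < x] by exact: open_gt.
elim=> [//|k IH].
have df (x : R) : 0 < x -> differentiable (@Num.sqrt R) x.
  by move=> /is_derive1_sqrt [h _]; exact/derivable1_diffP.
split=> // v.
apply: (@diff_order_eq _ _ _ _ _ (fun x => v * (2 * Num.sqrt x)^-1)) => //.
- move=> x /set_mem /= x0; have [_ <-] := is_derive1_sqrt x0.
  by have := deriveZv (1 : R) v (df x x0); rewrite -[v *: 1]/(v * 1) mulr1 => ->.
- apply: diff_orderM => //; first exact: diff_order_cst.
  apply: diff_orderV => //.
    by move=> x /= x0; rewrite mulf_neq0// gt_eqF// sqrtr_gt0.
  by apply: diff_orderM => //; exact: diff_order_cst.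
Qed.

Lemma diff_order_row_mx (V : normedModType R) m n1 n2 k (A : set V)
    (f : V -> 'M[R]_(m, n1)) (g : V -> 'M[R]_(m, n2)) : open A ->
  diff_order k A f -> diff_order k A g -> diff_order k A (fun x => row_mx (f x) (g x)).
Proof.
move=> oA hf hg; apply/diff_order_mxP => // i j; under eq_fun do rewrite mxE.
case: (fintype.split j) => j'; first by have /(diff_order_mxP _ _ oA) := hf; apply.
by have /(diff_order_mxP _ _ oA) := hg; apply.
Qed.

Lemma diff_order_col_mx (V : normedModType R) m1 m2 n k (A : set V)
    (f : V -> 'M[R]_(m1, n)) (g : V -> 'M[R]_(m2, n)) : open A ->
  diff_order k A f -> diff_order k A g -> diff_order k A (fun x => col_mx (f x) (g x)).
Proof.
move=> oA hf hg; apply/diff_order_mxP => // i j; under eq_fun do rewrite mxE.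
case: (fintype.split i) => i'; first by have /(diff_order_mxP _ _ oA) := hf; apply.
by have /(diff_order_mxP _ _ oA) := hg; apply.
Qed.

(** Completing the square: the first coordinate of [u] makes it orthogonal to the first basis
    vector, which leaves the Schur complement of [a]. *)
Lemma inner_block1 (n : nat) (a : R) (b : 'rV[R]_n) (C : 'M[R]_n) (v : 'rV[R]_n) :
  a != 0 -> let u : 'rV[R]_(1 + n) := row_mx (- (a^-1 *: (v *m b^T))) v in
  inner (block_mx a%:M b b^T C : 'M[R]_(1 + n)) u u = inner (C - a^-1 *: (b^T *m b)) v v.
Proof.
move=> a0; rewrite /inner /= mul_row_block tr_row_mx mul_row_col.
congr (fun_of_matrix _ 0 0).
rewrite mul_mx_scalar scalerN scalerA divff// scale1r addNr mul0mx add0r.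
rewrite mulNmx -scalemxAl addrC mulmxBr -scalemxAr mulmxBl mulmxA.
by rewrite -!scalemxAl mulmxDl mulNmx -!scalemxAl.
Qed.

(** One Gram-Schmidt step: [q] normalizes the first vector, its component is removed from the
    others, and [L] orthonormalizes what remains. *)
Lemma block_orthonormal (n : nat) (a q : R) (b : 'rV[R]_n) (C L : 'M[R]_n) :
  a != 0 -> q * a * q = 1 -> L *m (C - a^-1 *: (b^T *m b)) *m L^T = 1%:M ->
  let K : 'M[R]_(1 + n) := block_mx q%:M 0 (- (a^-1 *: (L *m b^T))) L in
  K *m block_mx a%:M b b^T C *m K^T = 1%:M.
Proof.
move=> a0 q2 LP /=; rewrite mulmx_block tr_block_mx mulmx_block.
have e1 : - (a^-1 *: (L *m b^T)) *m a%:M + L *m b^T = 0.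
  by rewrite mul_mx_scalar scalerN scalerA divff// scale1r addNr.
have e2 : - (a^-1 *: (L *m b^T)) *m b + L *m C = L *m (C - a^-1 *: (b^T *m b)).
  by rewrite mulNmx -scalemxAl addrC mulmxBr -scalemxAr mulmxA.
rewrite e1 e2 !mul0mx !addr0 !trmx0 !mulmx0 !add0r LP !addr0.
rewrite tr_scalar_mx -!scalar_mxM q2.
have -> : (q * a)%:M *m (- (a^-1 *: (L *m b^T)))^T + q%:M *m b *m L^T = 0.
  rewrite linearN linearZ /= trmx_mul trmxK !mul_scalar_mx.
  by rewrite scalerN scalerA mulfK// addrC -scalemxAl subrr.
by rewrite -scalar_mx_block.
Qed.

(* Induction on the size through the Schur complement; [L] is the inverse of a
   Cholesky factor of [S]. *)
Lemma smooth_orthonormalization (V : normedModType R) (A : set V) n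
    (S : V -> 'M[R]_n) : open A -> smooth_on A S ->
  (forall x, A x -> (S x)^T = S x) ->
  (forall x v, A x -> v != 0 -> 0 < inner (S x) v v) ->
  exists2 L : V -> 'M[R]_n, smooth_on A L &
    forall x, A x -> L x *m S x *m (L x)^T = 1%:M.
Proof.
move=> oA; elim: n S => [|n IH] S sS symS posS.
  exists (fun=> 1%:M) => [k|x _]; first exact: diff_order_cst.
  by apply/matrixP => -[].
pose S' x : 'M[R]_(1 + n) := S x.
pose s x := S' x 0 0; pose b x := ursubmx (S' x); pose C x := drsubmx (S' x).
have Sij i j : smooth_on A (fun x => S x i j).
  by move=> k; have /(diff_order_mxP _ _ oA) := sS k; apply.
have SE x : A x -> S' x = block_mx (s x)%:M (b x) (b x)^T (C x).
  move=> Ax; rewrite -[LHS]submxK; congr block_mx.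
    by apply/matrixP => i j; rewrite !mxE (ord1 i) (ord1 j) /= mulr1n /s; congr (S' x _ _); apply/val_inj.
  by rewrite /b trmx_ursub; rewrite [(S' x)^T]symS.
have s0 x : A x -> 0 < s x.
  move=> Ax; have /(posS x _ Ax) : delta_mx 0 0 != 0 :> 'rV[R]_n.+1.
    by apply/eqP => /matrixP/(_ 0 0)/eqP; rewrite !mxE eqxx oner_eq0.
  by rewrite /inner -rowE trmx_delta -colE !mxE.
have ss : smooth_on A s by exact: Sij.
have sb : smooth_on A b.
  move=> k; apply/diff_order_mxP => // i j.
  by under eq_fun do rewrite !mxE; exact: Sij.
have sC : smooth_on A C.
  move=> k; apply/diff_order_mxP => // i j.
  by under eq_fun do rewrite !mxE; exact: Sij.
have sV k : diff_order k A (fun x => (s x)^-1).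
  by apply: diff_orderV => // x /s0 sx; rewrite gt_eqF.
pose C' x := C x - (s x)^-1 *: ((b x)^T *m b x).
have [|x Ax|x v Ax v0|L sL LP] := IH C'.
- move=> k; apply: diff_orderD => //; apply: diff_order_opp => //.
  apply: diff_order_scale => //; apply: diff_order_mulmx => //.
  exact: diff_order_trmx.
- rewrite /C' linearB linearZ /= trmx_mul trmxK; congr (_ - _).
  by rewrite /C trmx_drsub; rewrite [(S' x)^T]symS.
- have sn : s x != 0 by rewrite gt_eqF// s0.
  rewrite /C' -(inner_block1 (b x) (C x) v sn) -SE//; apply: posS => //.
  apply/negP => /eqP /(congr1 (@rsubmx R 1 1 n)); rewrite row_mxKr linear0 => v00.
  by rewrite v00 eqxx in v0.
pose sg x := (Num.sqrt (s x))^-1.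
have ssg k : diff_order k A sg.
  apply: diff_orderV => //; first by move=> x /s0 sx; rewrite gt_eqF// sqrtr_gt0.
  exact: (diff_order_comp1 oA s0 (ss k) (sqrt_smooth k)).
exists (fun x => block_mx (sg x)%:M 0 (- ((s x)^-1 *: (L x *m (b x)^T))) (L x) : 'M[R]_(1 + n)).
  move=> k.
  have hb : diff_order k A (fun x => - ((s x)^-1 *: (L x *m (b x)^T))).
    apply: diff_order_opp => //; apply: diff_order_scale => //.
    by apply: diff_order_mulmx => //; exact: diff_order_trmx.
  rewrite /block_mx; apply: diff_order_col_mx => //; apply: diff_order_row_mx => //.
  - apply/diff_order_mxP => // i j; under eq_fun do rewrite !mxE (ord1 i) (ord1 j) mulr1n.
    exact: ssg.
  - exact: diff_order_cst.
move=> x Ax; have sn : s x != 0 by rewrite gt_eqF// s0.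
have q0 : Num.sqrt (s x) != 0 by rewrite gt_eqF// sqrtr_gt0 s0.
have sg2 : sg x * s x * sg x = 1.
  by rewrite /sg -[X in _ * X * _](sqr_sqrtr (ltW (s0 _ Ax))) expr2; field.
have := block_orthonormal sn sg2 (LP x Ax); rewrite -SE//; exact.
Qed.

End Bump.

(** * Metrics in coordinates *)

Section Inner.
Variables (R : realType) (m : nat).
Implicit Types (A B : 'M[R]_m) (u v w : 'rV[R]_m).

Lemma innerDl A u v w : inner A (u + v) w = inner A u w + inner A v w.
Proof. by rewrite /inner !mulmxDl mxE. Qed.

Lemma innerBl A u v w : inner A (u - v) w = inner A u w - inner A v w.
Proof. by rewrite /inner !mulmxBl !mxE. Qed.

Lemma innerDm A B u v : inner (A + B) u v = inner A u v + inner B u v.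
Proof. by rewrite /inner mulmxDr mulmxDl mxE. Qed.

Lemma innerBm A B u v : inner (A - B) u v = inner A u v - inner B u v.
Proof. by rewrite /inner mulmxBr mulmxBl !mxE. Qed.

Lemma innerZm a A u v : inner (a *: A) u v = a * inner A u v.
Proof. by rewrite /inner -scalemxAr -scalemxAl mxE. Qed.

Lemma innerZl a A u v : inner A (a *: u) v = a * inner A u v.
Proof. by rewrite /inner -!scalemxAl mxE. Qed.

Lemma innerC A u v : A^T = A -> inner A u v = inner A v u.
Proof.
by move=> As; rewrite /inner -[in LHS]As -{1}[u]trmxK -!trmx_mul mulmxA mxE.
Qed.

Lemma inner_mulmx A B u v : inner (B *m A) u v = inner A (u *m B) v.
Proof. by rewrite /inner !mulmxA. Qed.

Lemma inner_mulmx3 k (P : 'M[R]_k) (J : 'M[R]_(m, k)) u v :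
  inner (J *m P *m J^T) u v = inner P (u *m J) (v *m J).
Proof. by rewrite /inner trmx_mul !mulmxA. Qed.

Lemma inner_basis A v w : inner A v w = \sum_l w 0 l * inner A v (basis_vec R l).
Proof.
rewrite /inner mxE; apply: eq_bigr => l _.
by rewrite /basis_vec trmx_delta -colE !mxE mulrC.
Qed.

Lemma inner_basis2 A i j : inner A (basis_vec R i) (basis_vec R j) = A i j.
Proof. by rewrite /inner /basis_vec trmx_delta -rowE -colE !mxE. Qed.

Lemma derive_inner (V : normedModType R) (G : V -> 'M[R]_m) (X Y : V -> 'rV[R]_m) (x v : V) :
  differentiable G x -> differentiable X x -> differentiable Y x ->
  'D_v (fun y => inner (G y) (X y) (Y y)) x =
  inner ('D_v G x) (X x) (Y x) + inner (G x) ('D_v X x) (Y x)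
  + inner (G x) (X x) ('D_v Y x).
Proof.
move=> dG dX dY.
have dXG := differentiable_mulmx dX dG; have dYT := differentiable_trmx dY.
have := derive_entry v 0 0 (differentiable_mulmx dXG dYT) => <-.
rewrite (derive_mulmx _ dXG dYT) (derive_mulmx _ dX dG) (derive_trmx _ dY).
rewrite mulmxDl /inner mxE [X in X + _]mxE.
by congr (_ + _); exact: addrC.
Qed.

End Inner.

(** * Lie derivatives of a metric in coordinates *)

Section LocalGeometryLemmas.
Variables (R : realType) (m : nat).
Implicit Types (G : 'rV[R]_m -> 'M[R]_m) (X E : 'rV[R]_m -> 'rV[R]_m).

(* As a quadratic form on tangent vectors, this is half the Lie derivative of
   the metric [G] along [X]. *)
Definition half_lie G X (x : 'rV[R]_m) : 'M[R]_m :=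
  2^-1 *: 'D_(X x) G x + 'J X x *m G x.

Lemma inner_half_lie G X x u v : differentiable X x ->
  inner (half_lie G X x) u v =
  2^-1 * inner ('D_(X x) G x) u v + inner (G x) ('D_u X x) v.
Proof.
move=> dX; rewrite /half_lie innerDm innerZm inner_mulmx; congr (_ + _).
by rewrite (deriveEjacobian _ dX).
Qed.

(** Lowering the index cancels the inverse metric in [christoffel]; linearity in [w] then extends
    the formula from basis vectors. *)
Lemma christoffel_lower G x u v w : differentiable G x -> G x \in unitmx ->
  inner (G x) (christoffel G x u v) w =
  2^-1 * (inner ('D_u G x) v w + inner ('D_v G x) u w - inner ('D_w G x) u v).
Proof.
move=> dG Gu.
have -> : inner ('D_w G x) u v = \sum_l w 0 l * inner ('D_(basis_vec R l) G x) u v.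
  rewrite (derive_sum_basis w dG) /inner mulmx_sumr mulmx_suml summxE.
  by apply: eq_bigr => l _; rewrite -scalemxAr -scalemxAl mxE.
rewrite [in LHS]inner_basis [X in _ = _ * (X + _ - _)]inner_basis.
rewrite [X in _ = _ * (_ + X - _)]inner_basis.
rewrite -big_split -sumrB mulr_sumr; apply: eq_bigr => l _ /=.
rewrite -mulrDr -mulrBr [RHS]mulrCA; congr (_ * _).
rewrite {1}/inner /christoffel mulmxKV // /basis_vec trmx_delta -colE.
by rewrite [LHS]mxE [LHS]mxE.
Qed.

Lemma hessian_lie G E X x :
  differentiable G x -> G x \in unitmx -> (G x)^T = G x ->
  differentiable E x -> differentiable X x ->
  (\forall y \near x, inner (G y) (E y) (X y) = 0) ->
  inner (G x) (cov_deriv G E E x) (X x) = - inner (half_lie G X x) (E x) (E x).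
Proof.
(* [p] is the derivative of [inner (G y) (E y) (X y)] along [E], [q + r + s] its expansion by the
   product rule, and [b] the Christoffel part of the covariant derivative. *)
have key (a b c d p q r s t : R) : p = q + r + s -> p = 0 -> a = r + b ->
    b = 2^-1 * (q + q - c) -> d = 2^-1 * c + t -> t = s -> a = - d by move=> *; lra.
move=> dG Gu Gs dE dX EX.
have h1 := derive_inner (E x) dG dE dX.
have h0 : 'D_(E x) (fun y => inner (G y) (E y) (X y)) x = 0.
  apply: etrans (near_eq_derive (E x) EX) _; exact: derive_cst.
have h2 := innerDl (G x) ('D_(E x) E x) (christoffel G x (E x) (E x)) (X x).
have h3 := christoffel_lower (E x) (E x) (X x) dG Gu.
have h4 := inner_half_lie G (E x) (E x) dX.
have h5 := innerC ('D_(E x) X x) (E x) Gs.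
exact: key h1 h0 h2 h3 h4 h5.
Qed.

(** On [(E, E)], [half_lie] is half the derivative of [G(E, E)] along [X] plus [G(w, E)], where [w]
    is the bracket of [E] and [X]. The two metrics agree on both terms. *)
Lemma lie_change G G0 E X x :
  differentiable G x -> differentiable G0 x -> (G x)^T = G x -> (G0 x)^T = G0 x ->
  differentiable E x -> differentiable X x ->
  (\forall y \near x, inner (G y) (E y) (E y) = inner (G0 y) (E y) (E y)) ->
  (let w := 'D_(E x) X x - 'D_(X x) E x in
   inner (G x) w (E x) = inner (G0 x) w (E x)) ->
  inner (half_lie G X x) (E x) (E x) = inner (half_lie G0 X x) (E x) (E x).
Proof.
have key (p p0 q q0 r r0 s s0 a a0 c c0 : R) : p = p0 -> p = q + r + s ->
  p0 = q0 + r0 + s0 -> a = 2^-1 * q + c -> a0 = 2^-1 * q0 + c0 ->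
  r = s -> r0 = s0 -> c - r = c0 - r0 -> a = a0 by move=> *; lra.
move=> dG dG0 Gs G0s dE dX EE /=.
rewrite (innerBl (G x)) (innerBl (G0 x)) => br.
have h := near_eq_derive (X x) EE.
have h1 := derive_inner (X x) dG dE dE.
have h2 := derive_inner (X x) dG0 dE dE.
have h3 := inner_half_lie G (E x) (E x) dX.
have h4 := inner_half_lie G0 (E x) (E x) dX.
have h5 := innerC ('D_(X x) E x) (E x) Gs.
have h6 := innerC ('D_(X x) E x) (E x) G0s.
exact: key h h1 h2 h3 h4 h5 h6 br.
Qed.

Lemma half_lieB G X Y x u v : differentiable X x -> differentiable Y x ->
  differentiable G x ->
  inner (half_lie G (fun y => X y - Y y) x) u v =
  inner (half_lie G X x) u v - inner (half_lie G Y x) u v.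
Proof.
have key (a a1 a2 b b' c c' : R) : a = 2^-1 * (b - b') + (c - c') ->
  a1 = 2^-1 * b + c -> a2 = 2^-1 * b' + c' -> a = a1 - a2 by move=> *; lra.
move=> dX dY dG.
have h0 := inner_half_lie G u v (differentiableB dX dY).
have h1 := inner_half_lie G u v dX.
have h2 := inner_half_lie G u v dY.
have e1 : 'D_(X x - Y x) G x = 'D_(X x) G x - 'D_(Y x) G x.
  by rewrite deriveE// linearB /= -!deriveE.
have e2 : 'D_u (X \- Y) x = 'D_u X x - 'D_u Y x.
  apply: (@deriveB _ _ _ X Y); exact: diff_derivable.
rewrite e1 e2 (innerBm ('D_(X x) G x)) (innerBl (G x)) in h0.
exact: key h0 h1 h2.
Qed.

(** The extra term [dphi(u) X] of the product rule vanishes because [phi] is stationary in direction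
    [u]. It serves for [phi] constant along the fibers and [u] vertical. *)
Lemma half_lieZ G X (phi : 'rV[R]_m -> 'rV[R]_1) x u v :
  differentiable X x -> differentiable phi x -> differentiable G x ->
  'D_u phi x = 0 ->
  inner (half_lie G (fun y => phi y *m X y) x) u v =
  phi x 0 0 * inner (half_lie G X x) u v.
Proof.
have key (a b c p q : R) : a = 2^-1 * (c * p) + c * q -> b = 2^-1 * p + q ->
  a = c * b by move=> -> ->; ring.
move=> dX dphi dG Du.
have h0 := inner_half_lie G u v (differentiable_mulmx dphi dX).
have h1 := inner_half_lie G u v dX.
have pX : phi x *m X x = phi x 0 0 *: X x.
  by rewrite [phi x in LHS]mx11_scalar mul_scalar_mx.
have pD : phi x *m 'D_u X x = phi x 0 0 *: 'D_u X x.
  by rewrite [phi x in LHS]mx11_scalar mul_scalar_mx.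
rewrite (derive_mulmx _ dphi dX) Du mul0mx add0r pX pD (deriveZv _ _ dG) in h0.
rewrite (innerZm (phi x 0 0)) (innerZl (phi x 0 0)) in h0.
exact: key h0 h1.
Qed.

Lemma near_eq_half_lie G X Y x : (\forall y \near x, X y = Y y) ->
  differentiable X x -> half_lie G X x = half_lie G Y x.
Proof.
move=> XY dX; rewrite /half_lie (nbhs_singleton XY).
by rewrite (near_eq_jacobian XY dX).
Qed.

End LocalGeometryLemmas.

(** * Divergence in a parametrized submanifold *)

Section Divergence.
Variable R : realType.

(** The contraction of [a i l - a l i], antisymmetric, with the symmetric [T] is zero. In
    [divergenceE] this removes two of the three terms of the contracted Christoffel symbol. *)
Lemma trace_antisym n (a b T : 'I_n -> 'I_n -> R) :
  (forall i l, T i l = T l i) ->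
  \sum_i \sum_l 2^-1 * (a i l + b i l - a l i) * T l i =
  2^-1 * \sum_i \sum_l b i l * T l i.
Proof.
move=> Ts.
have h : \sum_i \sum_l a l i * T l i = \sum_i \sum_l a i l * T l i.
  by rewrite exchange_big; apply: eq_bigr => i _; apply: eq_bigr => l _; rewrite Ts.
transitivity (2^-1 * (\sum_i \sum_l a i l * T l i + \sum_i \sum_l b i l * T l i
    - \sum_i \sum_l a l i * T l i)); last by rewrite h; congr (_ * _); ring.
rewrite -big_split -sumrB mulr_sumr; apply: eq_bigr => i _.
by rewrite -big_split -sumrB mulr_sumr; apply: eq_bigr => l _ /=; ring.
Qed.

(** The second summand is the derivative along [X] of the logarithm of the volume density
    [sqrt(det P)]. *)
Lemma divergenceE n (P : 'rV[R]_n -> 'M[R]_n) (X : 'rV[R]_n -> 'rV[R]_n) u :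
  differentiable X u -> (P u)^T = P u -> (forall w, ('D_w P u)^T = 'D_w P u) ->
  divergence P X u = \tr ('J X u) + 2^-1 * \tr ('D_(X u) P u *m invmx (P u)).
Proof.
move=> dX Ps DPs; rewrite /divergence.
have Ts i l : invmx (P u) i l = invmx (P u) l i.
  by rewrite -[in LHS]Ps -trmx_inv mxE.
have -> : 2^-1 * \tr ('D_(X u) P u *m invmx (P u)) =
   \sum_i christoffel P u (basis_vec R i) (X u) 0 i.
  rewrite /mxtrace; under [in LHS]eq_bigr do rewrite mxE.
  rewrite -(trace_antisym (fun i l => inner ('D_(basis_vec R i) P u) (X u) (basis_vec R l))
    ('D_(X u) P u) Ts); apply: eq_bigr => i _.
  rewrite /christoffel [RHS]mxE; apply: eq_bigr => l _.
  rewrite [in RHS]mxE inner_basis2; congr (_ * (_ - _) * _).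
  exact: innerC.
rewrite -big_split; apply: eq_bigr => i _ /=.
rewrite /cov_deriv [LHS]mxE /cst; congr (_ + _).
by rewrite (deriveEjacobian _ dX) /basis_vec -rowE mxE.
Qed.

(** [B] and [DG] stand for the derivatives of [J] and [G] along the field, and the last hypothesis
    is the derivative of [X J = xi o s]. Multiplying it by [G J^T T] and taking traces eliminates
    [JX]. *)
Lemma trace_divergence n m (JX S T : 'M[R]_n) (J B : 'M[R]_(n, m)) (G DG Jxi : 'M[R]_m) :
  G^T = G -> S = J *m G *m J^T -> T^T = T -> S *m T = 1%:M ->
  JX *m J + B = J *m Jxi ->
  \tr JX + 2^-1 * \tr ((B *m G *m J^T + J *m DG *m J^T + J *m G *m B^T) *m T) =
  \tr (J *m (2^-1 *: DG + Jxi *m G) *m J^T *m T).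
Proof.
move=> Gs SE Ts ST h.
have e1 : \tr (J *m G *m B^T *m T) = \tr (B *m G *m J^T *m T).
  by rewrite -mxtrace_tr !trmx_mul trmxK Ts Gs mxtrace_mulC !mulmxA.
have e2 : \tr JX = \tr (J *m Jxi *m G *m J^T *m T) - \tr (B *m G *m J^T *m T).
  by rewrite -h !mulmxDl mxtraceD addrK -[in LHS](mulmx1 JX) -ST SE !mulmxA.
rewrite !mulmxDl mulmxDr !mulmxDl !mxtraceD e1 e2 -scalemxAr -!scalemxAl mxtraceZ !mulmxA.
move: (\tr _) (\tr _) (\tr _) => a b c.
lra.
Qed.

Lemma derive_mulmxl (V : normedModType R) m n p (M : 'M[R]_(m, n)) (f : V -> 'M[R]_(n, p)) x v :
  differentiable f x -> 'D_v (fun y => M *m f y) x = M *m 'D_v f x.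
Proof.
move=> df; have dM : differentiable (fun=> M) x by exact: differentiable_cst.
have D0 : 'D_v (fun=> M) x = 0 by exact: derive_cst.
by rewrite (derive_mulmx v dM df) D0 mul0mx add0r.
Qed.

(** Equality of mixed second derivatives of [s], read off the rows of its Jacobian. *)
Lemma jacobian_derivC n m (A : set 'rV[R]_n) (s : 'rV[R]_n -> 'rV[R]_m) u v w :
  open A -> smooth_on A s -> A u ->
  v *m 'D_w (jacobian s) u = w *m 'D_v (jacobian s) u.
Proof.
move=> oA ss Au; have [ds _] := (smooth_onP _ _).1 ss.
have dJ : differentiable (jacobian s) u.
  by have [+ _] := diff_order_jacobian oA (ss 2%N); apply.
have h a b : a *m 'D_b (jacobian s) u = 'D_b ('D_a s) u.
  rewrite -(derive_mulmxl _ _ dJ); apply: near_eq_derive.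
  apply: filterS (open_nbhs_nbhs (conj oA Au)) => y Ay.
  exact: esym (deriveEjacobian _ (ds _ Ay)).
by apply: etrans (h v w) (etrans _ (esym (h w v))); exact: deriveC oA ss Au.
Qed.

(** Differentiate [P = J G J^T] along [X] and [X J = xi o s] in every direction; by symmetry of the
    second derivatives of [s] the terms fit [trace_divergence]. The intrinsic divergence thus
    becomes a trace over the tangent space of an ambient quadratic form. *)
Lemma divergence_pullback n m (A : set 'rV[R]_n) (s : 'rV[R]_n -> 'rV[R]_m)
    (G : 'rV[R]_m -> 'M[R]_m) (xi : 'rV[R]_m -> 'rV[R]_m)
    (P : 'rV[R]_n -> 'M[R]_n) (X : 'rV[R]_n -> 'rV[R]_n) u :
  open A -> smooth_on A s -> A u ->
  differentiable G (s u) -> (forall y, A y -> (G (s y))^T = G (s y)) ->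
  (forall y, A y -> P y = 'J s y *m G (s y) *m ('J s y)^T) -> P u \in unitmx ->
  differentiable X u -> differentiable xi (s u) ->
  (forall y, A y -> X y *m 'J s y = xi (s y)) ->
  divergence P X u =
  \tr ('J s u *m half_lie G xi (s u) *m ('J s u)^T *m invmx (P u)).
Proof.
move=> oA ss Au dG Gs PE Pu dX dxi Xxi; have [ds _] := (smooth_onP _ _).1 ss.
have nA := open_nbhs_nbhs (conj oA Au).
have dJ : differentiable (jacobian s) u.
  by have [+ _] := diff_order_jacobian oA (ss 2%N); apply.
have dsu := ds u Au.
have dGs : differentiable (G \o s) u by exact: differentiable_comp.
have dJG := differentiable_mulmx dJ dGs.
have dJT := differentiable_trmx dJ.
have PE' : \forall y \near u, P y = 'J s y *m (G \o s) y *m ('J s y)^T.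
  by apply: filterS nA => y /PE.
have PT : \forall y \near u, P y = (P y)^T.
  by apply: filterS nA => y Ay; rewrite (PE _ Ay) !trmx_mul trmxK Gs// mulmxA.
have dP : differentiable P u.
  apply: near_eq_differentiable (differentiable_mulmx dJG dJT).
  by apply: filterS PE' => y; exact: esym.
have DP w : 'D_w P u = 'D_w (jacobian s) u *m G (s u) *m ('J s u)^T
    + 'J s u *m 'D_(w *m 'J s u) G (s u) *m ('J s u)^T
    + 'J s u *m G (s u) *m ('D_w (jacobian s) u)^T.
  apply: etrans (near_eq_derive w PE') _.
  rewrite (derive_mulmx _ dJG dJT) (derive_mulmx _ dJ dGs) (derive_trmx _ dJ).
  by rewrite (derive_comp _ dsu dG) (deriveEjacobian _ dsu) mulmxDl.
have DPs w : ('D_w P u)^T = 'D_w P u.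
  rewrite -(derive_trmx _ dP); exact: esym (near_eq_derive w PT).
rewrite (divergenceE dX _ DPs); last exact: esym (nbhs_singleton PT).
rewrite DP (Xxi _ Au) /half_lie; apply: trace_divergence.
- exact: Gs.
- exact: PE.
- by rewrite trmx_inv -(nbhs_singleton PT).
- exact: mulmxV.
have H (w : 'rV[R]_n) : w *m ('J X u *m 'J s u + 'D_(X u) (jacobian s) u) =
    w *m ('J s u *m 'J xi (s u)).
  have e : \forall y \near u, X y *m 'J s y = (xi \o s) y.
    by apply: filterS nA => y /Xxi.
  have := near_eq_derive w e.
  rewrite (derive_mulmx _ dX dJ) (derive_comp _ dsu dxi) (deriveEjacobian _ dsu).
  rewrite (deriveEjacobian _ dX) (deriveEjacobian _ dxi).
  rewrite (jacobian_derivC (X u) w oA ss Au) mulmxDr !mulmxA.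
  exact.
by apply/row_matrixP => i; rewrite !rowE; exact: H.
Qed.

End Divergence.

(** * Charts *)

(** Separate arguments for the chart ([p]) and the point ([r]) allow one chart to be used on a whole
    neighborhood. It is locked so that Jacobians are unfolded only on demand. *)
HB.lock Definition jac_at (R : realType) m (M : manifold R m) k
    (h : M -> 'rV[R]_k) (p r : M) : 'M[R]_(m, k) :=
  'J (h \o chart_inv (chart_at p)) (chart_at p r).

(** Acts on row vectors from the right: [trans r p r] takes the preferred coordinates of the tangent
    space at [r] to those of the chart at [p]. *)
Definition trans (R : realType) m (M : manifold R m) (p q r : M) : 'M[R]_m :=
  jac_at (chart_at q) p r.

Section CongruenceAlgebra.
Variable R : realType.

Lemma unitmx_inverse n (A B : 'M[R]_n) : A *m B = 1%:M -> A \in unitmx.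
Proof. by move/mulmx1_unit => []. Qed.

Lemma invmx_congr n (T T' g : 'M[R]_n) : T *m T' = 1%:M -> g \in unitmx ->
  invmx (T *m g *m T^T) = T'^T *m invmx g *m T'.
Proof.
move=> TT gu; have [Tu T'u] := mulmx1_unit TT.
have Su : T *m g *m T^T \in unitmx by rewrite !unitmx_mul unitmx_tr Tu gu.
apply: (can_inj (mulKmx Su)); rewrite mulmxV// !mulmxA.
by rewrite -[_ *m T^T *m _]mulmxA -trmx_mul (mulmx1C TT) trmx1 mulmx1 mulmxK.
Qed.

Lemma grad_congr n k (T T' g : 'M[R]_n) (w : 'M[R]_(n, k)) :
  T *m T' = 1%:M -> g \in unitmx ->
  (T *m w)^T *m invmx (T *m g *m T^T) = w^T *m invmx g *m T'.
Proof.
move=> TT gu; rewrite (invmx_congr TT gu) trmx_mul !mulmxA.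
by rewrite -[_ *m T^T *m _]mulmxA -trmx_mul (mulmx1C TT) trmx1 mulmx1.
Qed.

End CongruenceAlgebra.

(** * Change of charts for functions, fields, metrics and gradients *)

Section Charts.
Variables (R : realType) (m : nat) (M : manifold R m).
Implicit Types p q r : M.

Local Notation dom p := (chart_dom (chart_at p)).
Local Notation inv p := (chart_inv (chart_at p)).

Lemma chart_imageP p (U : set M) x :
  (chart_at p @` (U `&` dom p)) x <->
  [/\ U (inv p x), dom p (inv p x) & chart_at p (inv p x) = x].
Proof.
split=> [[r [Ur pr] <-]|[h1 h2 h3]]; first by rewrite chart_mapK.
by exists (inv p x).
Qed.

Lemma mem_chart_image p (U : set M) r : U r -> dom p r ->
  (chart_at p @` (U `&` dom p)) (chart_at p r).
Proof. by move=> Ur pr; exists r. Qed.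

Lemma open_chart_image p (U : set M) : open U -> open (chart_at p @` (U `&` dom p)).
Proof.
move=> oU.
have -> : chart_at p @` (U `&` dom p) = chart_at p @` dom p `&` inv p @^-1` U.
  apply/seteqP; split=> x.
    by move=> [r [Ur pr] <-]; split; [exists r|rewrite /= chart_mapK].
  by move=> [[r pr <-]] /=; rewrite chart_mapK// => Ur; exists r.
apply: open_preimage_on => //; first exact: chart_cod_open.
exact: chart_inv_continuous.
Qed.

Lemma open_chart_preimage p (O : set 'rV[R]_m) : open O ->
  open (dom p `&` chart_at p @^-1` O).
Proof.
move=> oO; apply: open_preimage_on => //; first exact: chart_dom_open.
exact: chart_map_continuous.
Qed.

Local Notation trans := (@trans R m M).

Definition smooth_mfun k (U : set M) (h : M -> 'rV[R]_k) : Prop :=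
  forall p, smooth_on (chart_at p @` (U `&` dom p)) (h \o inv p).

Lemma smooth_mfun_differentiable k (U : set M) (h : M -> 'rV[R]_k) p r :
  smooth_mfun U h -> U r -> dom p r -> differentiable (h \o inv p) (chart_at p r).
Proof.
move=> /(_ p 1%N)[dh _] Ur pr; apply: dh; exact: mem_chart_image.
Qed.

Lemma smooth_chart q : smooth_mfun (dom q) (chart_at q).
Proof. by move=> p; rewrite setIC; exact: transition_smooth. Qed.

Lemma near_chart p r (U : set M) : open U -> U r -> dom p r ->
  \forall x \near chart_at p r, [/\ U (inv p x), dom p (inv p x) &
    chart_at p (inv p x) = x].
Proof.
move=> oU Ur pr.
have := open_nbhs_nbhs (conj (open_chart_image oU) (mem_chart_image Ur pr)).
by apply: filterS => x /chart_imageP.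
Qed.

Lemma jac_at_comp k (h : M -> 'rV[R]_k) p q r : dom p r -> dom q r ->
  differentiable (h \o inv q) (chart_at q r) ->
  differentiable (h \o inv p) (chart_at p r) /\
  jac_at h p r = trans p q r *m jac_at h q r.
Proof.
move=> pr qr dh.
have dt : differentiable (chart_at q \o inv p) (chart_at p r).
  exact: (smooth_mfun_differentiable (@smooth_chart q)).
have dh' : differentiable (h \o inv q) ((chart_at q \o inv p) (chart_at p r)).
  by rewrite /= (chart_mapK pr).
have e : \forall x \near chart_at p r,
    ((h \o inv q) \o (chart_at q \o inv p)) x = (h \o inv p) x.
  apply: filterS (near_chart (chart_dom_open (chart_at q)) qr pr) => x [h1 h2 h3] /=.
  by rewrite chart_mapK.
have dc := differentiable_comp dt dh'.
split; first exact: near_eq_differentiable e dc.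
rewrite /trans jac_at.unlock -(near_eq_jacobian e dc) (jacobian_comp dt dh').
by rewrite /= (chart_mapK pr).
Qed.

Lemma trans_id p r : dom p r -> trans p p r = 1%:M.
Proof.
move=> pr; rewrite /trans jac_at.unlock -(jacobian_id (chart_at p r)).
have e : \forall x \near chart_at p r, x = (chart_at p \o inv p) x.
  by apply: filterS (near_chart openT I pr) => x [_ _ h].
by symmetry; apply: near_eq_jacobian e _; exact: ex_diff.
Qed.

Lemma trans_comp p q s r : dom p r -> dom q r -> dom s r ->
  trans p s r = trans p q r *m trans q s r.
Proof.
move=> pr qr sr; have [] // := @jac_at_comp _ (chart_at s) p q r pr qr.
exact: (smooth_mfun_differentiable (@smooth_chart s)).
Qed.

Lemma trans_inv p q r : dom p r -> dom q r -> trans p q r *m trans q p r = 1%:M.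
Proof. by move=> pr qr; rewrite -trans_comp// trans_id. Qed.

Lemma trans_unit p q r : dom p r -> dom q r -> trans p q r \in unitmx.
Proof. by move=> pr qr; exact: unitmx_inverse (trans_inv pr qr). Qed.

Lemma metric_chartE (g : M -> 'M[R]_m) p r : dom p r ->
  metric_in_chart g (chart_at p) (chart_at p r) =
  trans p r r *m g r *m (trans p r r)^T.
Proof.
by move=> pr; rewrite /metric_in_chart /pullback /param_diff (chart_mapK pr) /trans jac_at.unlock.
Qed.

Lemma field_chartE (X : M -> 'rV[R]_m) p r : dom p r ->
  field_in_chart X (chart_at p) (chart_at p r) = X r *m trans r p r.
Proof. by move=> pr; rewrite /field_in_chart (chart_mapK pr) /trans jac_at.unlock. Qed.

Lemma metric_chart_center (g : M -> 'M[R]_m) p :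
  metric_in_chart g (chart_at p) (chart_at p p) = g p.
Proof.
have pp := chart_atP p.
by rewrite metric_chartE// trans_id// trmx1 mulmx1 mul1mx.
Qed.

Lemma field_chart_center (X : M -> 'rV[R]_m) p :
  field_in_chart X (chart_at p) (chart_at p p) = X p.
Proof.
have pp := chart_atP p.
by rewrite field_chartE// trans_id// mulmx1.
Qed.

Lemma posdef_unitmx k (A : 'M[R]_k) :
  (forall v : 'rV[R]_k, v != 0 -> 0 < inner A v v) -> A \in unitmx.
Proof.
move=> pA; rewrite -row_free_unit -kermx_eq0; apply/rowV0P => v /sub_kermxP vA.
apply/eqP; apply/negP => /negP /pA; rewrite /inner vA mul0mx mxE ltxx //.
Qed.

Section Metric.
Variable g : M -> 'M[R]_m.
Hypothesis hg : riemannian g.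

Lemma riemannian_unit r : g r \in unitmx.
Proof. by have [_ pg _] := hg; apply: posdef_unitmx => v; exact: pg. Qed.

Lemma metric_chart_sym p r : dom p r ->
  (metric_in_chart g (chart_at p) (chart_at p r))^T =
  metric_in_chart g (chart_at p) (chart_at p r).
Proof.
by have [sg _ _] := hg; move=> pr; rewrite metric_chartE// !trmx_mul trmxK sg mulmxA.
Qed.

Lemma metric_chart_pos p r (v : 'rV[R]_m) : dom p r -> v != 0 ->
  0 < inner (metric_in_chart g (chart_at p) (chart_at p r)) v v.
Proof.
have [_ pg _] := hg; move=> pr v0; rewrite metric_chartE// inner_mulmx3; apply: pg.
apply: contra_neq v0 => /(congr1 (mulmx^~ (trans r p r))).
by rewrite -mulmxA trans_inv ?mulmx1 ?mul0mx//; exact: chart_atP.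
Qed.

Lemma metric_chart_unit p r : dom p r ->
  metric_in_chart g (chart_at p) (chart_at p r) \in unitmx.
Proof. by move=> pr; apply: posdef_unitmx => v; exact: metric_chart_pos. Qed.

Lemma metric_chart_smooth p (U : set M) :
  smooth_on (chart_at p @` (U `&` dom p)) (metric_in_chart g (chart_at p)).
Proof.
have [_ _ sg] := hg; move=> k; apply: diff_order_subset (sg p k).
by move=> x [r [_ pr] <-]; exists r.
Qed.

Lemma invmx_metric_chart p r : dom p r ->
  invmx (metric_in_chart g (chart_at p) (chart_at p r)) =
  (trans r p r)^T *m invmx (g r) *m trans r p r.
Proof.
move=> pr; have rr := chart_atP r; rewrite metric_chartE//.
exact: invmx_congr (trans_inv pr rr) (riemannian_unit r).
Qed.

Definition grad k (h : M -> 'rV[R]_k) r : 'M[R]_(k, m) :=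
  (jac_at h r r)^T *m invmx (g r).

Lemma grad_chartE (h : M -> 'rV[R]_1) p r : dom p r ->
  differentiable (h \o inv r) (chart_at r r) ->
  field_in_chart (grad h) (chart_at p) (chart_at p r) =
  (jac_at h p r)^T *m invmx (metric_in_chart g (chart_at p) (chart_at p r)).
Proof.
move=> pr dh; have rr := chart_atP r.
have [_ ->] := jac_at_comp pr rr dh.
rewrite field_chartE// metric_chartE//; symmetry.
exact: grad_congr (trans_inv pr rr) (riemannian_unit r).
Qed.

End Metric.

End Charts.

(** * Submersions *)

Section SubmersionAlgebra.
Variable R : realType.

Lemma inner_eq0 m (A : 'M[R]_m) (u : 'rV[R]_m) :
  (forall v, v != 0 -> 0 < inner A v v) -> inner A u u = 0 -> u = 0.
Proof.
by move=> pA; apply: contra_eq => /pA; rewrite lt_def => /andP[].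
Qed.

Lemma posdef_inv m (A : 'M[R]_m) : A^T = A ->
  (forall v, v != 0 -> 0 < inner A v v) ->
  forall v, v != 0 -> 0 < inner (invmx A) v v.
Proof.
move=> As pA v v0; have Au := posdef_unitmx pA.
have -> : inner (invmx A) v v = inner A (v *m invmx A) (v *m invmx A).
  by rewrite -inner_mulmx3 trmx_inv As mulVmx// mul1mx.
apply: pA; apply: contra_neq v0 => /(congr1 (mulmx^~ A)).
by rewrite mulmxKV// mul0mx.
Qed.

Lemma row_free_mul m d (P : 'M[R]_(m, d)) (v : 'rV[R]_d) :
  \rank P = d -> v *m P^T = 0 -> v = 0.
Proof.
move=> rP vP; have : row_free P^T by rewrite /row_free mxrank_tr rP.
by move/row_free_inj => inj; apply: inj; rewrite vP mul0mx.
Qed.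

(* The rows of [P^T A^-1] are the horizontal lifts of a coframe: [A] on them
   agrees with [B] on their images under [P]. *)
Lemma submersion_matrix m d (P : 'M[R]_(m, d)) (A : 'M[R]_m) (B : 'M[R]_d) :
  A^T = A -> (forall v, v != 0 -> 0 < inner A v v) -> \rank P = d ->
  (forall X Y : 'rV[R]_m, (X <= kermx (A *m (kermx P)^T))%MS ->
     (Y <= kermx (A *m (kermx P)^T))%MS ->
     inner A X Y = inner B (X *m P) (Y *m P)) ->
  P^T *m invmx A *m P = invmx B.
Proof.
move=> As pA rP h; have Au := posdef_unitmx pA.
pose Y := P^T *m invmx A; set Q := _ *m P.
have hY i : (row i Y <= kermx (A *m (kermx P)^T))%MS.
  apply/sub_kermxP; rewrite mulmxA -!row_mul mulmxKV//.
  by rewrite -trmx_mul mulmx_ker trmx0 row0.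
have Qs : Q^T = Q by rewrite /Q !trmx_mul trmxK trmx_inv As mulmxA.
(* On the lifts the hypothesis compares Gram matrices: [Q] itself on one side, [Q B Q] on the other.
   Since [Q] is positive definite it can be cancelled. *)
have QB : Q *m B *m Q = Q.
  rewrite -{2}Qs; apply/matrixP => i j.
  have := h _ _ (hY i) (hY j); rewrite -!row_mul -/Q.
  have rE k (Z : 'M[R]_(d, k)) (C : 'M[R]_k) :
      inner C (row i Z) (row j Z) = (Z *m C *m Z^T) i j.
    by rewrite !rowE -inner_mulmx3 inner_basis2.
  rewrite !rE => <-; congr (fun_of_matrix _ i j).
  by rewrite /Y trmx_mul trmxK trmx_inv As mulmxKV// mulmxA.
have Qu : Q \in unitmx.
  apply: posdef_unitmx => v v0.
  have -> : inner Q v v = inner (invmx A) (v *m P^T) (v *m P^T).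
    by rewrite -inner_mulmx3 trmxK.
  by apply: posdef_inv => //; apply: contra_neq v0; exact: row_free_mul.
have BQ : B *m Q = 1%:M.
  by apply: (can_inj (mulKmx Qu)); rewrite mulmxA QB mulmx1.
have [Bu _] := mulmx1_unit BQ.
by apply: (can_inj (mulKmx Bu)); rewrite BQ mulmxV.
Qed.

(** Positive definiteness makes the kernel and its orthogonal complement a direct sum decomposition,
    so the projection onto the latter vanishes exactly on the kernel. *)
Lemma proj_horizontal_eq0 m d (P : 'M[R]_(m, d)) (A : 'M[R]_m) (v : 'rV[R]_m) :
  (forall v, v != 0 -> 0 < inner A v v) ->
  v *m proj_mx (kermx (A *m (kermx P)^T)) (kermx P) = 0 <-> v *m P = 0.
Proof.
move=> pA; have Au := posdef_unitmx pA.
set H := kermx (A *m _); set V := kermx P.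
have cap : (H :&: V)%MS = 0.
  apply/eqP/rowV0P => u; rewrite sub_capmx => /andP[/sub_kermxP uH /submxP[w uE]].
  apply: (inner_eq0 pA); rewrite /inner [X in _ *m X^T]uE trmx_mul -mulmxA.
  by rewrite [A *m _]mulmxA mulmxA uH mul0mx mxE.
have full : (v <= H + V)%MS.
  suff /submx_full -> : row_full (H + V)%MS by [].
  rewrite /row_full; have := mxrank_sum_cap H V; rewrite cap mxrank0 addn0 => ->.
  rewrite {1}/H mxrank_ker eqmxMfull ?row_full_unit// mxrank_tr subnK//.
  exact: rank_leq_row.
split=> [v0|vP]; last by apply: proj_mx_0 => //; exact/sub_kermxP.
apply/sub_kermxP; rewrite -(add_proj_mx cap full) v0 add0r.
exact: proj_mx_sub.
Qed.

End SubmersionAlgebra.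

(** * A submersion read in charts *)

Section Submersions.
Variables (R : realType) (m d : nat) (M : manifold R m) (N : manifold R d).
Variable pi : M -> N.
Hypothesis hpi : smooth_map pi.

Local Notation dom p := (chart_dom (chart_at p)).
Local Notation inv p := (chart_inv (chart_at p)).

Lemma smooth_rep (y : N) : smooth_mfun (pi @^-1` dom y) (chart_at y \o pi).
Proof. by move=> p; rewrite setIC; have [_ ] := hpi; apply. Qed.

Lemma open_preimage_dom (y : N) : open (pi @^-1` dom y).
Proof.
have [cpi _] := hpi; apply: open_comp; last exact: chart_dom_open.
by move=> x _; exact: cpi.
Qed.

Lemma rep_differentiable (y : N) (p r : M) : dom p r -> dom y (pi r) ->
  differentiable ((chart_at y \o pi) \o inv p) (chart_at p r).
Proof. by move=> pr yr; exact: (smooth_mfun_differentiable (smooth_rep y)). Qed.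

Lemma map_diffE p : map_diff pi p = jac_at (chart_at (pi p) \o pi) p p.
Proof. by rewrite jac_at.unlock. Qed.

Lemma near_rep k (phi : N -> 'rV[R]_k) (y : N) (p r : M) : dom p r -> dom y (pi r) ->
  \forall x \near chart_at p r,
    ((phi \o inv y) \o ((chart_at y \o pi) \o inv p)) x = ((phi \o pi) \o inv p) x.
Proof.
move=> pr yr; apply: filterS (near_chart (open_preimage_dom y) yr pr) => x [h1 _ _] /=.
by rewrite chart_mapK.
Qed.

Lemma jac_at_pull k (phi : N -> 'rV[R]_k) (y : N) (p r : M) :
  dom p r -> dom y (pi r) -> differentiable (phi \o inv y) (chart_at y (pi r)) ->
  differentiable ((phi \o pi) \o inv p) (chart_at p r) /\
  jac_at (phi \o pi) p r = jac_at (chart_at y \o pi) p r *m jac_at phi y (pi r).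
Proof.
move=> pr yr dphi; have dr := rep_differentiable pr yr.
have dphi' : differentiable (phi \o inv y) (((chart_at y \o pi) \o inv p) (chart_at p r)).
  by rewrite /= (chart_mapK pr).
have e := near_rep phi pr yr; have dc := differentiable_comp dr dphi'.
split; first exact: near_eq_differentiable e dc.
rewrite jac_at.unlock -(near_eq_jacobian e dc) (jacobian_comp dr dphi').
by rewrite /= (chart_mapK pr).
Qed.

Lemma jac_rep_change (y y' : N) (p r : M) : dom p r -> dom y (pi r) -> dom y' (pi r) ->
  jac_at (chart_at y' \o pi) p r =
  jac_at (chart_at y \o pi) p r *m trans y y' (pi r).
Proof.
move=> pr yr y'r; have [|_ ->] // := @jac_at_pull _ (chart_at y') y p r pr yr.
exact: (smooth_mfun_differentiable (@smooth_chart _ _ _ y')).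
Qed.

Lemma jac_repE (y : N) (p r : M) : dom p r -> dom y (pi r) ->
  jac_at (chart_at y \o pi) p r = trans p r r *m map_diff pi r *m trans (pi r) y (pi r).
Proof.
move=> pr yr; have rr := chart_atP r; have nn := chart_atP (pi r).
rewrite (jac_rep_change pr nn yr) map_diffE.
by have [_ ->] := jac_at_comp pr rr (rep_differentiable rr nn).
Qed.

Lemma verticalP r (v : 'rV[R]_m) : (v <= vertical pi r)%MS <-> v *m map_diff pi r = 0.
Proof. by split=> [/sub_kermxP|?]; last exact/sub_kermxP. Qed.

Lemma vertical_chart (y : N) (p r : M) (v : 'rV[R]_m) : dom p r -> dom y (pi r) ->
  (v <= vertical pi r)%MS <-> v *m trans r p r *m jac_at (chart_at y \o pi) p r = 0.
Proof.
move=> pr yr; have rr := chart_atP r; have nn := chart_atP (pi r).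
rewrite verticalP (jac_repE pr yr) !mulmxA -[v *m _ *m _]mulmxA.
rewrite trans_inv// mulmx1; split=> [->|h]; first by rewrite mul0mx.
have := congr1 (mulmx^~ (trans y (pi r) (pi r))) h.
by rewrite -mulmxA trans_inv// mulmx1 mul0mx.
Qed.

Section SubmersionMetric.
Variables (g : M -> 'M[R]_m) (gN : N -> 'M[R]_d).
Hypotheses (hg : riemannian g) (hgN : riemannian gN).
Hypothesis hs : riemannian_submersion pi g gN.

(** The dual form of the submersion condition: [pi] pushes the inverse metric of [M] to that of
    [N]. *)
Lemma submersion_metric r :
  (map_diff pi r)^T *m invmx (g r) *m map_diff pi r = invmx (gN (pi r)).
Proof.
have [sg pg _] := hg; have [_ rk hor] := hs.
exact: submersion_matrix (sg r) (pg r) (rk r) (hor r).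
Qed.

Lemma submersion_metric_chart (y : N) (p r : M) : dom p r -> dom y (pi r) ->
  let J := jac_at (chart_at y \o pi) p r in
  J^T *m invmx (metric_in_chart g (chart_at p) (chart_at p r)) *m J =
  invmx (metric_in_chart gN (chart_at y) (chart_at y (pi r))).
Proof.
move=> pr yr /=; have rr := chart_atP r; have nn := chart_atP (pi r).
rewrite (jac_repE pr yr) (invmx_metric_chart hg pr) (invmx_metric_chart hgN yr).
rewrite -submersion_metric !trmx_mul !mulmxA.
have e : (trans p r r)^T *m (trans r p r)^T = 1%:M.
  by rewrite -trmx_mul trans_inv// trmx1.
rewrite -[_ *m (trans p r r)^T *m _]mulmxA e mulmx1.
by rewrite -[_ *m trans r p r *m _]mulmxA trans_inv// mulmx1.
Qed.

End SubmersionMetric.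

(** Replaces the horizontal projection, which depends on [g], by [map_diff], which does not; mean
    curvatures of different metrics become comparable. *)
Lemma mean_curvature_eq0 (g : M -> 'M[R]_m) n (E : 'I_n -> M -> 'rV[R]_m) p :
  riemannian g ->
  mean_curvature pi g E p = 0 <->
  \sum_a levi_civita g (E a) (E a) p *m map_diff pi p = 0.
Proof.
move=> [_ pg _].
rewrite /mean_curvature /second_fundamental_form /horizontal_proj.
rewrite -mulmx_suml -mulmx_suml.
exact: (@proj_horizontal_eq0 _ _ _ (map_diff pi p) (g p) _ (pg p)).
Qed.

End Submersions.

(** * Variation of the second fundamental form *)

Section LocalVariation.
Variables (R : realType) (m d : nat).
Variables (O : set 'rV[R]_m) (B : set 'rV[R]_d) (f : 'rV[R]_m -> 'rV[R]_d).
Variables (phi : 'rV[R]_d -> 'rV[R]_1) (Gam : 'rV[R]_d -> 'M[R]_d).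
Hypotheses (oO : open O) (oB : open B) (sf : smooth_on O f).
Hypothesis fOB : forall y, O y -> B (f y).
Hypotheses (sphi : smooth_on B phi) (sGam : smooth_on B Gam).

Lemma jacobian_comp_on y : O y -> 'J (phi \o f) y = 'J f y *m 'J phi (f y).
Proof.
move=> Oy; have [df _] := (smooth_onP _ _).1 sf.
have [dphi _] := (smooth_onP _ _).1 sphi.
by rewrite (jacobian_comp (df _ Oy) (dphi _ (fOB Oy))).
Qed.

Section OneMetric.
Variable G : 'rV[R]_m -> 'M[R]_m.
Hypotheses (sG : smooth_on O G) (Gs : forall y, O y -> (G y)^T = G y).
Hypothesis Gu : forall y, O y -> G y \in unitmx.
Hypothesis GGam : forall y, O y ->
  ('J f y)^T *m invmx (G y) *m 'J f y = Gam (f y).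

(** In this section [f] is [pi] in charts, [phi] a function on the base and [Gam] the inverse of the
    base metric. *)
Definition local_grad (y : 'rV[R]_m) : 'rV[R]_m :=
  ('J (phi \o f) y)^T *m invmx (G y).

Lemma local_grad_smooth : smooth_on O local_grad.
Proof.
move=> k; apply: diff_order_mulmx => //; last exact: diff_order_invmx.
apply: diff_order_trmx => //; apply: diff_order_jacobian => //.
exact: (diff_order_comp oO oB fOB).
Qed.

Lemma inner_local_grad y u : O y ->
  inner (G y) u (local_grad y) = (u *m 'J (phi \o f) y) 0 0.
Proof.
move=> Oy; rewrite /inner /local_grad trmx_mul trmxK trmx_inv Gs//.
by rewrite -mulmxA mulKVmx// Gu.
Qed.

(** The chain rule isolates [Jf^T G^-1 Jf], which the dual submersion condition turns into a
    function of [f y] alone. *)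
Lemma local_grad_projectable y : O y ->
  local_grad y *m 'J f y = ('J phi (f y))^T *m Gam (f y).
Proof.
move=> Oy; rewrite /local_grad jacobian_comp_on// trmx_mul -!mulmxA.
by congr (_ *m _); rewrite mulmxA; exact: GGam.
Qed.

Variable E : 'rV[R]_m -> 'rV[R]_m.
Hypotheses (sE : smooth_on O E) (EV : forall y, O y -> E y *m 'J f y = 0).

(** Differentiate [X Jf = psi o f] along [E], and [E Jf = 0] along the gradient [X]. Both
    derivatives vanish, and on subtracting them the second derivatives of [f] cancel by symmetry. *)
Lemma bracket_vertical x : O x ->
  ('D_(E x) local_grad x - 'D_(local_grad x) E x) *m 'J f x = 0.
Proof.
move=> Ox; have nO := open_nbhs_nbhs (conj oO Ox).
have [dE _] := (smooth_onP _ _).1 sE; have dEx := dE x Ox.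
have [dX _] := (smooth_onP _ _).1 local_grad_smooth; have dXx := dX x Ox.
have [df _] := (smooth_onP _ _).1 sf; have dfx := df x Ox.
have dJ : differentiable (jacobian f) x.
  by have [+ _] := diff_order_jacobian oO (sf 2%N); apply.
pose psi z := ('J phi z)^T *m Gam z.
have dpsi : differentiable psi (f x).
  have [+ _] : diff_order 1 B psi; last by apply; exact: fOB.
  apply: diff_order_mulmx => //; apply: diff_order_trmx => //.
  exact: diff_order_jacobian.
have h1 : 'D_(E x) (fun y => local_grad y *m 'J f y) x = 0.
  have e : \forall y \near x, local_grad y *m 'J f y = (psi \o f) y.
    by apply: filterS nO => y; exact: local_grad_projectable.
  apply: etrans (near_eq_derive (E x) e) _.
  by rewrite (derive_comp _ dfx dpsi) (deriveEjacobian _ dfx) EV// derive0.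
have h2 : 'D_(local_grad x) (fun y => E y *m 'J f y) x = 0.
  have e : \forall y \near x, E y *m 'J f y = 0.
    by apply: filterS nO => y; exact: EV.
  apply: etrans (near_eq_derive (local_grad x) e) _; exact: derive_cst.
rewrite (derive_mulmx _ dXx dJ) (jacobian_derivC _ _ oO sf Ox) in h1.
rewrite (derive_mulmx _ dEx dJ) in h2.
have key (a b c : 'rV[R]_d) : a + c = 0 -> b + c = 0 -> a - b = 0.
  by move=> e1 e2; apply/eqP; rewrite subr_eq0; apply/eqP/(addIr c); rewrite e1 e2.
rewrite mulmxBl; exact: key h1 h2.
Qed.

Lemma hessian_local_grad x : O x ->
  (cov_deriv G E E x *m 'J (phi \o f) x) 0 0 =
  - inner (half_lie G local_grad x) (E x) (E x).
Proof.
move=> Ox; have nO := open_nbhs_nbhs (conj oO Ox).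
have [dE _] := (smooth_onP _ _).1 sE.
have [dX _] := (smooth_onP _ _).1 local_grad_smooth.
have [dG _] := (smooth_onP _ _).1 sG.
rewrite -inner_local_grad//; apply: hessian_lie => //; last 1 first.
  apply: filterS nO => y Oy; rewrite inner_local_grad// jacobian_comp_on//.
  by rewrite mulmxA EV// mul0mx mxE.
- exact: dG.
- exact: Gu.
- exact: Gs.
- exact: dE.
- exact: dX.
Qed.

End OneMetric.

Lemma local_variation (G G0 : 'rV[R]_m -> 'M[R]_m) (E : 'rV[R]_m -> 'rV[R]_m) x :
  smooth_on O G -> smooth_on O G0 ->
  (forall y, O y -> (G y)^T = G y) -> (forall y, O y -> (G0 y)^T = G0 y) ->
  (forall y, O y -> G y \in unitmx) -> (forall y, O y -> G0 y \in unitmx) ->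
  (forall y, O y -> ('J f y)^T *m invmx (G y) *m 'J f y = Gam (f y)) ->
  (forall y, O y -> ('J f y)^T *m invmx (G0 y) *m 'J f y = Gam (f y)) ->
  (forall y u v, O y -> u *m 'J f y = 0 -> v *m 'J f y = 0 ->
     inner (G y) u v = inner (G0 y) u v) ->
  smooth_on O E -> (forall y, O y -> E y *m 'J f y = 0) -> O x ->
  (cov_deriv G E E x *m 'J (phi \o f) x) 0 0
  - (cov_deriv G0 E E x *m 'J (phi \o f) x) 0 0 =
  - inner (half_lie G0 (fun y => local_grad G y - local_grad G0 y) x) (E x) (E x).
Proof.
move=> sG sG0 Gs G0s Gu G0u GG G0G GG0 sE EV Ox.
have h1 := hessian_local_grad sG Gs Gu sE EV Ox.
have h2 := hessian_local_grad sG0 G0s G0u sE EV Ox.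
have [dE _] := (smooth_onP _ _).1 sE; have dEx := dE x Ox.
have [dX _] := (smooth_onP _ _).1 (local_grad_smooth sG Gu); have dXx := dX x Ox.
have [dX0 _] := (smooth_onP _ _).1 (local_grad_smooth sG0 G0u); have dX0x := dX0 x Ox.
have [dG _] := (smooth_onP _ _).1 sG; have dGx := dG x Ox.
have [dG0 _] := (smooth_onP _ _).1 sG0; have dG0x := dG0 x Ox.
have h3 := half_lieB (E x) (E x) dXx dX0x dG0x.
(* Passing from [G] to [G0] uses their agreement only on [E] and on the bracket, vertical by
   [bracket_vertical]. *)
have h4 : inner (half_lie G (local_grad G) x) (E x) (E x) =
    inner (half_lie G0 (local_grad G) x) (E x) (E x).
  apply: (lie_change dGx dG0x (Gs _ Ox) (G0s _ Ox) dEx dXx).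
    apply: filterS (open_nbhs_nbhs (conj oO Ox)) => y Oy.
    by apply: GG0 => //; exact: EV.
  have bv := bracket_vertical sG Gu GG sE EV Ox.
  exact: (GG0 _ _ _ Ox bv (EV _ Ox)).
have key (a b c e q r : R) : a = - c -> b = - e -> q = r - e -> c = r ->
  a - b = - q by move=> -> -> -> ->; ring.
exact: key h1 h2 h3 h4.
Qed.

End LocalVariation.

(** * Globally defined functions and local fields built from a chart *)

Section ManifoldBump.
Variables (R : realType) (m : nat) (M : manifold R m).
Local Notation dom p := (chart_dom (chart_at p)).
Local Notation inv p := (chart_inv (chart_at p)).

(** A bump in the chart at [q] is extended by zero. Smoothness at points off the chart domain holds
    because the support lies in the image [K] of a compact ball, which is closed as [M] is
    Hausdorff. *)
Lemma manifold_bump (q : M) (alpha : 'cV[R]_m) :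
  exists F : M -> 'rV[R]_1, smooth_mfun setT F /\ jac_at F q q = alpha.
Proof.
have qq := chart_atP q; pose a := chart_at q q.
have oC : open (chart_at q @` dom q) by exact: chart_cod_open.
have Ca : (chart_at q @` dom q) a by exists q.
have /nbhs_ballP[e /= e0 eC] := open_nbhs_nbhs (conj oC Ca).
pose r := e / 2; have r0 : 0 < r by rewrite divr_gt0.
have rC y : `|a - y| <= r -> (chart_at q @` dom q) y.
  by move=> ay; apply: eC; rewrite -ball_normE /=; apply: le_lt_trans ay _; rewrite /r; lra.
have [Phi [sPhi JPhi suppPhi]] := bump_function a alpha r0.
pose K := inv q @` closed_ball a r.
have clE : closed_ball a r = [set y | `|a - y| <= r] by rewrite closed_ballE.
have cK : closed K.
  apply: compact_closed; first exact: manifold_hausdorff.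
  apply: continuous_compact.
    apply: continuous_in_subspaceT => y /set_mem; rewrite clE => /= /rC Cy.
    exact: chart_inv_continuous.
  apply: bounded_closed_compact; last exact: closed_ball_closed.
  exists (`|a| + r); split; first by rewrite num_real.
  move=> b ab y; rewrite clE /= => ay; apply: le_trans (ltW ab).
  have := ler_distD a y 0; rewrite !subr0 [`|y - a|]distrC addrC => h.
  by apply: le_trans h _; rewrite lerD2l.
have Kq s : K s -> dom q s.
  by move=> [y]; rewrite clE => /= /rC [t qt <-] <-; rewrite chart_mapK.
pose F (s : M) : 'rV[R]_1 := if pselect (dom q s) then Phi (chart_at q s) else 0.
have F1 s : dom q s -> F s = Phi (chart_at q s) by rewrite /F; case: pselect.
have F0 s : ~ K s -> F s = 0.
  rewrite /F; case: pselect => // qs nK; apply/eqP; apply: contra_notT nK => /suppPhi.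
  by move=> h; exists (chart_at q s); [rewrite clE|rewrite chart_mapK].
exists F; split.
  move=> p k; apply: diff_order_pointwise => x [s [_ ps] sx].
  have [qs|nqs] := pselect (dom q s).
    pose A := chart_at p @` (dom q `&` dom p).
    have oA : open A by apply: open_chart_image; exact: chart_dom_open.
    apply: (@diff_order_subset _ _ _ _ A); first by move=> _ ->; exists s.
    apply: (@diff_order_eq _ _ _ _ _ (Phi \o (chart_at q \o inv p))) => //.
      by move=> z /set_mem /chart_imageP[h1 _ _] /=; rewrite F1.
    apply: (@diff_order_comp _ _ _ _ _ _ A setT) => //; first exact: openT.
    exact: smooth_chart.
  pose A := chart_at p @` (~` K `&` dom p).
  have oA : open A by apply: open_chart_image; exact: closed_openC.
  have nKs : (~` K) s by move=> /Kq.
  apply: (@diff_order_subset _ _ _ _ A); first by move=> _ ->; exists s.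
  apply: (@diff_order_eq _ _ _ _ _ (fun=> 0)) => //; last exact: diff_order_cst.
  by move=> z /set_mem /chart_imageP[h1 _ _] /=; rewrite F0.
have dPhi : differentiable Phi a by have [+ _] := sPhi 1%N; apply.
rewrite jac_at.unlock -JPhi; symmetry; apply: near_eq_jacobian dPhi.
apply: filterS (near_chart (chart_dom_open (chart_at q)) qq qq) => y [h1 _ h3] /=.
by rewrite F1// h3.
Qed.

Lemma smooth_field_from_chart p (U : set M) (E : 'rV[R]_m -> 'rV[R]_m) : open U ->
  U `<=` dom p -> smooth_on (chart_at p @` (U `&` dom p)) E ->
  smooth_field_on U (fun r => E (chart_at p r) *m trans p r r).
Proof.
move=> oU Up sE q k.
have oq := open_chart_image (p := q) oU.
have op := open_chart_image (p := p) oU.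
have sT : smooth_on (chart_at q @` (U `&` dom q)) (chart_at p \o inv q).
  move=> l; apply: diff_order_subset (@smooth_chart _ _ _ p q l).
  by move=> _ [s [Us qs] <-]; exists s => //; split=> //; exact: Up.
have sT' : smooth_on (chart_at p @` (U `&` dom q `&` dom p)) (chart_at q \o inv p).
  move=> l; apply: diff_order_subset (@smooth_chart _ _ _ q p l).
  by move=> _ [s [[Us qs] ps] <-]; exists s.
have oUq : open (chart_at p @` (U `&` dom q `&` dom p)).
  by apply: open_chart_image; apply: openI => //; exact: chart_dom_open.
apply: (@diff_order_eq _ _ _ _ _ (fun x => (E \o (chart_at p \o inv q)) x *m
   (jacobian (chart_at q \o inv p) \o (chart_at p \o inv q)) x)); [exact: oq| |].
  move=> x /set_mem [s [Us qs] <-]; have ps := Up _ Us; have ss := chart_atP s.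
  rewrite field_chartE// /= chart_mapK// -mulmxA -trans_comp//.
  by rewrite /trans jac_at.unlock.
apply: diff_order_mulmx => //.
  apply: (diff_order_comp oq op) => // x [s [Us qs] <-].
  by exists s; [split=> //; exact: Up|rewrite /= chart_mapK].
apply: (diff_order_comp oq oUq) => // [x [s [Us qs] <-]|].
  by exists s; [split=> //; exact: Up|rewrite /= chart_mapK].
exact: diff_order_jacobian.
Qed.

End ManifoldBump.

(** * Fibers *)

Section KernelAlgebra.
Variable R : realType.

Lemma kernel_basis n d (P : 'M[R]_(n + d, d)) : \rank P = d ->
  exists2 B : 'M[R]_(n, n + d), row_free B & B *m P = 0.
Proof.
move=> rP; have e : \rank (kermx P) = n by rewrite mxrank_ker rP addnK.
have : exists2 B : 'M[R]_(\rank (kermx P), n + d), row_free B & B *m P = 0.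
  exists (row_base (kermx P)); first exact: row_base_free.
  by apply/sub_kermxP; rewrite eq_row_base.
by rewrite e.
Qed.

Lemma sub_kernel_basis n d k (P : 'M[R]_(n + d, d)) (J : 'M[R]_(n, n + d))
    (E : 'M[R]_(k, n + d)) : \rank P = d -> row_free J -> J *m P = 0 ->
  E *m P = 0 -> (E <= J)%MS.
Proof.
move=> rP fJ JP EP.
have JK : (J <= kermx P)%MS by exact/sub_kermxP.
have EK : (E <= kermx P)%MS by exact/sub_kermxP.
apply: submx_trans EK _; rewrite -(mxrank_leqif_sup JK).
by rewrite mxrank_ker rP addnK (eqP fJ).
Qed.

(** [E] and [J] have values in the same kernel, so [E = Q J]; orthonormality reads [Q S Q^T = 1],
    whence [S^-1 = Q^T Q] for the Gram matrix [S] of [J]. *)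
Lemma trace_frame n d (P : 'M[R]_(n + d, d)) (J E : 'M[R]_(n, n + d))
    (G K : 'M[R]_(n + d)) : \rank P = d -> row_free J -> J *m P = 0 ->
  E *m P = 0 -> E *m G *m E^T = 1%:M ->
  \tr (J *m K *m J^T *m invmx (J *m G *m J^T)) =
  \sum_a inner K (row a E) (row a E).
Proof.
move=> rP fJ JP EP EE; have /submxP[Q EQ] := sub_kernel_basis rP fJ JP EP.
set S := J *m G *m J^T.
have QS : Q *m S *m Q^T = 1%:M by rewrite -EE EQ trmx_mul /S !mulmxA.
have QQ : S *m (Q^T *m Q) = 1%:M.
  have h : Q *m (S *m Q^T) = 1%:M by rewrite mulmxA.
  by rewrite mulmxA; exact: mulmx1C h.
have Su : S \in unitmx by have [] := mulmx1_unit QQ.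
have -> : invmx S = Q^T *m Q.
  by apply: (can_inj (mulKmx Su)); rewrite QQ mulmxV.
rewrite mulmxA mxtrace_mulC !mulmxA -EQ /mxtrace.
apply: eq_bigr => a _.
by rewrite rowE -inner_mulmx3 inner_basis2 EQ trmx_mul !mulmxA.
Qed.

Lemma normsq_eq0 m (v : 'rV[R]_m) : v *m v^T = 0 -> v = 0.
Proof.
move=> /matrixP/(_ 0 0); rewrite !mxE => /eqP; rewrite psumr_eq0 => [/allP h|i _].
  apply/rowP => i; have := h i (mem_index_enum i).
  by rewrite mxE mulf_eq0 orbb => /eqP ->; rewrite mxE.
by rewrite mxE -expr2 sqr_ge0.
Qed.

(** A vector killed by [B^T] and [P] lies in the row span of [B] and is orthogonal to it for the
    standard product. *)
Lemma complement_unit n d (P : 'M[R]_(n + d, d)) (B : 'M[R]_(n, n + d)) :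
  \rank P = d -> row_free B -> B *m P = 0 -> row_mx B^T P \in unitmx.
Proof.
move=> rP fB BP; rewrite -row_free_unit -kermx_eq0; apply/rowV0P => v.
move=> /sub_kermxP; rewrite mul_mx_row => vBP.
have [vB vP] : v *m B^T = 0 /\ v *m P = 0.
  by apply: eq_row_mx; rewrite vBP row_mx0.
have /submxP[w vw] := sub_kernel_basis rP fB BP vP.
by apply: normsq_eq0; rewrite {2}vw trmx_mul mulmxA vB mul0mx.
Qed.

Lemma gram_pos n m (A : 'M[R]_m) (W : 'M[R]_(n, m)) :
  (forall v, v != 0 -> 0 < inner A v v) -> row_free W ->
  forall v, v != 0 -> 0 < inner (W *m A *m W^T) v v.
Proof.
move=> pA fW v v0; rewrite inner_mulmx3; apply: pA; apply: contra_neq v0 => vW.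
by apply: (row_free_inj fW); rewrite vW mul0mx.
Qed.

Lemma gram_sym n m (A : 'M[R]_m) (W : 'M[R]_(n, m)) : A^T = A ->
  (W *m A *m W^T)^T = W *m A *m W^T.
Proof. by move=> As; rewrite !trmx_mul trmxK As mulmxA. Qed.

Lemma congr_cancel n m (D : 'M[R]_(n, m)) (T T' A : 'M[R]_m) : T' *m T = 1%:M ->
  D *m A *m D^T = D *m T' *m (T *m A *m T^T) *m (D *m T')^T.
Proof.
move=> TT; rewrite trmx_mul !mulmxA -[D *m _ *m T]mulmxA TT mulmx1.
by rewrite -[_ *m T^T *m _]mulmxA -trmx_mul TT trmx1 mulmx1.
Qed.

Lemma solve_gram n m k (X : 'M[R]_(k, n)) (J : 'M[R]_(n, m)) (A : 'M[R]_m) S :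
  S = J *m A *m J^T -> S \in unitmx -> X *m J *m A *m J^T *m invmx S = X.
Proof.
move=> SE Su; have -> : X *m J *m A *m J^T = X *m S by rewrite SE !mulmxA.
exact: mulmxK.
Qed.

End KernelAlgebra.

(** * Vertical frames, parametrizations of fibers and divergence along them *)

Section Fibers.
Variables (R : realType) (n d : nat).
Variables (M : manifold R (n + d)) (N : manifold R d) (pi : M -> N).
Hypothesis hpi : smooth_map pi.
Hypothesis rpi : forall p, \rank (map_diff pi p) = d.

Local Notation dom p := (chart_dom (chart_at p)).
Local Notation inv p := (chart_inv (chart_at p)).
Local Notation rep y p := ((chart_at y \o pi) \o inv p).

Lemma rank_jac_rep (y : N) (p r : M) : dom p r -> dom y (pi r) ->
  \rank (jac_at (chart_at y \o pi) p r) = d.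
Proof.
move=> pr yr; have rr := chart_atP r; have nn := chart_atP (pi r).
rewrite (jac_repE hpi pr yr) mxrankMfree ?row_free_unit ?trans_unit//.
by rewrite eqmxMfull ?row_full_unit ?trans_unit// rpi.
Qed.

Section Frame.
Variable g : M -> 'M[R]_(n + d).
Hypothesis hg : riemannian g.

(** Without a frame around each point [minimal_fibers] would carry no information. A basis of the
    vertical space at [p] is extended by constants in the chart, projected to the vertical spaces
    and orthonormalized. *)
Lemma vertical_frame_exists (p : M) :
  exists (U : set M) (E : 'I_n -> M -> 'rV[R]_(n + d)),
    [/\ open U, U p & vertical_frame pi g U E].
Proof.
have pp := chart_atP p; pose y := pi p; have yy : dom y (pi p) := chart_atP y.
pose U1 := pi @^-1` dom y; have oU1 : open U1 := open_preimage_dom hpi y.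
pose O1 := chart_at p @` (U1 `&` dom p).
have oO1 : open O1 by exact: open_chart_image.
pose x0 := chart_at p p; have O1x0 : O1 x0 by exists p.
pose G := metric_in_chart g (chart_at p).
pose P := jacobian (rep y p).
have sP : smooth_on O1 P.
  by move=> k; apply: diff_order_jacobian => //; exact: (smooth_rep hpi y).
have sG : smooth_on O1 G by exact: metric_chart_smooth.
have PE r : dom p r -> P (chart_at p r) = jac_at (chart_at y \o pi) p r.
  by move=> _; rewrite jac_at.unlock.
have rP x : O1 x -> \rank (P x) = d.
  by move=> [r [yr pr] <-]; rewrite PE//; exact: rank_jac_rep.
have Gp x v : O1 x -> v != 0 -> 0 < inner (G x) v v.
  by move=> [r [_ pr] <-]; exact: metric_chart_pos.
have Gs x : O1 x -> (G x)^T = G x.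
  by move=> [r [_ pr] <-]; exact: metric_chart_sym.
have Gu x : O1 x -> G x \in unitmx.
  by move=> [r [_ pr] <-]; exact: metric_chart_unit.
pose Q x := (P x)^T *m invmx (G x) *m P x.
have Qu x : O1 x -> Q x \in unitmx.
  move=> Ox; apply: posdef_unitmx => v v0.
  have -> : inner (Q x) v v = inner (invmx (G x)) (v *m (P x)^T) (v *m (P x)^T).
    by rewrite -inner_mulmx3 trmxK.
  apply: posdef_inv => [||]; [exact: Gs|by move=> w; exact: Gp|].
  by apply: contra_neq v0; exact: row_free_mul (rP x Ox).
have [B fB BP] := kernel_basis (rP x0 O1x0).
(* The subtracted term is the horizontal part of the constant rows [B]: the rows of [P^T G^-1] span
   the horizontal space and [Q] is their matrix of images under [P]. *)
pose W x := B - B *m P x *m invmx (Q x) *m (P x)^T *m invmx (G x).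
have sW : smooth_on O1 W.
  move=> k; apply: diff_orderD => //; first exact: diff_order_cst.
  apply: diff_order_opp => //; apply: diff_order_mulmx => //; last exact: diff_order_invmx.
  apply: diff_order_mulmx => //; last exact: diff_order_trmx.
  apply: diff_order_mulmx => //.
    by apply: diff_order_mulmx => //; exact: diff_order_cst.
  apply: diff_order_invmx => //; apply: diff_order_mulmx => //.
  by apply: diff_order_mulmx => //; [exact: diff_order_trmx|exact: diff_order_invmx].
have WP x : O1 x -> W x *m P x = 0.
  move=> Ox; rewrite mulmxBl -!mulmxA [_^T *m _]mulmxA -/(Q x).
  by rewrite mulVmx ?Qu// mulmx1 subrr.
have W0 : W x0 = B by rewrite /W BP !mul0mx subr0.
pose S x := W x *m G x *m (W x)^T.
have sS k : diff_order k O1 S.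
  apply: diff_order_mulmx => //; last exact: diff_order_trmx.
  exact: diff_order_mulmx.
(* At [x0], [W] is the free family [B], so its Gram determinant is nonzero there; orthonormalization
   takes place where it stays nonzero. *)
pose O2 := O1 `&` (fun x => \det (S x)) @^-1` [set~ 0].
have oO2 : open O2.
  apply: open_preimage_on => //; last first.
    exact/closed_openC/accessible_closed_set1/hausdorff_accessible/Rhausdorff.
  move=> x Ax; apply: (@smooth_on_continuous _ _ _ O1) => // k.
  exact: diff_order_det.
have O2x0 : O2 x0.
  split=> //=; apply/eqP; rewrite -unitfE -unitmxE; apply: posdef_unitmx.
  by rewrite /S W0; apply: gram_pos => // v; exact: Gp.
have [||x v [Ox /= dS] v0|L sL LS] := smooth_orthonormalization (S := S) oO2.
- by move=> k; apply: diff_order_subset (sS k) => x [].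
- by move=> x [Ox _]; exact: gram_sym (Gs _ Ox).
- have Su : S x \in unitmx by rewrite unitmxE unitfE; apply/eqP.
  rewrite /S inner_mulmx3; apply: Gp => //; apply: contra_neq v0 => vW.
  by apply: (can_inj (mulmxK Su)); rewrite /S !mulmxA vW !mul0mx.
pose U := U1 `&` dom p `&` chart_at p @^-1` O2.
have oU : open U.
  by rewrite /U -setIA; apply: openI => //; exact: open_chart_preimage.
have UO2 : chart_at p @` (U `&` dom p) `<=` O2 by move=> _ [r [[_ h] _] <-].
pose F x := L x *m W x.
pose E (a : 'I_n) r := row a (F (chart_at p r)) *m trans p r r.
exists U, E; split=> //; split.
- move=> a; apply: (smooth_field_from_chart (E := fun x => row a (F x))) => //.
    by move=> r [[]].
  move=> k; apply: (diff_order_subset UO2).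
  have sF : diff_order k O2 F.
    apply: diff_order_mulmx => //.
    by apply: diff_order_subset (sW k) => x [].
  by under eq_fun do rewrite rowE; apply: diff_order_mulmx => //; exact: diff_order_cst.
- move=> a r [[yr pr] [ O1r _]]; have rr := chart_atP r.
  apply/(vertical_chart hpi _ pr yr).
  rewrite /E -[_ *m trans p r r *m _]mulmxA trans_inv// mulmx1 -PE// -row_mul /F -mulmxA WP// mulmx0.
  exact: row0.
- move=> a b r [[yr pr] O2r]; have rr := chart_atP r.
  rewrite -inner_mulmx3 -metric_chartE// -/G !rowE -inner_mulmx3 inner_basis2.
  by have := LS _ O2r; rewrite /F /S trmx_mul !mulmxA => ->; rewrite mxE.
Qed.

End Frame.

(** Makes the divergence hypothesis, quantified over parametrizations, usable at every point. The
    parametrization is a slice of coordinates provided by the inverse function theorem. *)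
Lemma fiber_param_exists (p : M) :
  exists (A : set 'rV[R]_n) (s : 'rV[R]_n -> M) (u : 'rV[R]_n),
    [/\ fiber_param pi (pi p) A s, A u & s u = p].
Proof.
have pp := chart_atP p; pose y := pi p; have yy : dom y (pi p) := chart_atP y.
pose U1 := pi @^-1` dom y; have oU1 : open U1 := open_preimage_dom hpi y.
pose O1 := chart_at p @` (U1 `&` dom p).
have oO1 : open O1 by exact: open_chart_image.
pose x0 := chart_at p p; have O1x0 : O1 x0 by exists p.
pose f := rep y p; have sf : smooth_on O1 f by exact: (smooth_rep hpi y).
have [df _] := (smooth_onP _ _).1 sf.
have rP : \rank ('J f x0) = d.
  by have := rank_jac_rep pp yy; rewrite jac_at.unlock.
have [B0 fB BP] := kernel_basis rP.
pose L := B0^T; have Lu := complement_unit rP fB BP.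
(* The last [d] coordinates are [pi] in charts, so the fiber is the slice [z0]; the first [n] are
   linear functions that complete them to an invertible Jacobian at [x0]. *)
pose Phi (z : 'rV[R]_(n + d)) : 'rV[R]_(n + d) := z *m row_mx L 0 + f z *m row_mx 0 1%:M.
have PhiE z : Phi z = row_mx (z *m L) (f z).
  by rewrite /Phi !mul_mx_row !mulmx0 mulmx1 add_row_mx addr0 add0r.
have sPhi : smooth_on O1 Phi.
  move=> k; apply: diff_orderD => //; apply: diff_order_mulmx => //.
  - exact: diff_order_id.
  - exact: diff_order_cst.
  - exact: diff_order_cst.
have JPhi : 'J Phi x0 \in unitmx.
  have dfx := df _ O1x0; have di : differentiable (fun z : 'rV[R]_(n + d) => z) x0 by [].
  have d1 : differentiable (fun z : 'rV[R]_(n + d) => z *m row_mx L (0 : 'M[R]_(n + d, d))) x0.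
    exact: differentiable_mulmxr.
  have d2 : differentiable (fun z => f z *m row_mx (0 : 'M[R]_(d, n)) 1%:M) x0.
    exact: differentiable_mulmxr.
  have -> // : 'J Phi x0 = row_mx L ('J f x0).
  apply: jacobian_eq; first exact: differentiableD.
  move=> v; apply: etrans (deriveD (diff_derivable d1) (diff_derivable d2)) _.
  rewrite (derive_mulmxr _ _ di) (derive_mulmxr _ _ dfx) derive_id.
  rewrite (deriveEjacobian _ dfx).
  by rewrite !mul_mx_row !mulmx0 mulmx1 add_row_mx addr0 add0r.
have [ O [B [Psi [[oO Ox0 OO1 oB] [hO hB _ sPsi]]]]] := inverse_function oO1 sPhi O1x0 JPhi.
pose z0 := f x0.
pose io (u : 'rV[R]_n) : 'rV[R]_(n + d) := row_mx u z0.
have oT := @openT 'rV[R]_n.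
have sio : smooth_on setT io.
  move=> k; apply: diff_order_row_mx => //; first exact: diff_order_id.
  exact: diff_order_cst.
have cio : continuous io by move=> u; exact: smooth_on_continuous sio I.
pose A := io @^-1` B.
have oA : open A by apply: open_comp => // u _; exact: cio.
pose w u := Psi (io u).
have sw : smooth_on A w.
  move=> k; apply: (diff_order_comp oA oB (f := io) (g := Psi)) => //.
  by apply: diff_order_subset (sio k).
pose s u := inv p (w u).
have wP u : A u -> [/\ O (w u), w u *m L = u & f (w u) = z0].
  move=> Au; have [Ow] := hB _ Au; rewrite PhiE => /eq_row_mx[e1 e2].
  by split.
have sP u : A u -> [/\ dom y (pi (s u)), dom p (s u) & chart_at p (s u) = w u].
  by move=> /wP[/OO1 /chart_imageP[h1 h2 h3] _ _].
have pis u : A u -> pi (s u) = pi p.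
  move=> Au; have [h1 h2 h3] := sP u Au; have [_ _] := wP u Au.
  rewrite /z0 /f /= -/(s u) /x0 chart_mapK// => e.
  by rewrite -[LHS](chart_mapK h1) e chart_mapK.
have cw u : A u -> {for u, continuous w} by move=> Au; exact: smooth_on_continuous sw Au.
have cs u : A u -> {for u, continuous s}.
  move=> Au; have [h1 h2 h3] := sP u Au.
  apply: continuous_comp; first exact: cw.
  by apply: chart_inv_continuous; exists (s u).
have oAq q : open (A `&` s @^-1` dom q).
  by apply: open_preimage_on => //; exact: chart_dom_open.
have ssq q : smooth_on (A `&` s @^-1` dom q) (chart_at q \o s).
  move=> k.
  have oq : open (chart_at p @` (dom q `&` dom p)).
    by apply: open_chart_image; exact: chart_dom_open.
  apply: (diff_order_comp (oAq q) oq (f := w) (g := chart_at q \o inv p)).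
  - move=> u [Au qu]; have [h1 h2 h3] := sP u Au.
    by exists (s u).
  - by apply: diff_order_subset (sw k) => u [].
  - exact: smooth_chart.
exists A, s, (x0 *m L); split.
- split=> //.
  + by move=> u Au; split; [exact: cs|exact: pis].
  + move=> u Au; have [h1 h2 h3] := sP u Au.
    have [dw _] := (smooth_onP _ _).1 sw; have dwu := dw u Au.
    have dt : differentiable (chart_at (s u) \o inv p) (w u).
      rewrite -h3; apply: (smooth_mfun_differentiable (@smooth_chart _ _ _ (s u))) => //.
      exact: chart_atP.
    have -> : param_diff s u = 'J w u *m trans p (s u) (s u).
      rewrite /param_diff /trans jac_at.unlock h3.
      exact: (jacobian_comp dwu dt).
    rewrite mxrankMfree; last first.
      by rewrite row_free_unit trans_unit//; exact: chart_atP.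
    (* [w u *m L = u] forces rank [n]; the same identity gives injectivity and the open sets
       below. *)
    have e : 'J w u *m L = 1%:M.
      rewrite -(jacobian_mulmxr L dwu) -(jacobian_id u).
      apply: near_eq_jacobian (differentiable_mulmxr L dwu).
      by apply: filterS (open_nbhs_nbhs (conj oA Au)) => v /wP[].
    by apply/eqP; rewrite eqn_leq rank_leq_row /= -{1}(mxrank1 R n) -e mxrankM_maxl.
  + split=> [u v /set_mem Au /set_mem Av suv|B' oB' B'A].
      have [_ <- _] := wP u Au; have [_ <- _] := wP v Av.
      have [_ _ <-] := sP u Au; have [_ _ <-] := sP v Av.
      by rewrite suv.
    pose O' := O `&` (fun z => z *m L) @^-1` B'.
    have oO' : open O'.
      apply: openI => //; apply: open_comp => // z _; exact: continuous_mulmxr.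
    exists (dom p `&` chart_at p @^-1` O'); first exact: open_chart_preimage.
    apply/seteqP; split=> q.
      move=> [u B'u <-]; have Au := B'A _ B'u; have [h1 h2 h3] := sP u Au.
      have [k1 k2 k3] := wP u Au.
      by split; [split=> //=; rewrite h3; split=> //=; rewrite k2|exact: pis].
    move=> [[pq [Oq /= B'q]] /= piq]; exists (chart_at p q *m L) => //.
    have [_ e] := hO _ Oq; rewrite /s /w.
    have -> : io (chart_at p q *m L) = Phi (chart_at p q).
      by rewrite PhiE /io /z0 /f /x0 /= !chart_mapK// piq.
    by rewrite e chart_mapK.
- by rewrite /A /=; have [h _] := hO _ Ox0; move: h; rewrite PhiE.
- have [_ e] := hO _ Ox0; rewrite /s /w.
  have -> : io (x0 *m L) = Phi x0 by rewrite PhiE.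
  by rewrite e chart_mapK.
Qed.

Section FiberDivergence.
Variables (x : N) (A : set 'rV[R]_n) (s : 'rV[R]_n -> M).
Hypothesis hs : fiber_param pi x A s.

Lemma fiber_chart (p : M) u : A u -> dom p (s u) ->
  differentiable (chart_at p \o s) u /\
  'J (chart_at p \o s) u = param_diff s u *m trans (s u) p (s u).
Proof.
have [oA hA sA rA _] := hs; move=> Au pu; set r := s u in pu *.
have rr : dom r r := chart_atP r.
have d1 : differentiable (chart_at r \o s) u.
  by have [+ _] := sA r 1%N; apply; split.
have d2 : differentiable (chart_at p \o inv r) ((chart_at r \o s) u).
  exact: (smooth_mfun_differentiable (@smooth_chart _ _ _ p)).
have oAr : open (A `&` s @^-1` dom r).
  apply: open_preimage_on => //; last exact: chart_dom_open.
  by move=> v /hA[].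
have nA : \forall v \near u, A v /\ dom r (s v).
  by apply: filterS (open_nbhs_nbhs (conj oAr _)).
have e : \forall v \near u, ((chart_at p \o inv r) \o (chart_at r \o s)) v = (chart_at p \o s) v.
  by apply: filterS nA => v [_ h] /=; rewrite chart_mapK.
have dc := differentiable_comp d1 d2.
split; first exact: near_eq_differentiable e dc.
by rewrite -(near_eq_jacobian e dc) (jacobian_comp d1 d2) /param_diff /trans jac_at.unlock.
Qed.

(** [pi \o s] is constant, so its differential vanishes. *)
Lemma param_diff_vertical u : A u -> param_diff s u *m map_diff pi (s u) = 0.
Proof.
have [oA hA sA rA _] := hs; move=> Au; set r := s u.
have rr : dom r r := chart_atP r; have nn := chart_atP (pi r).
have [d1 _] := fiber_chart Au rr.
have d2 : differentiable (rep (pi r) r) ((chart_at r \o s) u).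
  exact: (rep_differentiable hpi rr nn).
have oAr : open (A `&` s @^-1` dom r).
  apply: open_preimage_on => //; last exact: chart_dom_open.
  by move=> v /hA[].
have nA : \forall v \near u, A v /\ dom r (s v).
  by apply: filterS (open_nbhs_nbhs (conj oAr _)).
have e : \forall v \near u, (rep (pi r) r \o (chart_at r \o s)) v = chart_at (pi r) (pi r).
  apply: filterS nA => v [Av h] /=; rewrite chart_mapK//.
  by have [_ ->] := hA v Av; have [_ ->] := hA u Au.
have dc := differentiable_comp d1 d2.
have <- : 'J (rep (pi r) r \o (chart_at r \o s)) u = param_diff s u *m map_diff pi r.
  by rewrite (jacobian_comp d1 d2) map_diffE jac_at.unlock.
rewrite (near_eq_jacobian e dc); apply: jacobian_eq; first exact: differentiable_cst.
by move=> v; rewrite mulmx0; exact: derive_cst.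
Qed.

Variable g : M -> 'M[R]_(n + d).
Hypothesis hg : riemannian g.
Variables (xi : M -> 'rV[R]_(n + d)) (X : 'rV[R]_n -> 'rV[R]_n).
Hypothesis sxi : smooth_field_on setT xi.
Hypothesis hX : forall u, A u -> X u *m param_diff s u = xi (s u).

(** [divergence_pullback] gives a trace in the parametrization and [trace_frame] rewrites it over an
    orthonormal vertical basis, in which [s] no longer appears. *)
Lemma fiber_divergence (E : 'I_n -> 'rV[R]_(n + d)) u : A u -> let p := s u in
  (forall a, E a *m map_diff pi p = 0) ->
  (forall a b, inner (g p) (E a) (E b) = (a == b)%:R) ->
  divergence (pullback g s) X u =
  \sum_a inner (half_lie (metric_in_chart g (chart_at p))
    (field_in_chart xi (chart_at p)) (chart_at p p)) (E a) (E a).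
Proof.
have [oA hA sA rA _] := hs; move=> Au p Ev EE.
have pp : dom p p := chart_atP p.
pose A' := A `&` s @^-1` dom p.
have oA' : open A'.
  apply: open_preimage_on => //; last exact: chart_dom_open.
  by move=> v /hA[].
have A'u : A' u by [].
pose sg := chart_at p \o s; have ssg : smooth_on A' sg by exact: sA.
pose G := metric_in_chart g (chart_at p).
pose xh := field_in_chart xi (chart_at p).
have JE v : A' v -> 'J sg v = param_diff s v *m trans (s v) p (s v).
  by move=> [Av pv]; have [_] := fiber_chart Av pv.
have fJ v : A' v -> row_free ('J sg v).
  move=> A'v; have [Av pv] := A'v; rewrite /row_free JE// mxrankMfree ?rA//.
  by rewrite row_free_unit trans_unit//; exact: chart_atP.
have PE v : A' v -> pullback g s v = 'J sg v *m G (sg v) *m ('J sg v)^T.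
  move=> A'v; have [Av pv] := A'v; rewrite JE// /sg /G metric_chartE//.
  have vv := chart_atP (s v).
  exact: congr_cancel (trans_inv vv pv).
have Gs v : A' v -> (G (sg v))^T = G (sg v).
  by move=> [Av pv]; exact: metric_chart_sym.
have Pu v : A' v -> pullback g s v \in unitmx.
  move=> A'v; rewrite PE//; apply: posdef_unitmx; apply: gram_pos; last exact: fJ.
  by move=> w; have [_ pv] := A'v; exact: metric_chart_pos.
have Xxi v : A' v -> X v *m 'J sg v = xh (sg v).
  move=> A'v; have [Av pv] := A'v; rewrite JE// mulmxA hX// /xh /sg /=.
  by rewrite field_chartE.
pose C := chart_at p @` (setT `&` dom p).
have oC : open C by apply: open_chart_image; exact: openT.
have AC v : A' v -> C (sg v) by move=> [_ pv]; exists (s v).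
have sG : smooth_on C G by exact: metric_chart_smooth.
have sxh : smooth_on C xh by exact: sxi.
have sJ k : diff_order k A' (jacobian sg) by exact: diff_order_jacobian.
have sGs k : diff_order k A' (G \o sg) by exact: (diff_order_comp oA' oC AC).
have sP k : diff_order k A' (pullback g s).
  apply: (@diff_order_eq _ _ _ _ _ (fun v => 'J sg v *m (G \o sg) v *m ('J sg v)^T)).
  - exact: oA'.
  - by move=> v /set_mem A'v; exact: esym (PE v A'v).
  - by apply: diff_order_mulmx => //; [exact: diff_order_mulmx|exact: diff_order_trmx].
(* [X] comes without any regularity: it is recovered from [X J = xi] by multiplying with [G J^T] and
   inverting the Gram matrix. *)
have dX : differentiable X u.
  have [+ _] : diff_order 1 A' X; last by apply.
  apply: (@diff_order_eq _ _ _ _ _ (fun v => (xh \o sg) v *m (G \o sg) v *m ('J sg v)^T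
     *m invmx (pullback g s v))).
  - exact: oA'.
  - move=> v /set_mem A'v; rewrite /= -(Xxi _ A'v).
    exact: solve_gram (PE _ A'v) (Pu _ A'v).
  - apply: diff_order_mulmx => //; last exact: diff_order_invmx.
    apply: diff_order_mulmx => //; last exact: diff_order_trmx.
    by apply: diff_order_mulmx => //; exact: (diff_order_comp oA' oC AC).
have [dG _] := (smooth_onP _ _).1 sG; have [dxh _] := (smooth_onP _ _).1 sxh.
have Ju := JE u A'u; rewrite trans_id// mulmx1 in Ju.
have -> := divergence_pullback oA' ssg A'u (dG _ (AC _ A'u)) Gs PE (Pu _ A'u) dX
  (dxh _ (AC _ A'u)) Xxi.
rewrite (PE _ A'u).
pose Em := \matrix_a E a.
have EmE a : row a Em = E a by rewrite rowK.
have JP : 'J sg u *m map_diff pi p = 0 by rewrite Ju; exact: param_diff_vertical.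
have EmP : Em *m map_diff pi p = 0.
  by apply/row_matrixP => a; rewrite row_mul EmE row0.
have EGE : Em *m G (sg u) *m Em^T = 1%:M.
  apply/matrixP => a b; rewrite -inner_basis2 inner_mulmx3 -!rowE !EmE.
  by rewrite /G /sg /= metric_chart_center EE mxE.
rewrite (trace_frame _ (rpi p) (fJ _ A'u) JP EmP EGE).
by apply: eq_bigr => a _; rewrite EmE.
Qed.

End FiberDivergence.

End Fibers.

(** * The variation identity on the manifold *)

Section VariationIdentity.
Variables (R : realType) (m d : nat) (M : manifold R m) (N : manifold R d).
Variable pi : M -> N.
Variables (g g0 : M -> 'M[R]_m) (gN : N -> 'M[R]_d).
Hypotheses (hg : riemannian g) (hg0 : riemannian g0) (hgN : riemannian gN).
Hypothesis hs : riemannian_submersion pi g gN.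
Hypothesis hs0 : riemannian_submersion pi g0 gN.
Hypothesis hV : forall r (u v : 'rV[R]_m), (u <= vertical pi r)%MS ->
  (v <= vertical pi r)%MS -> inner (g r) u v = inner (g0 r) u v.

Local Notation dom p := (chart_dom (chart_at p)).
Local Notation inv p := (chart_inv (chart_at p)).

Let hpi : smooth_map pi. Proof. by case: hs. Qed.

Lemma smooth_mfun_pull k (V : set N) (phi : N -> 'rV[R]_k) : open V ->
  smooth_mfun V phi -> smooth_mfun (pi @^-1` V) (phi \o pi).
Proof.
move=> oV sphi p k'; apply: diff_order_pointwise => x [r [Vr pr] rx].
have yy := chart_atP (pi r); set y := pi r in yy.
pose V' := V `&` dom y.
have oV' : open (pi @^-1` V').
  have [cpi _] := hpi; apply: open_comp; first by move=> ? _; exact: cpi.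
  by apply: openI => //; exact: chart_dom_open.
pose A := chart_at p @` (pi @^-1` V' `&` dom p).
have oA : open A by exact: open_chart_image.
have oB : open (chart_at y @` (V `&` dom y)) by exact: open_chart_image.
apply: (@diff_order_subset _ _ _ _ A); first by move=> _ ->; exists r.
apply: (@diff_order_eq _ _ _ _ _ ((phi \o inv y) \o ((chart_at y \o pi) \o inv p))) => //.
  by move=> z /set_mem /chart_imageP[[h1 h1'] _ _] /=; rewrite chart_mapK.
apply: (diff_order_comp oA oB).
- by move=> z /chart_imageP[[h1 h1'] _ _]; exists (pi (inv p z)).
- apply: diff_order_subset (smooth_rep hpi y p k').
  by move=> _ [q [[_ h] pq] <-]; exists q.
- exact: sphi.
Qed.

(** The field [X_t - X_0], for [g = g_t] and [h = f o pi]. *)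
Definition grad_diff (h : M -> 'rV[R]_1) r : 'rV[R]_m := grad g h r - grad g0 h r.

Lemma jac_at_base k (V : set N) (phi : N -> 'rV[R]_k) r : smooth_mfun V phi ->
  V (pi r) -> jac_at (phi \o pi) r r = map_diff pi r *m jac_at phi (pi r) (pi r).
Proof.
move=> sphi Vr; have rr := chart_atP r; have yy := chart_atP (pi r).
rewrite map_diffE; have [] // := jac_at_pull hpi rr yy (phi := phi).
exact: (smooth_mfun_differentiable sphi).
Qed.

(** [phi] is required to be smooth only on an open [V], so that both global bumps and coordinate
    functions of [N] can be used. *)
Lemma variation_identity (V : set N) (phi : N -> 'rV[R]_1) (U : set M)
    (E : M -> 'rV[R]_m) p : open V -> smooth_mfun V phi -> V (pi p) ->
  open U -> U p -> smooth_field_on U E ->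
  (forall r, U r -> (E r <= vertical pi r)%MS) ->
  (levi_civita g E E p *m jac_at (phi \o pi) p p) 0 0
  - (levi_civita g0 E E p *m jac_at (phi \o pi) p p) 0 0 =
  - inner (half_lie (metric_in_chart g0 (chart_at p))
      (field_in_chart (grad_diff (phi \o pi)) (chart_at p)) (chart_at p p)) (E p) (E p).
Proof.
move=> oV sphi Vp oU Up sE EV.
have pp := chart_atP p; have yy := chart_atP (pi p); set y := pi p in yy.
pose V' := V `&` dom y.
have oV' : open (pi @^-1` V').
  have [cpi _] := hpi; apply: open_comp; first by move=> ? _; exact: cpi.
  by apply: openI => //; exact: chart_dom_open.
pose W := U `&` pi @^-1` V'.
pose O := chart_at p @` (W `&` dom p).
have oO : open O by apply: open_chart_image; exact: openI.
pose B := chart_at y @` (V `&` dom y).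
have oB : open B by exact: open_chart_image.
pose f := (chart_at y \o pi) \o inv p.
pose x0 := chart_at p p.
have Ox0 : O x0 by exists p.
have sf : smooth_on O f.
  move=> k; apply: diff_order_subset (smooth_rep hpi y p k).
  by move=> _ [q [[_ [_ h]] pq] <-]; exists q.
have fOB x : O x -> B (f x).
  by move=> /chart_imageP[[_ [h1 h1']] _ _]; exists (pi (inv p x)).
have JfE r : 'J f (chart_at p r) = jac_at (chart_at y \o pi) p r by rewrite jac_at.unlock.
pose Gam z := invmx (metric_in_chart gN (chart_at y) z).
have sGam : smooth_on B Gam.
  move=> k; apply: diff_order_invmx => //; last exact: metric_chart_smooth.
  by move=> _ [q [_ yq] <-]; exact: metric_chart_unit.
have sub (G : M -> 'M[R]_m) : riemannian G -> riemannian_submersion pi G gN ->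
    forall x, O x -> ('J f x)^T *m invmx (metric_in_chart G (chart_at p) x) *m 'J f x = Gam (f x).
  move=> hG hsG _ [r [[_ [_ h]] pr] <-]; rewrite JfE.
  by rewrite (submersion_metric_chart hpi hG hgN hsG pr h) /Gam /f /= chart_mapK.
have sG (G : M -> 'M[R]_m) : riemannian G -> smooth_on O (metric_in_chart G (chart_at p)).
  by move=> hG; exact: metric_chart_smooth.
have symG (G : M -> 'M[R]_m) : riemannian G -> forall x, O x ->
    (metric_in_chart G (chart_at p) x)^T = metric_in_chart G (chart_at p) x.
  by move=> hG _ [r [_ pr] <-]; exact: metric_chart_sym.
have uG (G : M -> 'M[R]_m) : riemannian G -> forall x, O x ->
    metric_in_chart G (chart_at p) x \in unitmx.
  by move=> hG _ [r [_ pr] <-]; exact: metric_chart_unit.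
have GG0 x u v : O x -> u *m 'J f x = 0 -> v *m 'J f x = 0 ->
    inner (metric_in_chart g (chart_at p) x) u v = inner (metric_in_chart g0 (chart_at p) x) u v.
  move=> [r [[_ [_ yr]] pr] <-]; rewrite JfE => uJ vJ; have rr := chart_atP r.
  rewrite !metric_chartE// !inner_mulmx3; apply: hV; apply/(vertical_chart hpi _ pr yr);
    by rewrite -[_ *m trans p r r *m _]mulmxA trans_inv// mulmx1.
pose Eh := field_in_chart E (chart_at p).
have sEh : smooth_on O Eh.
  move=> k; apply: diff_order_subset (sE p k).
  by move=> _ [q [[h _] pq] <-]; exists q.
have EhV x : O x -> Eh x *m 'J f x = 0.
  move=> [r [[Ur [_ yr]] pr] <-]; rewrite JfE /Eh field_chartE//.
  by apply/(vertical_chart hpi _ pr yr); exact: EV.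
have sphi' : smooth_on B (phi \o inv y) by exact: sphi.
have := local_variation oO oB sf fOB sphi' sGam (sG _ hg) (sG _ hg0) (symG _ hg)
  (symG _ hg0) (uG _ hg) (uG _ hg0) (sub _ hg hs) (sub _ hg0 hs0) GG0 sEh EhV Ox0.
have Jphi r : W r -> dom p r -> 'J ((phi \o inv y) \o f) (chart_at p r) = jac_at (phi \o pi) p r.
  move=> [_ [Vr yr]] pr; have e := near_rep hpi phi pr yr.
  rewrite jac_at.unlock; apply: (near_eq_jacobian e).
  apply: differentiable_comp; first by rewrite /f; exact: rep_differentiable.
  rewrite /= (chart_mapK pr); exact: (smooth_mfun_differentiable sphi).
have Wp : W p by [].
rewrite (Jphi p Wp pp) {1}/Eh => ->.
have -> : Eh x0 = E p by exact: field_chart_center.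
have lg (G : M -> 'M[R]_m) : riemannian G ->
    differentiable (local_grad f (phi \o inv y) (metric_in_chart G (chart_at p))) x0.
  move=> hG; have [+ _] := local_grad_smooth oO oB sf fOB sphi' (sG _ hG) (uG _ hG) 1%N.
  by apply.
have e : \forall z \near x0, local_grad f (phi \o inv y) (metric_in_chart g (chart_at p)) z
    - local_grad f (phi \o inv y) (metric_in_chart g0 (chart_at p)) z
    = field_in_chart (grad_diff (phi \o pi)) (chart_at p) z.
  apply: filterS (open_nbhs_nbhs (conj oO Ox0)) => _ [r [Wr pr] <-].
  have rr := chart_atP r; have [_ [Vr yr]] := Wr.
  have dh : differentiable ((phi \o pi) \o inv r) (chart_at r r).
    by have [] := jac_at_pull hpi rr (chart_atP (pi r)) (smooth_mfun_differentiable sphi Vr (chart_atP (pi r))).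
  rewrite [RHS]field_chartE// /grad_diff mulmxBl -!field_chartE//.
  by rewrite !grad_chartE// /local_grad Jphi.
have h := near_eq_half_lie (metric_in_chart g0 (chart_at p)) e
  (differentiableB (lg _ hg) (lg _ hg0)).
exact: (congr1 (fun H => - inner H (E p) (E p)) h).
Qed.

End VariationIdentity.

(** * From a variation to a vertical field *)

Section VariationField.
Variable R : realType.

(** [Z] projects onto the kernel of [P] along the rows of [Y]. As [A - B] annihilates those rows, it
    equals its compression by [Z], which only sees values on the kernel. *)
Lemma metric_determined m d (P : 'M[R]_(m, d)) (A B : 'M[R]_m) :
  A^T = A -> B^T = B -> A \in unitmx -> B \in unitmx ->
  P^T *m invmx A *m P \in unitmx ->
  (forall u v : 'rV[R]_m, u *m P = 0 -> v *m P = 0 -> inner A u v = inner B u v) ->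
  P^T *m invmx A = P^T *m invmx B -> A = B.
Proof.
move=> As Bs Au Bu Qu AB YE; set Y := P^T *m invmx A in Qu YE.
set Q := Y *m P in Qu.
pose C := A - B; pose Z := 1%:M - P *m invmx Q *m Y.
have YC : Y *m C = 0.
  by rewrite /C mulmxBr {1}/Y mulmxKV// YE mulmxKV// subrr.
have CY : C *m Y^T = 0.
  by have := congr1 trmx YC; rewrite trmx_mul trmx0 /C linearB /= As Bs.
have ZP : Z *m P = 0.
  by rewrite /Z mulmxBl mul1mx -[_ *m Y *m P]mulmxA -/Q mulmxKV// subrr.
have ZC : Z *m C *m Z^T = C.
  rewrite /Z mulmxBl mul1mx -[_ *m Y *m C]mulmxA YC mulmx0 subr0.
  by rewrite linearB /= trmx1 mulmxBr mulmx1 trmx_mul mulmxA CY mul0mx subr0.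
have ZZ : Z *m A *m Z^T = Z *m B *m Z^T.
  apply/matrixP => i j; rewrite -!inner_basis2 !inner_mulmx3.
  by apply: AB; rewrite -mulmxA ZP mulmx0.
by apply/eqP; rewrite -subr_eq0 -/C -ZC /C mulmxBr mulmxBl ZZ subrr.
Qed.

Lemma smooth_fieldB m (M : manifold R m) (V : set M) (X Y : M -> 'rV[R]_m) :
  open V -> smooth_field_on V X -> smooth_field_on V Y ->
  smooth_field_on V (fun r => X r - Y r).
Proof.
move=> oV sX sY p k; have oO := open_chart_image (p := p) oV.
apply: (@diff_order_eq _ _ _ _ _
  (fun x => field_in_chart X (chart_at p) x + - field_in_chart Y (chart_at p) x)).
- exact: oO.
- by move=> x _; rewrite /field_in_chart mulmxBl.
- apply: diff_orderD; [exact: oO|exact: sX|].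
  exact: (diff_order_opp oO (sY p k)).
Qed.

Lemma smooth_grad m (M : manifold R m) (g : M -> 'M[R]_m) (V : set M)
    (h : M -> 'rV[R]_1) : riemannian g -> open V -> smooth_mfun V h ->
  smooth_field_on V (grad g h).
Proof.
move=> hg oV sh p k; have oO := open_chart_image (p := p) oV.
apply: (@diff_order_eq _ _ _ _ _ (fun x => ('J (h \o chart_inv (chart_at p)) x)^T *m
   invmx (metric_in_chart g (chart_at p) x))); first exact: oO.
  move=> _ /set_mem[r [Vr pr] <-]; have rr := chart_atP r.
  rewrite [RHS]grad_chartE// ?jac_at.unlock//.
  exact: (smooth_mfun_differentiable sh).
apply: diff_order_mulmx => //.
  by apply: diff_order_trmx => //; apply: diff_order_jacobian => //; exact: sh.
apply: diff_order_invmx => //; last exact: metric_chart_smooth.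
by move=> _ [r [_ pr] <-]; exact: metric_chart_unit.
Qed.

Variables (n d : nat) (M : manifold R (n + d)) (N : manifold R d).
Variable pi : M -> N.
Variables (g g0 : M -> 'M[R]_(n + d)) (gN : N -> 'M[R]_d).
Hypotheses (hg : Riem pi g0 g) (hg0 : riemannian g0) (hgN : riemannian gN).
Hypotheses (hs : riemannian_submersion pi g gN) (hmin : minimal_fibers pi n g).
Hypotheses (hs0 : riemannian_submersion pi g0 gN) (hmin0 : minimal_fibers pi n g0).

Lemma variation_field : g <> g0 -> exists xi : M -> 'rV[R]_(n + d),
  [/\ vertical_field pi xi, nontrivial_field xi
    & forall x : N, div_free_on_fiber pi n g0 xi x].
Proof.
have [rg hV] := hg; have [hpi rpi _] := hs => gg0.
have [q gq] : exists q, g q <> g0 q.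
  by apply/existsNP => h; apply: gg0; apply/funext.
have [sg _ _] := rg; have [sg0 _ _] := hg0.
pose P p := map_diff pi p.
have [k rk] : exists k, row k ((P q)^T *m invmx (g q)) <> row k ((P q)^T *m invmx (g0 q)).
  apply/existsNP => h; apply: gq; apply: (metric_determined (P := P q) (sg q) (sg0 q)
    (riemannian_unit rg q) (riemannian_unit hg0 q)).
  - by rewrite (submersion_metric rg hs) unitmx_inv riemannian_unit.
  - by move=> u v uP vP; apply: hV; apply/verticalP.
  - by apply/row_matrixP.
(* The differential of [F] at [pi q] is the [k]-th basis covector, so [xi q] is the difference of
   the two distinct rows found above. *)
have [F [sF JF]] := manifold_bump (pi q) (delta_mx k 0).
pose h := F \o pi.
have sh : smooth_mfun setT h by exact: (smooth_mfun_pull hs openT sF).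
have Jh r : jac_at h r r = P r *m jac_at F (pi r) (pi r) by exact: (jac_at_base hs sF I).
pose xi := grad_diff g g0 h.
have xiE r : xi r = (jac_at F (pi r) (pi r))^T *m ((P r)^T *m invmx (g r) - (P r)^T *m invmx (g0 r)).
  by rewrite /xi /grad_diff /grad Jh trmx_mul mulmxBr !mulmxA.
have sxi : smooth_field_on setT xi.
  apply: smooth_fieldB; first exact: openT.
    exact: smooth_grad rg openT sh.
  exact: smooth_grad hg0 openT sh.
exists xi; split.
- split=> // p; apply/verticalP; rewrite xiE -mulmxA mulmxBl.
  by rewrite (submersion_metric rg hs) (submersion_metric hg0 hs0) subrr mulmx0.
- exists q; rewrite xiE JF trmx_delta -rowE linearB /= subr_eq0.
  exact/eqP.
move=> x A s X hA hX u Au; set p := s u.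
have [U [E [oU Up fE]]] := vertical_frame_exists hpi rpi hg0 p.
have [sE EV EE] := fE.
(* One frame is orthonormal for both metrics, so both minimality hypotheses apply to it. *)
have fE' : vertical_frame pi g U E.
  by split=> // a b r Ur; rewrite hV ?EE//; exact: EV.
have /(mean_curvature_eq0 pi E p rg) H1 := hmin oU fE' Up.
have /(mean_curvature_eq0 pi E p hg0) H0 := hmin0 oU fE Up.
rewrite (fiber_divergence hpi rpi hA hg0 sxi hX Au (E := fun a => E a p)); last 2 first.
- by move=> a; apply/verticalP; exact: EV.
- by move=> a b; exact: EE.
have key a := variation_identity rg hg0 hgN hs hs0 hV openT sF I oU Up (sE a) (EV a).
have lin (G : M -> 'M[R]_(n + d)) :
    \sum_a levi_civita G (E a) (E a) p *m map_diff pi p = 0 ->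
    \sum_a (levi_civita G (E a) (E a) p *m jac_at (F \o pi) p p) 0 0 = 0.
  move=> e; rewrite -summxE -mulmx_suml -/h Jh mulmxA mulmx_suml e mul0mx mxE //.
apply: oppr_inj; rewrite -sumrN oppr0.
have e a : - inner (half_lie (metric_in_chart g0 (chart_at p))
    (field_in_chart xi (chart_at p)) (chart_at p p)) (E a p) (E a p) =
    (levi_civita g (E a) (E a) p *m jac_at (F \o pi) p p) 0 0 -
    (levi_civita g0 (E a) (E a) p *m jac_at (F \o pi) p p) 0 0.
  exact: esym (key a).
by rewrite (eq_bigr _ (fun a _ => e a)) sumrB !lin// subrr.
Qed.

End VariationField.

(** * From a vertical field to a variation *)

Section Shear.
Variable R : realType.

Definition shear m (w : 'M[R]_(m, 1)) (v : 'rV[R]_m) (t : R) : 'M[R]_m :=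
  1%:M - t *: (w *m v).

Lemma mul_shear k m (X : 'M[R]_(k, m)) w v t : X *m w = 0 -> X *m shear w v t = X.
Proof.
by move=> Xw; rewrite /shear mulmxBr mulmx1 -scalemxAr mulmxA Xw mul0mx scaler0 subr0.
Qed.

Lemma shear_mul k m (P : 'M[R]_(m, k)) w v t : v *m P = 0 -> shear w v t *m P = P.
Proof.
by move=> vP; rewrite /shear mulmxBl mul1mx -scalemxAl -mulmxA vP mulmx0 scaler0 subr0.
Qed.

(** [v *m w = 0] makes [w *m v] square to zero, so shears with opposite parameters are inverse to
    each other. *)
Lemma shearN m (w : 'M[R]_(m, 1)) v t : v *m w = 0 -> shear w v t *m shear w v (- t) = 1%:M.
Proof.
move=> vw; rewrite {1}/shear mulmxBl mul1mx -scalemxAl -mulmxA (mul_shear _ _ vw).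
by rewrite /shear scaleNr opprK addrK.
Qed.

Lemma shear0 m (w : 'M[R]_(m, 1)) v : shear w v 0 = 1%:M.
Proof. by rewrite /shear scale0r subr0. Qed.

Lemma shear_congr m (T T' : 'M[R]_m) w v t : T *m T' = 1%:M ->
  T *m shear w v t *m T' = shear (T *m w) (v *m T') t.
Proof.
move=> TT; rewrite /shear mulmxBr mulmx1 mulmxBl TT -scalemxAr -scalemxAl.
by rewrite !mulmxA.
Qed.

Lemma diff_order_fst (V W : normedModType R) k (A : set (V * W)) : open A ->
  diff_order k A (fun z : V * W => z.1).
Proof.
move=> oA; apply: (diff_order_linear (f := id) (L := @fst V W)) => //.
  by move=> x; exact: cvg_fst.
exact: diff_order_id.
Qed.

Lemma diff_order_snd (V W : normedModType R) k (A : set (V * W)) : open A ->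
  diff_order k A (fun z : V * W => z.2).
Proof.
move=> oA; apply: (diff_order_linear (f := id) (L := @snd V W)) => //.
  by move=> x; exact: cvg_snd.
exact: diff_order_id.
Qed.

Lemma open_setX (V W : topologicalType) (A : set V) (B : set W) :
  open A -> open B -> open (A `*` B).
Proof.
move=> oA oB; have -> : A `*` B = fst @^-1` A `&` snd @^-1` B by [].
apply: openI; apply: open_comp => // x _; [exact: cvg_fst|exact: cvg_snd].
Qed.

End Shear.

(** * The sheared metrics *)

Section ShearedMetric.
Variables (R : realType) (m d : nat) (M : manifold R m) (N : manifold R d).
Variable pi : M -> N.
Variables (g0 : M -> 'M[R]_m) (gN : N -> 'M[R]_d).
Hypotheses (hg0 : riemannian g0) (hs0 : riemannian_submersion pi g0 gN).
Variables (F : N -> 'rV[R]_1) (xi : M -> 'rV[R]_m).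
Hypotheses (sF : smooth_mfun setT F) (hxi : vertical_field pi xi).

Local Notation dom p := (chart_dom (chart_at p)).
Local Notation inv p := (chart_inv (chart_at p)).
Local Notation omega r := (jac_at (F \o pi) r r).

Definition sheared_metric (t : R) r : 'M[R]_m :=
  shear (omega r) (xi r) t *m g0 r *m (shear (omega r) (xi r) t)^T.

Let hpi : smooth_map pi. Proof. by case: hs0. Qed.

Lemma omegaE r : omega r = map_diff pi r *m jac_at F (pi r) (pi r).
Proof. exact: (jac_at_base hs0 sF I). Qed.

Lemma field_map_diff r : xi r *m map_diff pi r = 0.
Proof. by have [_ v] := hxi; apply/verticalP. Qed.

Lemma field_omega r : xi r *m omega r = 0.
Proof. by rewrite omegaE mulmxA field_map_diff mul0mx. Qed.

Lemma vertical_shear r (v : 'rV[R]_m) t : (v <= vertical pi r)%MS ->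
  v *m shear (omega r) (xi r) t = v.
Proof.
move=> /verticalP vP; apply: mul_shear; by rewrite omegaE mulmxA vP mul0mx.
Qed.

Lemma sheared_metric_vertical t r (u v : 'rV[R]_m) :
  (u <= vertical pi r)%MS -> (v <= vertical pi r)%MS ->
  inner (sheared_metric t r) u v = inner (g0 r) u v.
Proof. by move=> uV vV; rewrite inner_mulmx3 !vertical_shear. Qed.

Definition chart_shear p (t : R) (x : 'rV[R]_m) : 'M[R]_m :=
  shear ('J ((F \o pi) \o inv p) x) (field_in_chart xi (chart_at p) x) t.

Let dh p r : dom p r -> differentiable ((F \o pi) \o inv p) (chart_at p r).
Proof.
move=> pr; exact: (smooth_mfun_differentiable (smooth_mfun_pull hs0 openT sF)).
Qed.

Lemma sheared_metric_chart t p r : dom p r ->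
  metric_in_chart (sheared_metric t) (chart_at p) (chart_at p r) =
  chart_shear p t (chart_at p r) *m metric_in_chart g0 (chart_at p) (chart_at p r)
  *m (chart_shear p t (chart_at p r))^T.
Proof.
move=> pr; have rr := chart_atP r; rewrite !metric_chartE// /chart_shear field_chartE//.
have e : 'J ((F \o pi) \o inv p) (chart_at p r) = trans p r r *m omega r.
  have [_ <-] := jac_at_comp pr rr (dh rr); by rewrite jac_at.unlock.
rewrite e -(shear_congr _ _ _ (trans_inv pr rr)) /sheared_metric.
rewrite !trmx_mul !mulmxA -[_ *m trans r p r *m _]mulmxA trans_inv// mulmx1.
by rewrite -[_ *m (trans p r r)^T *m (trans r p r)^T]mulmxA -trmx_mul trans_inv// trmx1 mulmx1.
Qed.

Lemma chart_shear_smooth (V : normedModType R) (A : set V) k p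
    (a : V -> R) (f : V -> 'rV[R]_m) : open A ->
  diff_order k A a -> diff_order k A f ->
  (forall z, A z -> (chart_at p @` (setT `&` dom p)) (f z)) ->
  diff_order k A (fun z => chart_shear p (a z) (f z)).
Proof.
move=> oA sa sf fC; have oC := open_chart_image (p := p) (@openT M).
have [sxi _] := hxi.
have sJ : diff_order k (chart_at p @` (setT `&` dom p))
    (fun x => 'J ((F \o pi) \o inv p) x *m field_in_chart xi (chart_at p) x).
  apply: diff_order_mulmx => //; last exact: sxi.
  apply: diff_order_jacobian => //; exact: (smooth_mfun_pull hs0 openT sF).
apply: diff_orderD => //; first exact: diff_order_cst.
apply: diff_order_opp => //; apply: diff_order_scale => //.
exact: (diff_order_comp oA oC fC sf sJ).
Qed.

Lemma chart_center_image (p : M) : chart_at p @` dom p = chart_at p @` (setT `&` dom p).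
Proof. by rewrite setTI. Qed.

Lemma sheared_metric_riemannian t : riemannian (sheared_metric t).
Proof.
have [sg pg _] := hg0; split=> [r|r v v0|p k].
- exact: gram_sym (sg r).
- apply: gram_pos v0; first exact: pg.
  have [u _] := mulmx1_unit (shearN t (field_omega r)).
  by rewrite row_free_unit.
rewrite chart_center_image; have oC := open_chart_image (p := p) (@openT M).
apply: (@diff_order_eq _ _ _ _ _ (fun x => chart_shear p t x
  *m metric_in_chart g0 (chart_at p) x *m (chart_shear p t x)^T)) => //.
  by move=> _ /set_mem[r [_ pr] <-]; rewrite sheared_metric_chart.
have sS : diff_order k (chart_at p @` (setT `&` dom p)) (chart_shear p t).
  by apply: (@chart_shear_smooth _ _ k p (fun=> t) id) => //;
    [exact: diff_order_cst|exact: diff_order_id].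
apply: diff_order_mulmx => //; last exact: diff_order_trmx.
apply: diff_order_mulmx => //; exact: metric_chart_smooth.
Qed.

Lemma sheared_metric_smooth eps : smooth_family eps sheared_metric.
Proof.
move=> p k; rewrite chart_center_image.
have oC := open_chart_image (p := p) (@openT M); set C := chart_at p @` _ in oC *.
pose A : set (R^o * 'rV[R]_m) := `]- eps, eps[%classic `*` C.
have oA : open A by apply: open_setX => //; exact: interval_open.
apply: (@diff_order_eq _ _ _ _ A (fun z => chart_shear p z.1 z.2
  *m metric_in_chart g0 (chart_at p) z.2 *m (chart_shear p z.1 z.2)^T)) => //.
  by move=> [t _] /set_mem[_ [r [_ pr] /= <-]]; rewrite sheared_metric_chart.
have s2 := @diff_order_snd _ _ _ k A oA.
have AC z : A z -> C z.2 by case.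
have sS : diff_order k A (fun z => chart_shear p z.1 z.2).
  apply: (@chart_shear_smooth _ A k p (fun z => z.1) (fun z => z.2)) => //.
  exact: diff_order_fst.
apply: diff_order_mulmx => //; last exact: diff_order_trmx.
apply: diff_order_mulmx => //.
by apply: (diff_order_comp oA oC AC s2); exact: metric_chart_smooth.
Qed.

(** The shear carries vectors horizontal for the new metric to vectors horizontal for [g0], and does
    not change their image under [pi_*]. *)
Lemma sheared_metric_submersion t : riemannian_submersion pi (sheared_metric t) gN.
Proof.
have [_ rk hor] := hs0; split=> // r X Y.
have AP : shear (omega r) (xi r) t *m map_diff pi r = map_diff pi r.
  exact/shear_mul/field_map_diff.
have hr (Z : 'rV[R]_m) : (Z <= horizontal pi (sheared_metric t) r)%MS ->
    (Z *m shear (omega r) (xi r) t <= horizontal pi g0 r)%MS.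
  move=> /sub_kermxP ZH; apply/sub_kermxP; rewrite -[RHS]ZH /sheared_metric.
  have AV : (shear (omega r) (xi r) t)^T *m (vertical pi r)^T = (vertical pi r)^T.
    rewrite -trmx_mul; congr (_^T); apply: mul_shear.
    by rewrite omegaE mulmxA /vertical mulmx_ker mul0mx.
  by rewrite -[_ *m _^T *m (vertical pi r)^T]mulmxA AV !mulmxA.
move=> /hr XH /hr YH; rewrite /sheared_metric inner_mulmx3 (hor _ _ _ XH YH).
by rewrite -!mulmxA AP.
Qed.

Lemma sheared_metric0 : sheared_metric 0 = g0.
Proof. by apply/funext => r; rewrite /sheared_metric shear0 trmx1 mulmx1 mul1mx. Qed.

(** Pairing with [xi], which the shear fixes, the two metrics differ by [t g0(xi, xi) omega]. *)
Lemma sheared_metric_neq t r : t != 0 -> xi r != 0 -> omega r != 0 ->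
  sheared_metric t r != g0 r.
Proof.
move=> t0 x0 w0; apply/eqP => e; have [sg pg _] := hg0.
have := congr1 (mulmx (xi r)) e.
rewrite /sheared_metric !mulmxA (mul_shear _ _ (field_omega r)).
rewrite /shear linearB /= trmx1 mulmxBr mulmx1 linearZ /= trmx_mul -scalemxAr mulmxA.
move/eqP; rewrite subr_eq addrC -subr_eq subrr eq_sym scaler_eq0 (negPf t0) /=.
rewrite [_ *m (xi r)^T]mx11_scalar mul_scalar_mx scaler_eq0 => /orP[/eqP h|].
  by have := pg r (xi r) x0; rewrite /inner h ltxx.
by rewrite trmx_eq0 (negPf w0).
Qed.

End ShearedMetric.

Lemma mul_congr (R : realType) n k l (T T' A : 'M[R]_n) (a : 'M[R]_(n, k))
    (b : 'M[R]_(n, l)) : T *m T' = 1%:M ->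
  (T *m a)^T *m (T'^T *m A *m T') *m (T *m b) = a^T *m A *m b.
Proof.
move=> TT; have TT' := mulmx1C TT.
have e : T^T *m T'^T = 1%:M by rewrite -trmx_mul TT' trmx1.
rewrite trmx_mul !mulmxA -[a^T *m T^T *m _]mulmxA e mulmx1.
by rewrite -[_ *m T' *m T]mulmxA TT' mulmx1.
Qed.

(** * Minimality of the fibers for the sheared metrics *)

Section ShearedMinimality.
Variables (R : realType) (n d : nat).
Variables (M : manifold R (n + d)) (N : manifold R d) (pi : M -> N).
Variables (g0 : M -> 'M[R]_(n + d)) (gN : N -> 'M[R]_d).
Hypotheses (hg0 : riemannian g0) (hgN : riemannian gN).
Hypotheses (hs0 : riemannian_submersion pi g0 gN) (hmin0 : minimal_fibers pi n g0).
Variables (F : N -> 'rV[R]_1) (xi : M -> 'rV[R]_(n + d)).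
Hypotheses (sF : smooth_mfun setT F) (hxi : vertical_field pi xi).

Local Notation dom p := (chart_dom (chart_at p)).
Local Notation inv p := (chart_inv (chart_at p)).

Let hpi : smooth_map pi. Proof. by case: hs0. Qed.
Let rpi : forall p, \rank (map_diff pi p) = d. Proof. by case: hs0. Qed.

Lemma div_free_trace p (E : 'I_n -> 'rV[R]_(n + d)) :
  div_free_on_fiber pi n g0 xi (pi p) ->
  (forall a, E a *m map_diff pi p = 0) ->
  (forall a b, inner (g0 p) (E a) (E b) = (a == b)%:R) ->
  \sum_a inner (half_lie (metric_in_chart g0 (chart_at p))
    (field_in_chart xi (chart_at p)) (chart_at p p)) (E a) (E a) = 0.
Proof.
have [A [s [u [hs Au <-]]]] := fiber_param_exists hpi rpi p => hdiv EV EE.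
have [_ hA _ rA _] := hs; have [sxi _] := hxi.
(* The pseudo-inverse yields true components because [xi] is vertical, hence in the row space of
   [param_diff s v]. *)
pose X v := xi (s v) *m pinvmx (param_diff s v).
have hX v : A v -> X v *m param_diff s v = xi (s v).
  move=> Av; rewrite /X mulmxKpV//.
  apply: (sub_kernel_basis (rpi (s v))); first by rewrite /row_free rA.
    exact: (param_diff_vertical hpi hs Av).
  exact: field_map_diff hxi _.
have xE : pi (s u) = pi p by have [_ ->] := hA u Au.
rewrite -(fiber_divergence hpi rpi hs hg0 sxi hX Au EV EE).
by rewrite xE in hdiv; exact: (hdiv A s X).
Qed.

(** The function [t g_N(grad phi, grad F)] on [N], as a 1 by 1 matrix so that Jacobians apply to
    it. *)
Definition grad_coef (phi : N -> 'rV[R]_1) (t : R) (y : N) : 'rV[R]_1 :=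
  t *: ((jac_at phi y y)^T *m invmx (gN y) *m jac_at F y y).

Lemma grad_coef_chart phi (y s : N) t : dom y s ->
  differentiable (phi \o inv s) (chart_at s s) ->
  grad_coef phi t s = t *: (('J (phi \o inv y) (chart_at y s))^T *m
    invmx (metric_in_chart gN (chart_at y) (chart_at y s)) *m
    'J (F \o inv y) (chart_at y s)).
Proof.
move=> ys dphi; have ss := chart_atP s.
have dF : differentiable (F \o inv s) (chart_at s s).
  exact: (smooth_mfun_differentiable sF).
have [_ e1] := jac_at_comp ys ss dphi; have [_ e2] := jac_at_comp ys ss dF.
rewrite jac_at.unlock in e1 e2; rewrite /grad_coef jac_at.unlock e1 e2.
rewrite (invmx_metric_chart hgN ys); congr (_ *: _).
exact: (esym (mul_congr _ _ _ (trans_inv ys ss))).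
Qed.

Lemma grad_coef_differentiable phi (V : set N) (y s : N) t : open V ->
  smooth_mfun V phi -> V s -> dom y s ->
  differentiable (grad_coef phi t \o inv y) (chart_at y s).
Proof.
move=> oV sphi Vs ys; have oO := open_chart_image (p := y) oV.
set O := chart_at y @` _ in oO.
have [+ _] : diff_order 1 O (grad_coef phi t \o inv y); last by apply; exists s.
apply: (@diff_order_eq _ _ _ _ _ (fun z => t *: (('J (phi \o inv y) z)^T *m
    invmx (metric_in_chart gN (chart_at y) z) *m 'J (F \o inv y) z))) => //.
  move=> _ /set_mem[r [Vr yr] <-]; rewrite /= chart_mapK// -grad_coef_chart//.
  by apply: (smooth_mfun_differentiable sphi) => //; exact: chart_atP.
apply: (diff_order_scale (a := fun=> t)); [exact: oO|exact: diff_order_cst|].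
have sF' : smooth_on O (F \o inv y).
  by move=> k; apply: diff_order_subset (sF y k) => _ [r [_ yr] <-]; exists r.
apply: diff_order_mulmx => //; last exact: diff_order_jacobian.
apply: diff_order_mulmx => //.
  by apply: diff_order_trmx => //; apply: diff_order_jacobian => //; exact: sphi.
apply: diff_order_invmx => //; last exact: metric_chart_smooth.
by move=> _ [r [_ yr] <-]; exact: metric_chart_unit.
Qed.

Local Notation gt t := (sheared_metric pi g0 F xi t).

(** The inverse of the sheared metric is obtained with the opposite shear, which fixes [P]. What
    remains is [t P^T g0^-1 omega xi], and [P^T g0^-1 P] is the inverse of [gN]. *)
Lemma sheared_grad_diff (V : set N) phi t r : smooth_mfun V phi -> V (pi r) ->
  grad_diff (gt t) g0 (phi \o pi) r = grad_coef phi t (pi r) *m xi r.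
Proof.
move=> sphi Vr; have vP := field_map_diff hxi r.
have vw : xi r *m jac_at (F \o pi) r r = 0 by exact: (field_omega hs0 sF hxi).
rewrite /grad_diff /grad (jac_at_base hs0 sphi Vr) /sheared_metric.
rewrite (invmx_congr (shearN t vw) (riemannian_unit hg0 r)).
rewrite trmx_mul -!mulmxA -mulmxBr /grad_coef -(submersion_metric hg0 hs0).
set P := map_diff pi r; set c := jac_at phi _ _; set S := shear _ _ _.
have PS : P^T *m S^T = P^T by rewrite -trmx_mul (shear_mul _ _ vP).
rewrite [P^T *m (S^T *m _)]mulmxA PS /S /shear (omegaE hs0 sF) scaleNr opprK.
rewrite [invmx (g0 r) *m _]mulmxDr mulmx1 [P^T *m _]mulmxDr addrAC subrr add0r -/P.
by rewrite -!scalemxAl -!scalemxAr !mulmxA.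
Qed.

Lemma sheared_metric_minimal t : (forall x, div_free_on_fiber pi n g0 xi x) ->
  minimal_fibers pi n (gt t).
Proof.
move=> hdiv U E oU [sE EV EE] p Up.
have pp := chart_atP p; have yy := chart_atP (pi p); set y := pi p in yy.
have hV r (u v : 'rV[R]_(n + d)) := @sheared_metric_vertical _ _ _ _ _ _ _ _ hs0 F xi sF t r u v.
have hgt := sheared_metric_riemannian hg0 hs0 sF hxi t.
have hst := sheared_metric_submersion hs0 sF hxi t.
have fE0 : vertical_frame pi g0 U E.
  by split=> // a b r Ur; rewrite -(EE a b r Ur) hV//; exact: EV.
have [_ _ EE0] := fE0.
have /(mean_curvature_eq0 pi E p hg0) H0 := hmin0 oU fE0 Up.
apply/(mean_curvature_eq0 pi E p hgt); apply/rowP => k; rewrite [RHS]mxE.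
(* The [k]-th coordinate near [pi p]: pairing with its differential extracts the [k]-th entry of the
   projected mean curvature. *)
pose phi r : 'rV[R]_1 := chart_at y r *m (delta_mx k 0 : 'M[R]_(d, 1)).
have oV : open (dom y) by exact: chart_dom_open.
have sphi : smooth_mfun (dom y) phi.
  move=> q l; have oq := open_chart_image (p := q) oV.
  apply: diff_order_mulmx => //; last exact: diff_order_cst.
  exact: smooth_chart.
have Jphi : jac_at phi y y = delta_mx k 0.
  have dy : differentiable (chart_at y \o inv y) (chart_at y y).
    exact: (smooth_mfun_differentiable (@smooth_chart _ _ _ y)).
  rewrite jac_at.unlock; apply: etrans (jacobian_mulmxr (delta_mx k 0 : 'M[R]_(d, 1)) dy) _.
  have := trans_id yy; rewrite /trans jac_at.unlock => ->; exact: mul1mx.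
have Jphi' : jac_at (phi \o pi) p p = map_diff pi p *m delta_mx k 0.
  by rewrite (jac_at_base hs0 sphi yy) -/y Jphi.
have entry (v : 'rV[R]_d) : (v *m (delta_mx k 0 : 'M[R]_(d, 1))) 0 0 = v 0 k.
  by rewrite -colE mxE.
have sumE (G : M -> 'M[R]_(n + d)) : (\sum_a levi_civita G (E a) (E a) p *m map_diff pi p) 0 k =
    \sum_a (levi_civita G (E a) (E a) p *m jac_at (phi \o pi) p p) 0 0.
  by rewrite summxE; apply: eq_bigr => a _; rewrite Jphi' mulmxA entry.
have key a := variation_identity hgt hg0 hgN hst hs0 hV oV sphi yy oU Up (sE a) (EV a).
have H0' := sumE g0; rewrite H0 mxE in H0'.
rewrite sumE -[LHS]subr0 [X in _ - X]H0' -sumrB (eq_bigr _ (fun a _ => key a)) sumrN.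
apply/eqP; rewrite oppr_eq0; apply/eqP.
(* Factoring through [pi] gives zero derivative along vertical vectors, so [half_lieZ] takes this
   coefficient out of the trace. *)
pose Phi := (grad_coef phi t \o pi) \o inv p.
have dcoef := grad_coef_differentiable t oV sphi yy yy.
have [dPhi JPhi] := jac_at_pull hpi pp yy dcoef.
have DPhi a : 'D_(E a p) Phi (chart_at p p) = 0.
  rewrite (deriveEjacobian _ dPhi); rewrite jac_at.unlock in JPhi.
  have /verticalP := EV a p Up; rewrite map_diffE jac_at.unlock => e.
  by rewrite JPhi mulmxA e mul0mx.
pose xh := field_in_chart xi (chart_at p).
have oC := open_chart_image (p := p) (@openT M).
have Cp : (chart_at p @` (setT `&` dom p)) (chart_at p p) by exists p.
have dxh : differentiable xh (chart_at p p).
  by have [sxi _] := hxi; have [+ _] := sxi p 1%N; apply.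
have dG : differentiable (metric_in_chart g0 (chart_at p)) (chart_at p p).
  by have [+ _] := @metric_chart_smooth _ _ _ g0 hg0 p setT 1%N; apply.
have e : \forall x \near chart_at p p, Phi x *m xh x =
    field_in_chart (grad_diff (gt t) g0 (phi \o pi)) (chart_at p) x.
  apply: filterS (near_chart (open_preimage_dom hpi y) yy pp) => x [h1 h2 h3].
  by rewrite /Phi /xh /field_in_chart /= (sheared_grad_diff t sphi h1) mulmxA.
have hl := near_eq_half_lie (metric_in_chart g0 (chart_at p)) e (differentiable_mulmx dPhi dxh).
have term a : inner (half_lie (metric_in_chart g0 (chart_at p))
    (field_in_chart (grad_diff (gt t) g0 (phi \o pi)) (chart_at p)) (chart_at p p))
    (E a p) (E a p) = Phi (chart_at p p) 0 0 *
    inner (half_lie (metric_in_chart g0 (chart_at p)) xh (chart_at p p)) (E a p) (E a p).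
  apply: etrans (half_lieZ (E a p) dxh dPhi dG (DPhi a)).
  exact: (congr1 (fun H => inner H (E a p) (E a p)) (esym hl)).
have h := @div_free_trace p (fun a => E a p) (hdiv _)
  (fun a => (verticalP pi p _).1 (EV a p Up)) (fun a b => EE0 a b p Up).
rewrite (eq_bigr _ (fun a _ => term a)) -mulr_sumr.
apply: etrans (congr1 ( *%R (Phi (chart_at p p) 0 0)) h) _; exact: mulr0.
Qed.

End ShearedMinimality.

Theorem theorem3p14 (R : realType) (n d : nat) (hd : (0 < d)%N)
    (M : manifold R (n + d)) (N : manifold R d) (pi : M -> N)
    (g0 : M -> 'M[R]_(n + d)) (gN : N -> 'M[R]_d)
    (hg0 : riemannian g0) (hgN : riemannian gN)
    (hpi : riemannian_submersion pi g0 gN)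
    (hmin : minimal_fibers pi n g0) :
  ((exists (eps : R) (g : R -> M -> 'M[R]_(n + d)),
      nontrivial_variation pi g0 eps g /\
      forall t, t \in `]- eps, eps[ ->
        riemannian_submersion pi (g t) gN /\ minimal_fibers pi n (g t)) ->
   exists xi : M -> 'rV[R]_(n + d),
     [/\ vertical_field pi xi, nontrivial_field xi
       & forall x : N, div_free_on_fiber pi n g0 xi x])
  /\
  ((exists xi : M -> 'rV[R]_(n + d),
     [/\ vertical_field pi xi, nontrivial_field xi, bounded_field g0 xi
       & forall x : N, div_free_on_fiber pi n g0 xi x]) ->
   exists (eps : R) (g : R -> M -> 'M[R]_(n + d)),
      nontrivial_variation pi g0 eps g /\
      forall t, t \in `]- eps, eps[ ->
        riemannian_submersion pi (g t) gN /\ minimal_fibers pi n (g t)).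
Proof.
split=> [[eps [g [[eps0 hR _ gz [t tI gt]] hall]]]|[xi [hxi [p0 x0] _ hdiv]]].
  have [hst hmt] := hall t tI.
  exact: (variation_field (hR t tI) hg0 hgN hst hmt hpi hmin gt).
(* [hd] supplies a nonzero covector at [pi p0]; its pull-back is nonzero since [map_diff] has rank
   [d]. *)
have [F [sF JF]] := manifold_bump (pi p0) (delta_mx (Ordinal hd) 0).
(* The shears are invertible for every [t], so the radius 1 is an arbitrary choice, as is the
   parameter 1/2 that shows non-triviality below. *)
exists 1, (sheared_metric pi g0 F xi); split; last first.
  move=> t _; split; first exact: (sheared_metric_submersion hpi sF hxi t).
  exact: (sheared_metric_minimal hg0 hgN hpi hmin sF hxi hdiv).
split.
- exact: ltr01.
- move=> t _; split; first exact: (sheared_metric_riemannian hg0 hpi sF hxi t).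
  by move=> p X Y; exact: (sheared_metric_vertical hpi xi sF).
- exact: (sheared_metric_smooth hg0 hpi sF hxi).
- exact: sheared_metric0.
exists 2^-1; first by rewrite in_itv /=; apply/andP; split; lra.
move=> /(congr1 (fun g => g p0)); apply/eqP.
apply: (sheared_metric_neq hg0 hpi sF hxi); [by rewrite invr_eq0 pnatr_eq0|exact: x0|].
have [_ rpi _] := hpi; rewrite (omegaE hpi sF) JF; apply/eqP => /(congr1 trmx).
rewrite trmx_mul trmx0 trmx_delta => /(row_free_mul (rpi p0)) /matrixP/(_ 0 (Ordinal hd)).
by rewrite !mxE !eqxx => /eqP; rewrite oner_eq0.
Qed.
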